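(* For every $\xi_0\in W^{1,\infty}(\mathbb S^1;\mathbb R^d)$ with $|\partial_s\xi_0(s)|\le1$ for a.e. $s\in\mathbb S^1$, there exists a global in time generalized solution $(\xi,\sigma)$ to the normalized uniformly compressing curve-shortening flow with initial datum $\xi_0$, and moreover $\sigma(t,s)\ge0$ for almost every $(t,s)\in Q_\infty$.
   Context: $\mathbb S^1=\mathbb R/\mathbb Z$, $d\ge2$, $Q_\infty=(0,\infty)\times\mathbb S^1$. Given $\xi_0$ as in the claim, a pair $(\xi,\sigma)$ is a generalized solution if: (i) $\xi\in L^\infty_{loc}([0,\infty);W^{1,\infty}(\mathbb S^1))^d$, $\partial_t\xi\in L^2_{loc}([0,\infty);L^2(\mathbb S^1))^d$, $\sigma\in L^2_{loc}([0,\infty);H^1(\mathbb S^1))$ and $\sigma\partial_s\xi\in L^2_{loc}([0,\infty);H^1(\mathbb S^1))^d$; (ii) for a.e. $(t,s)\in Q_\infty$: $\partial_t\xi=\partial_s(\sigma\partial_s\xi)+\xi$, $\sigma(|\partial_s\xi|^2-1)=0$, $|\partial_s\xi|\le1$, and $\xi(0,s)=\xi_0(s)$ for a.e. $s$; (iii) for a.e. $t\in(0,\infty)$, $\int_{\mathbb S^1}|\partial_t\xi(t,s)|^2ds\le\int_{\mathbb S^1}\xi(t,s)\cdot\partial_t\xi(t,s)\,ds$. *)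

(* Defs.v *)
From HB Require Import structures.
From mathcomp Require Import all_boot all_order all_algebra.
From mathcomp Require Import all_classical all_reals all_analysis.
Set Implicit Arguments.
Unset Strict Implicit.
Unset Printing Implicit Defensive.
Import Order.TTheory GRing.Theory Num.Theory.
Import numFieldNormedType.Exports.
Local Open Scope classical_set_scope.
Local Open Scope ring_scope.

Section NUCSF.
Variable R : realType.
Local Notation mu := (@lebesgue_measure R).
Local Notation mu2 := ((@lebesgue_measure R) \x (@lebesgue_measure R))%E.

(** S^1 = R/Z : functions on S^1 are 1-periodic functions on R. *)
Definition periodic1 (f : R -> R) : Prop := forall s, f (s + 1) = f s.

(** [g] is an integrable-on-compacts derivative of [f] on [a, +oo[,
    i.e. [f] is locally absolutely continuous there with a.e. derivative [g]. *)
Definition AC_from (a : R) (f g : R -> R) : Prop :=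
  forall b c, a <= b -> b <= c ->
    mu.-integrable `[b, c] (EFin \o g) /\
    f c - f b = \int[mu]_(x in `[b, c]) g x.

Definition AC_loc (f g : R -> R) : Prop :=
  forall b c, b <= c ->
    mu.-integrable `[b, c] (EFin \o g) /\
    f c - f b = \int[mu]_(x in `[b, c]) g x.

Definition sqnorm d (v : 'I_d -> R) : R := \sum_(i < d) v i ^+ 2.
Definition dotp d (v w : 'I_d -> R) : R := \sum_(i < d) v i * w i.

(** Space-time cylinders (0,T) x S^1 and Q_oo = (0,oo) x S^1, S^1 represented by [0,1]. *)
Definition QT (T : R) : set (R * R) := `]0, T[ `*` `[0, 1].
Definition Qinf : set (R * R) := `]0, +oo[ `*` `[0, 1].

Definition uncurry2 (f : R -> R -> R) : R * R -> R := fun p => f p.1 p.2.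

Definition L2loc (f : R -> R -> R) : Prop :=
  measurable_fun setT (uncurry2 f) /\
  forall T, 0 < T ->
    (\int[mu2]_(p in QT T) ((uncurry2 f p) ^+ 2)%:E < +oo)%E.

Definition Linfloc (f : R -> R -> R) : Prop :=
  measurable_fun setT (uncurry2 f) /\
  forall T, 0 < T -> exists C : R,
    {ae mu2, forall p, QT T p -> `|uncurry2 f p| <= C}.

(** Generalized solution of the normalized uniformly compressing
    curve-shortening flow with initial datum xi0 (Definition in context).
    The space derivatives, the time derivative and the space derivative of
    sigma * d_s xi are given by explicit (representative) functions:
    xis = d_s xi, xit = d_t xi, sigs = d_s sigma, rho = sigma d_s xi,
    tau = d_s (sigma d_s xi). *)
Definition generalized_solution d (xi0 : 'I_d -> R -> R)
    (xi : 'I_d -> R -> R -> R) (sigma : R -> R -> R) : Prop :=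
  exists (xis xit : 'I_d -> R -> R -> R) (sigs : R -> R -> R)
         (rho tau : 'I_d -> R -> R -> R),
  (* xi in L^oo_loc([0,oo); W^{1,oo}(S^1))^d *)
  ((forall i t, periodic1 (xi i t)) /\
   (forall i, Linfloc (xi i) /\ Linfloc (xis i)) /\
   {ae mu, forall t, 0 < t -> forall i, AC_loc (xi i t) (xis i t)} /\
  (* d_t xi in L^2_loc([0,oo); L^2(S^1))^d *)
   (forall i, L2loc (xit i)) /\
   {ae mu, forall s, forall i, AC_from 0 (fun t => xi i t s) (fun t => xit i t s)} /\
  (* sigma in L^2_loc([0,oo); H^1(S^1)) *)
   (forall t, periodic1 (sigma t)) /\ L2loc sigma /\ L2loc sigs /\
   {ae mu, forall t, 0 < t -> AC_loc (sigma t) (sigs t)} /\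
  (* sigma d_s xi in L^2_loc([0,oo); H^1(S^1))^d *)
   (forall i, [/\ forall t, periodic1 (rho i t), L2loc (rho i), L2loc (tau i),
        {ae mu2, forall p, Qinf p ->
           rho i p.1 p.2 = sigma p.1 p.2 * xis i p.1 p.2}
      & {ae mu, forall t, 0 < t -> AC_loc (rho i t) (tau i t)}])) /\
  [/\ {ae mu2, forall p, Qinf p ->
         forall i, xit i p.1 p.2 = tau i p.1 p.2 + xi i p.1 p.2},
      {ae mu2, forall p, Qinf p ->
         sigma p.1 p.2 * (sqnorm (fun i => xis i p.1 p.2) - 1) = 0},
      {ae mu2, forall p, Qinf p -> sqnorm (fun i => xis i p.1 p.2) <= 1}
    & {ae mu, forall s, [set` `[0, 1]] s -> forall i, xi i 0 s = xi0 i s}] /\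
  {ae mu, forall t, 0 < t ->
     \int[mu]_(s in `[0, 1]) sqnorm (fun i => xit i t s)
     <= \int[mu]_(s in `[0, 1]) dotp (fun i => xi i t s) (fun i => xit i t s)}.

End NUCSF.

(* Main.v *)
Require Import Defs.
From HB Require Import structures.
From mathcomp Require Import all_boot all_order all_algebra.
From mathcomp Require Import all_classical all_reals all_analysis.
From mathcomp Require Import measurable_realfun ring lra.
Set Implicit Arguments.
Unset Strict Implicit.
Unset Printing Implicit Defensive.
Import Order.TTheory GRing.Theory Num.Theory.
Import numFieldNormedType.Exports.
Local Open Scope classical_set_scope.
Local Open Scope ring_scope.

(** The flow is the gradient flow of [- |xi|^2 / 2] in [L^2] constrained to the
convex set [K] of periodic 1-Lipschitz curves. The catching-up scheme
[x -> P_K (e^h x)], [h = 2^-n], converges to a path [X] in [K] satisfying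
[|X b - w| <= |e^(b-a) X a - w|] for [w] in [K] (whence [f := xi - xi_t] lies
in the normal cone of [K] at [xi] for a.e. [t]) and
[|X b - X a|^2 <= (b-a)/2 (|X b|^2 - |X a|^2)] (which is (iii) in the limit).
The derivatives of [xi] are obtained as limits of dyadic difference quotients,
which form [L^2]-bounded martingales.

For a fixed time let [F' = - f]. Testing the normal cone with primitives of the
unit directions of [F - c], where [c] minimizes [c |-> int |F - c|], turns
Cauchy-Schwarz into an equality, so [F - c = |F - c| xi_s]; hence
[sigma := |F - c|]. The minimizer [c] is unique and the problem is well posed,
so [c] is a limit of minimizers over finitely many rational vectors, hence
measurable in time. *)

(** * Moreau's catching-up scheme in a Hilbert space *)

(** Stability rests instead on two facts: the growth is an exact dilation, and [K] is star-shaped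
    about 0, so growth factors can be moved onto test points. The scheme enforces only |xi_s| <= 1;
    the tension is recovered afterwards as a multiplier. At a fixed time this is an L^1 duality: the
    maximum of int F . n over mean-zero fields with |n| <= 1 equals the minimum over constants c of
    int |F - c|, mean zero being the condition that a primitive of n closes up. Unit directions of F
    - c break down where F = c, so the minimization is first smoothed by a parameter e > 0. Three
    derivatives must be jointly measurable: those of xi in s and in t, and that of sigma in s. All
    come from one statement on quotients with a parameter, whose error is dominated by a single
    function H of finite integral. Slicing H in one order gives absolute continuity, in the other
    strong L^2 convergence of the quotients at a.e. fixed point; with time as that point, quadratic
    expressions in the velocity pass to the limit. *)

Lemma expR_sub1_le (R : realType) (h : R) : 0 <= h <= 2^-1 ->
  h <= expR h - 1 <= h + 2 * h ^+ 2.
Proof.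
move=> /andP[h0 h1]; apply/andP; split; first by have := expR_ge1Dx h; lra.
have := expR_ge1Dx (- h); have := expR_gt0 h; have := expRxMexpNx_1 h.
by move: (expR h) (expR (- h)) => e i; nra.
Qed.

Definition dyadic_step (R : realType) n : R := 2^-1 ^+ n.

Section DyadicStep.
Variable R : realType.
Local Notation h := (@dyadic_step R).

Lemma dyadic_step_gt0 n : 0 < h n.
Proof. by rewrite exprn_gt0. Qed.
Lemma dyadic_step_ge0 n : 0 <= h n. Proof. exact/ltW/dyadic_step_gt0. Qed.
Lemma dyadic_stepS n : h n = 2 * h n.+1.
Proof. by rewrite /dyadic_step exprS; lra. Qed.
Lemma dyadic_step_le_half n : 0 <= h n.+1 <= 2^-1.
Proof.
rewrite dyadic_step_ge0 /dyadic_step exprS ger_pMr//.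
by rewrite exprn_ile1//; lra.
Qed.
Lemma cvg_dyadic_step : h n @[n --> \oo] --> 0.
Proof. by apply: cvg_expr; rewrite ger0_norm //; lra. Qed.
Lemma dyadic_stepV n : h n * 2 ^+ n = 1.
Proof. by rewrite /dyadic_step -exprMn mulVf ?expr1n. Qed.

Lemma truncn_dyadic n (t : R) : 0 <= t ->
  (Num.truncn (t * 2 ^+ n))%:R * h n <= t < (Num.truncn (t * 2 ^+ n))%:R * h n + h n.
Proof.
move=> t0; have /truncn_itv : 0 <= t * 2 ^+ n by rewrite mulr_ge0 ?exprn_ge0.
rewrite -[(Num.truncn _).+1%:R]natr1; move: (Num.truncn _)%:R => k /andP[k1 k2].
have := dyadic_step_gt0 n; have := dyadic_stepV n.
move: (h n) (2 ^+ n) k1 k2 => a b k1 k2 e a0.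
have tE : t = t * b * a by rewrite -mulrA (mulrC b) e mulr1.
apply/andP; split; rewrite tE; first by rewrite ler_pM2r.
by rewrite (_ : k * a + a = (k + 1) * a) ?ltr_pM2r//; ring.
Qed.
End DyadicStep.

Section Sweeping.
Variables (R : realType) (V : lmodType R) (ip : V -> V -> R).
Hypothesis ipC : forall x y, ip x y = ip y x.
Hypothesis ipDl : forall x y z, ip (x + y) z = ip x z + ip y z.
Hypothesis ipZl : forall a x z, ip (a *: x) z = a * ip x z.
Hypothesis ip_ge0 : forall x, 0 <= ip x x.

(** For curves the inner product is [cdot], which vanishes on every curve that is 0 on [0, 1];
    limits are therefore determined only up to seminorm 0. *)
Definition seminorm x := Num.sqrt (ip x x).
Local Notation nrm := seminorm.

Lemma ipDr x y z : ip z (x + y) = ip z x + ip z y.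
Proof. by rewrite ipC ipDl !(ipC z). Qed.
Lemma ipZr a x z : ip z (a *: x) = a * ip z x.
Proof. by rewrite ipC ipZl ipC. Qed.
Lemma ipNl x z : ip (- x) z = - ip x z.
Proof. by rewrite -scaleN1r ipZl mulN1r. Qed.
Lemma ipNr x z : ip z (- x) = - ip z x.
Proof. by rewrite ipC ipNl ipC. Qed.
Definition ipE := (ipDl, ipDr, ipZl, ipZr, ipNl, ipNr).

Lemma ip_subZ x y l :
  ip (x - l *: y) (x - l *: y) = ip x x - 2 * l * ip x y + l ^+ 2 * ip y y.
Proof. by rewrite !ipE (ipC y x); ring. Qed.

Lemma nrm_ge0 x : 0 <= nrm x. Proof. exact: sqrtr_ge0. Qed.
Lemma nrmE x : nrm x ^+ 2 = ip x x. Proof. by rewrite sqr_sqrtr. Qed.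

Lemma le_nrm x y : (nrm x <= nrm y) = (ip x x <= ip y y).
Proof. by rewrite -!nrmE ler_sqr ?nnegrE ?nrm_ge0. Qed.

Lemma ip_le x y : ip x y <= nrm x * nrm y.
Proof.
have [|e0] := eqVneq (nrm x * nrm y) 0; last first.
  move: e0; rewrite mulf_eq0 negb_or => /andP[nx ny].
  have px : 0 < nrm x by rewrite lt_neqAle eq_sym nx nrm_ge0.
  have py : 0 < nrm y by rewrite lt_neqAle eq_sym ny nrm_ge0.
  have := ip_ge0 (nrm y *: x - nrm x *: y).
  rewrite !ipE (ipC y x) -!nrmE => h.
  have p : 0 < nrm x * nrm y by exact: mulr_gt0.
  by rewrite -(ler_pM2l p); move: h; lra.
move=> e0; rewrite e0; move/eqP: e0; rewrite mulf_eq0 => e0.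
have {e0}[] : ip x x = 0 \/ ip y y = 0.
  by case/orP: e0 => /eqP h; [left|right]; rewrite -nrmE h expr0n.
- move=> xx; rewrite leNgt; apply/negP => p.
  (* With A = [ip x y] and B = [ip y y] this reads - A^2 (B + 2) >= 0; the added 1 covers B = 0. *)
  have := ip_ge0 ((ip y y + 1) *: x - ip x y *: y).
  have := ip_ge0 y.
  by rewrite !ipE (ipC y x) xx => ? ?; nra.
- move=> yy; rewrite leNgt; apply/negP => p.
  have := ip_ge0 (ip x y *: x - (ip x x + 1) *: y).
  have := ip_ge0 x.
  by rewrite !ipE (ipC y x) yy => ? ?; nra.
Qed.

Lemma nrmD x y : nrm (x + y) <= nrm x + nrm y.
Proof.
rewrite -ler_sqr ?nnegrE ?addr_ge0 ?nrm_ge0// nrmE !ipE (ipC y x) -!nrmE.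
by have := ip_le x y; lra.
Qed.

Lemma nrmZ a x : nrm (a *: x) = `|a| * nrm x.
Proof.
by rewrite /nrm !ipE mulrA -expr2 sqrtrM ?sqr_ge0// sqrtr_sqr.
Qed.

Lemma nrm0 : nrm 0 = 0.
Proof. by rewrite -(scale0r 0) nrmZ normr0 mul0r. Qed.

Lemma nrm_scaleB a x : 0 <= a - 1 -> nrm (a *: x - x) = (a - 1) * nrm x.
Proof. by move=> a1; rewrite -{2}[x]scale1r -scalerBl nrmZ ger0_norm. Qed.

Lemma nrmN x : nrm (- x) = nrm x.
Proof. by rewrite -scaleN1r nrmZ normrN1 mul1r. Qed.

Lemma nrm_distC x y : nrm (x - y) = nrm (y - x).
Proof. by rewrite -nrmN opprB. Qed.

Lemma nrm_tri z x y : nrm (x - y) <= nrm (x - z) + nrm (z - y).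
Proof. by rewrite -[x - y](subrKA z) nrmD. Qed.

Lemma nrm_dist x y : `|nrm x - nrm y| <= nrm (x - y).
Proof.
rewrite ler_norml; apply/andP; split.
  by have := nrm_tri x y 0; rewrite !subr0 nrm_distC; lra.
by have := nrm_tri y x 0; rewrite !subr0; lra.
Qed.

(* [a] is one step of length [2h] (the projection of [X]); [b] is reached in two
   steps of length [h]: [c] is the rescaled intermediate point, [b] its projection. *)
Lemma catching_up_step X Y a b c :
  ip (X - a) (b - a) <= 0 -> ip (Y - c) (a - c) <= 0 ->
  ip (c - b) (a - b) <= 0 ->
  ip (a - b) (a - b) <= ip (X - Y) (X - Y) + 2 * (nrm (c - b) * nrm (Y - c)).
Proof.
move=> h1 h2 h3.
(* The nonexpansiveness estimate for two projections. The defect left over pairs the residuals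
   [c - b] and [Y - c] of the two half steps, so it is of second order in the step, and of first
   order after summation over all steps. *)
have h4 := ip_ge0 ((X - a) - (Y - b)).
have h5 := ip_le (c - b) (Y - c).
suff: ip (a - b) (a - b) <= ip (X - Y) (X - Y) + 2 * ip (c - b) (Y - c) by lra.
clear h5; move: h1 h2 h3 h4; rewrite !ipE.
rewrite (ipC X Y) (ipC a b) (ipC X a) (ipC X b) (ipC Y a) (ipC Y b) (ipC c a)
  (ipC c b) (ipC Y c).
by lra.
Qed.

Variable K : set V.
Hypothesis K0 : K 0.
Hypothesis Kconv : forall (l : R) x y, 0 <= l <= 1 -> K x -> K y ->
  K (l *: x + (1 - l) *: y).
Hypothesis Kcomplete : forall u : nat -> V, (forall n, K (u n)) ->
  (forall e : R, 0 < e -> exists N, forall m n, (N <= m)%N -> (N <= n)%N ->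
     nrm (u m - u n) < e) ->
  exists2 x, K x & nrm (u n - x) @[n --> \oo] --> 0.

Lemma Kscale (l : R) x : 0 <= l <= 1 -> K x -> K (l *: x).
Proof. by move=> l01 Kx; have := Kconv l01 Kx K0; rewrite scaler0 addr0. Qed.

Lemma projection_exists y : exists2 x, K x & forall w, K w -> nrm (y - x) <= nrm (y - w).
Proof.
pose S := [set nrm (y - w) | w in K].
have S0 : S !=set0 by exists (nrm (y - 0)), 0.
have Slb : has_lbound S by exists 0 => _ [w _ <-]; exact: nrm_ge0.
pose m := inf S.
have m_ge0 : 0 <= m by apply: lb_le_inf => // _ [w _ <-]; exact: nrm_ge0.
have m_le w : K w -> m <= nrm (y - w) by move=> Kw; apply: ge_inf => //; exists w.
have /choice[u Hu] n : exists w, K w /\ nrm (y - w) < m + n.+1%:R^-1.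
  have /(inf_adherent) : 0 < n.+1%:R^-1 :> R by [].
  by case/(_ S (conj S0 Slb)) => _ [w Kw <-] h; exists w.
have par i j : ip (u i - u j) (u i - u j) <=
    2 * (ip (y - u i) (y - u i) - m ^+ 2) + 2 * (ip (y - u j) (y - u j) - m ^+ 2).
  have Kh : K (2^-1 *: u i + (1 - 2^-1) *: u j).
    by apply: Kconv; [lra|apply (Hu i)|apply (Hu j)].
  have := m_le _ Kh; rewrite -ler_sqr ?nnegrE ?nrm_ge0// nrmE.
  rewrite !ipE (ipC (u j) (u i)) (ipC y (u i)) (ipC y (u j)).
  by lra.
have est n : ip (y - u n) (y - u n) - m ^+ 2 <= (2 * m + 1) * n.+1%:R^-1.
  have [_ h] := Hu n; rewrite -nrmE.
  have n0 : 0 < n.+1%:R^-1 :> R by [].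
  have n1 : n.+1%:R^-1 <= 1 :> R by rewrite invf_le1// ler1n.
  have : nrm (y - u n) ^+ 2 <= (m + n.+1%:R^-1) ^+ 2.
    by rewrite ler_sqr ?nnegrE ?nrm_ge0 ?addr_ge0// ltW.
  have : n.+1%:R^-1 * n.+1%:R^-1 <= n.+1%:R^-1 :> R by rewrite ger_pMr.
  move: (n.+1%:R^-1) => i ? ?; lra.
have cau : forall e : R, 0 < e -> exists N, forall p q, (N <= p)%N -> (N <= q)%N ->
     nrm (u p - u q) < e.
  move=> e e0.
  pose C := 4 * (2 * m + 1).
  have C0 : 0 < C by rewrite /C; lra.
  exists (Num.truncn (C / e ^+ 2)) => p q hp hq.
  rewrite -ltr_sqr ?nnegrE ?nrm_ge0 ?ltW// nrmE; apply: (le_lt_trans (par p q)).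
  have key k : (Num.truncn (C / e ^+ 2) <= k)%N -> (2 * m + 1) * k.+1%:R^-1 < e ^+ 2 / 4.
    move=> hk.
    rewrite ltr_pdivrMr//.
    have : C / e ^+ 2 < k.+1%:R.
      apply: (lt_le_trans (truncnS_gt _)).
      by rewrite ler_nat ltnS.
    by rewrite ltr_pdivrMr ?exprn_gt0// /C; lra.
  move: (est p) (est q) (key _ hp) (key _ hq); move: (_ / p.+1%:R) (_ / q.+1%:R) => ? ?; lra.
have [x Kx ux] := Kcomplete (fun n => (Hu n).1) cau.
exists x => // w Kw; apply: le_trans (m_le _ Kw).
apply/ler_addgt0Pr => /= e e0.
have e2 : 0 < e / 2 by lra.
have h1 : \forall n \near \oo, nrm (u n - x) < e / 2.
  move/cvgrPdist_lt: ux => /(_ _ e2); apply: filterS => n.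
  by rewrite sub0r normrN ger0_norm ?nrm_ge0.
have h2 : \forall n \near \oo, n.+1%:R^-1 < e / 2 :> R.
  exact: (near_infty_natSinv_lt (PosNum e2)).
near \oo => n.
have := nrm_tri (u n) y x.
have [_] := Hu n.
have : nrm (u n - x) < e / 2 by near: n.
have : n.+1%:R^-1 < e / 2 :> R by near: n.
by move: (n.+1%:R^-1) => i; lra.
Unshelve. all: by end_near.
Qed.

Definition proj y : V := sval (cid2 (projection_exists y)).
Lemma projK y : K (proj y).
Proof. by rewrite /proj; case: cid2. Qed.

Lemma proj_var y w : K w -> ip (y - proj y) (w - proj y) <= 0.
Proof.
move=> Kw; rewrite leNgt; apply/negP => p.
set a := proj y in p *.
have min : forall w, K w -> nrm (y - a) <= nrm (y - w) by rewrite /a/proj; case: cid2.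
set B := ip (w - a) (w - a); set A := ip _ _ in p.
have B0 : 0 <= B by exact: ip_ge0.
(* Moving from [a] towards [w] by [l] lowers the distance as soon as l B < 2 A; this choice also
   lies in ]0, 1], even when B = 0. *)
pose l := A / (A + B).
have AB : 0 < A + B by lra.
have l0 : 0 < l by rewrite divr_gt0.
have l1 : l <= 1 by rewrite ler_pdivrMr//; lra.
have lE : l * (A + B) = A by rewrite divfK// gt_eqF.
have l01 : 0 <= l <= 1 by rewrite l1 ltW.
have := min _ (Kconv l01 Kw (projK y)).
rewrite -/a le_nrm.
have -> : y - (l *: w + (1 - l) *: a) = (y - a) - l *: (w - a).
  by rewrite scalerBl scalerBr scale1r addrCA opprD addrA.
move: l l0 l1 lE {l01} => l l0 l1 lE.
rewrite (ip_subZ (y - a)) -/A -/B.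
move=> h.
have : 2 * l * A <= l ^+ 2 * B by lra.
rewrite expr2 -mulrA -mulrA mulrCA ler_pM2l// => h2.
nra.
Qed.

Lemma proj_min y w : K w -> nrm (y - proj y) <= nrm (y - w).
Proof. by rewrite /proj; case: cid2 => x ? h; exact: h. Qed.

Lemma proj_nrm y w : K w -> nrm (proj y - w) <= nrm (y - w).
Proof.
move=> Kw; rewrite le_nrm.
have h1 := ip_ge0 (y - proj y); have := proj_var y Kw.
move: h1; rewrite !ipE (ipC w (proj y)) (ipC (proj y) y) (ipC y w); lra.
Qed.

(** Multiplication by [expR h] is the exact flow of x' = x, so the growth of successive steps
    composes without error; this is why [scheme_evi] involves only the total time. *)
Definition stp (h : R) x := proj (expR h *: x).
Definition scheme h x0 k := iter k (stp h) x0.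

Lemma schemeS h x0 k : scheme h x0 k.+1 = stp h (scheme h x0 k).
Proof. by []. Qed.

Variable x0 : V.
Hypothesis Kx0 : K x0.

Lemma schemeK h k : K (scheme h x0 k).
Proof. by case: k => [//|k]; exact: projK. Qed.

Lemma schemeD h k m : scheme h x0 (k + m) = scheme h (scheme h x0 k) m.
Proof. by rewrite /scheme addnC iterD. Qed.

Lemma expRN_in01 (h : R) : 0 <= h -> 0 <= expR (- h) <= 1.
Proof. by move=> h0; rewrite expR_ge0 -expR0 ler_expR oppr_le0. Qed.

(** As [K] is star-shaped about 0, [expR (- h) *: w] is again in [K]: the growth factor of the last
    step is moved onto the test point and the induction hypothesis is applied there. *)
Lemma scheme_evi h x m w : 0 <= h -> K w ->
  nrm (scheme h x m - w) <= nrm (expR (m%:R * h) *: x - w).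
Proof.
move=> h0; elim: m w => [|m IH] w Kw.
  by rewrite mul0r expR0 scale1r.
rewrite schemeS; apply: (le_trans (proj_nrm _ Kw)).
have -> : expR h *: scheme h x m - w = expR h *: (scheme h x m - expR (- h) *: w).
  by rewrite scalerBr scalerA expRxMexpNx_1 scale1r.
have -> : expR (m.+1%:R * h) *: x - w = expR h *: (expR (m%:R * h) *: x - expR (- h) *: w).
  by rewrite scalerBr !scalerA expRxMexpNx_1 scale1r -expRD -[m.+1%:R]natr1 mulrDl mul1r [h + _]addrC.
rewrite !nrmZ ler_wpM2l//.
by apply: IH; apply: Kscale => //; exact: expRN_in01.
Qed.

Lemma scheme_nrm h x m : 0 <= h -> nrm (scheme h x m) <= expR (m%:R * h) * nrm x.
Proof.
move=> h0; have := @scheme_evi h x m 0 h0 K0.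
by rewrite !subr0 nrmZ ger0_norm ?expR_ge0.
Qed.

Lemma sub_scheme_nrm h x m : 0 <= h -> K x ->
  nrm (scheme h x m - x) <= (expR (m%:R * h) - 1) * nrm x.
Proof.
move=> h0 Kx; have := @scheme_evi h x m x h0 Kx.
rewrite nrm_scaleB//.
by rewrite subr_ge0 -expR0 ler_expR mulr_ge0.
Qed.

(** Testing the projection with the previous iterate bounds one squared increment by
    [(expR h - 1) / 2] times the gain in squared norm; Cauchy-Schwarz over [m] increments costs the
    factor [m]. *)
Lemma scheme_energy h m k : 0 <= h ->
  nrm (scheme h x0 (k + m) - scheme h x0 k) ^+ 2 <=
  m%:R * (expR h - 1) / 2 * (nrm (scheme h x0 (k + m)) ^+ 2 - nrm (scheme h x0 k) ^+ 2).
Proof.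
move=> h0; have e0 : 0 <= expR h - 1 by rewrite subr_ge0 -expR0 ler_expR.
elim: m => [|m IH].
  by rewrite addn0 !subrr mulr0 nrm0 expr0n.
rewrite addnS schemeS.
set y := scheme h x0 k in IH *; set x := scheme h x0 _ in IH *.
set z := stp h x.
have Kx : K x by exact: schemeK.
have := proj_var (expR h *: x) Kx.
rewrite -/(stp h x) -/z => hv.
have {hv} hz : ip (z - x) (z - x) <= (expR h - 1) / 2 * (ip z z - ip x x).
  have h2 := ip_ge0 (z - x); move: h2 hv; rewrite !ipE (ipC z x).
  move: (expR h) e0 => e e0; nra.
rewrite !nrmE in IH *.
move: (expR h - 1) e0 IH hz => e e0 IH hz.
case: m @x z IH hz Kx => [|m] x z IH hz Kx.
  have xy : x = y by rewrite /x addn0.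
  by rewrite -xy mul1r.
have m0 : 0 < m.+1%:R :> R by [].
(* The inductive form of Cauchy-Schwarz: the two sides of the next inequality differ by exactly this
   square. *)
have h3 := ip_ge0 ((m.+1%:R) *: (z - x) - (x - y)).
have {h3} : m.+1%:R * ip (z - y) (z - y) <=
   (m.+1%:R + 1) * (m.+1%:R * ip (z - x) (z - x) + ip (x - y) (x - y)).
  move: h3; rewrite !ipE (ipC z y) (ipC y x) (ipC z x); lra.
rewrite -[m.+2%:R]natr1.
move: (m.+1%:R) m0 IH => M M0 IH h3.
rewrite -(ler_pM2l M0); apply: (le_trans h3).
have -> : M * ((M + 1) * e / 2 * (ip z z - ip y y)) = (M + 1) * (M * (e / 2 * (ip z z - ip x x)) + M * e / 2 * (ip x x - ip y y)) by ring.
by rewrite ler_pM2l; [rewrite lerD// ler_pM2l | lra].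
Qed.

(** A double step multiplies the squared distance by e^(4h), which the exponential weight absorbs,
    and adds the defect of [catching_up_step], a product of two residuals each of size
    [expR h - 1]. *)
Lemma scheme_refine h k : 0 <= h ->
  expR (- (2 * ((2 * k)%:R * h))) *
  ip (scheme (2 * h) x0 k - scheme h x0 (2 * k)) (scheme (2 * h) x0 k - scheme h x0 (2 * k)) <=
  2 * k%:R * (expR h - 1) ^+ 2 * ip x0 x0.
Proof.
move=> h0; have e0 : 0 <= expR h - 1 by rewrite subr_ge0 -expR0 ler_expR.
elim: k => [|k IH].
  by rewrite muln0 subrr -nrmE nrm0 expr0n !(mulr0, mul0r).
rewrite (mulnDr 2 1 k : (2 * k.+1 = (2 * k).+2)%N) !schemeS.
set x := scheme (2 * h) x0 k in IH *; set y := scheme h x0 _ in IH *.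
set y' := stp h y.
have Kx : K x by exact: schemeK.
have Ky : K y by exact: schemeK.
have Ky' : K y' by exact: projK.
set a := stp _ x; set b := stp h y'.
have Ka : K a by exact: projK.
have Kb : K b by exact: projK.
have ny : nrm y <= expR ((2 * k)%:R * h) * nrm x0 by exact: scheme_nrm.
have ny' : nrm y' <= expR h * nrm y.
  by have := @scheme_nrm h y 1 h0; rewrite mul1r.
have [i0 i1] : 0 <= expR (- h) /\ expR (- h) <= 1 by apply/andP; exact: expRN_in01.
have e1 : 0 < expR h by exact: expR_gt0.
have ei : expR (- h) * expR h = 1 by rewrite mulrC expRxMexpNx_1.
have ee : expR (2 * h) = expR h * expR h by rewrite mulrDl mul1r expRD.
pose X := expR (2 * h) *: x; pose Y := expR (2 * h) *: y; pose c := expR h *: y'.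
have h1 : ip (X - a) (b - a) <= 0 by exact: proj_var.
have h3 : ip (c - b) (a - b) <= 0 by exact: proj_var.
have Yc : Y - c = expR h *: (expR h *: y - y') by rewrite scalerBr scalerA -ee.
have h2 : ip (Y - c) (a - c) <= 0.
  have -> : a - c = expR h *: (expR (- h) *: a - y').
    by rewrite scalerBr scalerA expRxMexpNx_1 scale1r.
  rewrite Yc ipZl ipZr !pmulr_rle0 ?expR_gt0//.
  by apply: proj_var; apply: Kscale => //; exact: expRN_in01.
have := catching_up_step h1 h2 h3.
have nc : nrm (c - b) <= (expR h - 1) * nrm y'.
  apply: (le_trans (proj_min c Ky')).
  by rewrite nrm_scaleB.
have nY : nrm (Y - c) <= expR h * ((expR h - 1) * nrm y).
  rewrite Yc nrmZ ger0_norm ?expR_ge0// ler_pM2l ?expR_gt0//.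
  apply: (le_trans (proj_min (expR h *: y) Ky)).
  by rewrite nrm_scaleB.
have -> : ip (X - Y) (X - Y) = (expR h) ^+ 4 * ip (x - y) (x - y).
  by rewrite -scalerBr ipZl ipZr ee; ring.
have -> : expR (- (2 * ((2 * k).+2%:R * h))) = expR (- h) ^+ 4 * expR (- (2 * ((2 * k)%:R * h))).
  by rewrite -expRM_natl -expRD -!natr1; congr expR; ring.
have W : expR (- (2 * ((2 * k)%:R * h))) = expR (- ((2 * k)%:R * h)) ^+ 2.
  by rewrite -expRM_natl; congr expR; ring.
have Gy : expR (- ((2 * k)%:R * h)) * nrm y <= nrm x0.
  rewrite -(ler_pM2l (expR_gt0 ((2 * k)%:R * h))) mulrA expRxMexpNx_1 mul1r.
  exact: ny.
rewrite W in IH *.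
move: (expR (- ((2 * k)%:R * h))) (expR_ge0 (- ((2 * k)%:R * h))) IH Gy => G G0 IH Gy.
move: nc nY; rewrite -[k.+1%:R]natr1 -(nrmE x0).
move: (ip (a - b) _) (ip (x - y) _) (nrm_ge0 (c - b)) (nrm_ge0 (Y - c)) (nrm_ge0 y) (nrm_ge0 y') IH.
rewrite -nrmE.
move: (nrm (c - b)) (nrm (Y - c)) (nrm y) (nrm y') (nrm x0) ny' Gy {ny W Yc ee h1 h2 h3}.
move: (expR h) (expR (- h)) e0 i0 i1 e1 ei => e i e0 i0 i1 e1 ei p q r r' n0 hr' Gr D D0 p0 q0 r0 r'0 IH hp hq hD.
have pq : p * q <= ((e - 1) * (e * r)) * (e * ((e - 1) * r)).
  apply: ler_pM => //; apply: (le_trans hp); exact: ler_wpM2l.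
have Gr2 : (G * r) ^+ 2 <= n0 ^+ 2.
  by rewrite ler_sqr ?nnegrE ?mulr_ge0 //; apply: le_trans Gr; rewrite mulr_ge0.
have i2 : i ^+ 2 <= 1 by rewrite expr_le1.
have ei4 : i ^+ 4 * e ^+ 4 = 1 by rewrite -exprMn ei expr1n.
have ei2 : i ^+ 2 * e ^+ 2 = 1 by rewrite -exprMn ei expr1n.
have s1 : i ^+ 4 * G ^+ 2 * D <= i ^+ 4 * G ^+ 2 * (e ^+ 4 * D0 + 2 * (((e - 1) * (e * r)) * (e * ((e - 1) * r)))).
  by apply: ler_wpM2l; [rewrite mulr_ge0 ?exprn_ge0 | lra].
apply: (le_trans s1).
have -> : i ^+ 4 * G ^+ 2 * (e ^+ 4 * D0 + 2 * (((e - 1) * (e * r)) * (e * ((e - 1) * r))))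
  = (i ^+ 4 * e ^+ 4) * (G ^+ 2 * D0) + 2 * (i ^+ 2 * e ^+ 2) * ((e - 1) ^+ 2 * (i ^+ 2 * (G * r) ^+ 2)) by ring.
rewrite ei4 ei2.
have s2 : (e - 1) ^+ 2 * (i ^+ 2 * (G * r) ^+ 2) <= (e - 1) ^+ 2 * n0 ^+ 2.
  apply: ler_wpM2l; first exact: sqr_ge0.
  by apply: le_trans Gr2; rewrite ler_piMl ?sqr_ge0.
by lra.
Qed.


Definition flow_approx n (t : R) := scheme (dyadic_step R n) x0 (Num.truncn (t * 2 ^+ n)).
Local Notation X := flow_approx.
Local Notation h := (dyadic_step R).

(** By [scheme_refine] the distance is of the order of the square root of the step; [3 / 4] is a
    rational upper bound for 2^(-1/2). The fine grid has made 2k or 2k + 1 steps when the coarse one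
    has made k, and the possible extra step is estimated separately. *)
Lemma flow_approxS n t : 0 <= t ->
  nrm (X n.+1 t - X n t) <= 4 * (1 + t) * expR t * nrm x0 * (3 / 4) ^+ n.
Proof.
move=> t0; rewrite /X; set m := Num.truncn (t * 2 ^+ n.+1); set k := Num.truncn (t * 2 ^+ n).
have /andP[m1 m2] := truncn_dyadic n.+1 t0; rewrite -/m in m1 m2.
have /andP[k1 k2] := truncn_dyadic n t0; rewrite -/k dyadic_stepS in k1 k2.
have hp := dyadic_step_gt0 R n.+1.
have kt : (2 * k)%:R * h n.+1 <= t by rewrite natrM; lra.
have /andP[km mk] : (2 * k <= m)%N && (m <= 2 * k + 1)%N.
  rewrite -(ltnS _ m) -(ltr_nat R) -(ler_nat R) -natr1 natrD natrM.
  apply/andP; split; first by rewrite -(ltr_pM2r hp) mulrDl; lra.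
  have : m%:R * h n.+1 < (2 * k + 2)%:R * h n.+1 by rewrite natrD natrM; lra.
  by rewrite ltr_pM2r// ltr_nat addn2 ltnS -addn1 -(ler_nat R) natrD natrM.
have /andP[e1 e2] := expR_sub1_le (dyadic_step_le_half R n).
have /andP[_ h2] := dyadic_step_le_half R n.
have e3 : expR (h n.+1) - 1 <= 2 * h n.+1 by nra.
have hq : h n.+1 <= (3 / 4) ^+ n * (3 / 4) ^+ n.
  rewrite -exprMn /dyadic_step exprS.
  apply: (@le_trans _ _ (2^-1 ^+ n)); first by rewrite ger_pMl ?exprn_gt0//; lra.
  by apply: lerXn2r; rewrite ?nnegrE; lra.
have q1 : (3 / 4) ^+ n <= 1 :> R by rewrite exprn_ile1//; lra.
have q0 : 0 <= (3 / 4) ^+ n :> R by rewrite exprn_ge0//; lra.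
move: (((3 / 4) ^+ n) : R) hq q1 q0 => q hq q1 q0.
have hq' : h n.+1 <= q by apply: le_trans hq _; exact: ler_piMl.
apply: (le_trans (@nrm_tri (scheme (h n.+1) x0 (2 * k)) _ _)).
have -> : 4 * (1 + t) * expR t * nrm x0 * q =
  2 * expR t * nrm x0 * q + (2 + 4 * t) * expR t * nrm x0 * q by ring.
have nx := nrm_ge0 x0; have et := expR_ge0 t.
apply: lerD.
  have -> : m = (2 * k + (m - 2 * k))%N by rewrite subnKC.
  have : (m - 2 * k <= 1)%N by rewrite leq_subLR.
  rewrite schemeD; move: (m - 2 * k)%N => j j1.
  apply: le_trans (sub_scheme_nrm _ _ (schemeK _ _)) _; first exact: ltW.
  have ej : expR (j%:R * h n.+1) - 1 <= 2 * h n.+1.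
    by case: j j1 => [_|[_|//]]; [rewrite mul0r expR0; lra | rewrite mul1r].
  have ek : nrm (scheme (h n.+1) x0 (2 * k)) <= expR t * nrm x0.
    apply: le_trans (scheme_nrm _ _ (ltW hp)) _.
    by apply: ler_wpM2r => //; rewrite ler_expR.
  have ej0 : 0 <= expR (j%:R * h n.+1) - 1 by rewrite subr_ge0 -expR0 ler_expR mulr_ge0// ltW.
  apply: (@le_trans _ _ ((2 * h n.+1) * (expR t * nrm x0))).
    by apply: ler_pM => //; exact: nrm_ge0.
  rewrite (_ : 2 * expR t * _ * _ = (2 * q) * (expR t * nrm x0)); last by ring.
  by rewrite ler_wpM2r ?mulr_ge0//; lra.
rewrite nrm_distC -ler_sqr ?nnegrE ?nrm_ge0//; last first.
  by rewrite !mulr_ge0 ?nrm_ge0//; lra.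
rewrite nrmE dyadic_stepS.
have := @scheme_refine (h n.+1) k (ltW hp).
rewrite -(nrmE x0).
have : expR (- (2 * t)) <= expR (- (2 * ((2 * k)%:R * h n.+1))) by rewrite ler_expR; lra.
have : expR (- (2 * t)) * (expR t * expR t) = 1.
  by rewrite -!expRD (_ : _ + _ = 0) ?expR0//; ring.
have := ip_ge0 (scheme (2 * h n.+1) x0 k - scheme (h n.+1) x0 (2 * k)).
move: (ip (_ - _) _) (expR (- _)) (expR (- _)) (expR_ge0 (- (2 * t))) => D i j i0 D0 ei ij.
move: (nrm x0) nx (expR t) et ei => N N0 E E0 ei.
move=> HD.
have hh : k%:R * (expR (h n.+1) - 1) ^+ 2 <= 2 * t * h n.+1.
  apply: (@le_trans _ _ (k%:R * (2 * h n.+1) ^+ 2)).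
    apply: ler_wpM2l => //; rewrite ler_sqr ?nnegrE//; lra.
  by move: kt; rewrite natrM; nra.
have iD : i * D <= 4 * t * h n.+1 * N ^+ 2.
  apply: (@le_trans _ _ (j * D)); first exact: ler_wpM2r.
  by apply: (le_trans HD); have := ler_wpM2r (sqr_ge0 N) hh; lra.
have -> : D = (i * D) * (E * E) by rewrite -mulrA mulrCA ei mulr1.
apply: (@le_trans _ _ ((4 * t * h n.+1 * N ^+ 2) * (E * E))).
  by apply: ler_wpM2r => //; exact: mulr_ge0.
rewrite (_ : ((2 + 4 * t) * _ * _ * _) ^+ 2 = ((2 + 4 * t) ^+ 2 * (q * q)) * N ^+ 2 * (E * E)); last by ring.
apply: ler_wpM2r; first exact: mulr_ge0.
apply: ler_wpM2r; first exact: sqr_ge0.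
apply: ler_pM; [lra|exact: ltW|nra|by []].
Qed.


Lemma nrm_dist_geom (u : nat -> V) (C q : R) : 0 <= C -> 0 <= q < 1 ->
  (forall n, nrm (u n.+1 - u n) <= C * q ^+ n) ->
  forall n m : nat, nrm (u (n + m)%N - u n) <= C / (1 - q) * q ^+ n.
Proof.
move=> C0 /andP[q0 q1] hu n m.
suff h : nrm (u (n + m)%N - u n) <= C / (1 - q) * (q ^+ n - q ^+ (n + m)%N).
  apply: (le_trans h); rewrite ler_wpM2l ?divr_ge0//; first by lra.
  by rewrite lerBlDr lerDl exprn_ge0.
elim: m => [|m IH]; first by rewrite addn0 !subrr nrm0 mulr0.
apply: (le_trans (@nrm_tri (u (n + m)%N) _ _)).
rewrite addnS; apply: (le_trans (lerD (hu _) IH)).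
rewrite -mulrA -mulrA -mulrDr ler_wpM2l// exprS.
have q1' : 1 - q != 0 by lra.
have -> : q ^+ n - q * q ^+ (n + m)%N = (1 - q) * q ^+ (n + m)%N + (q ^+ n - q ^+ (n + m)%N) by ring.
by rewrite [leRHS]mulrDr mulKf.
Qed.

Lemma flow_approx_cvg t : 0 <= t ->
  exists2 x : V, K x & nrm (X n t - x) @[n --> \oo] --> 0.
Proof.
move=> t0; apply: Kcomplete => [n|e e0]; first exact: schemeK.
pose C := 4 * (1 + t) * expR t * nrm x0.
have C0 : 0 <= C by rewrite !mulr_ge0 ?expR_ge0 ?nrm_ge0//; lra.
have q01 : 0 <= (3 / 4 : R) < 1 by lra.
have := @nrm_dist_geom (X ^~ t) C (3 / 4) C0 q01 (fun n => flow_approxS n t0).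
set D := C / _ => hD.
have D0 : 0 <= D by rewrite divr_ge0//; lra.
have : D * (3 / 4) ^+ n @[n --> \oo] --> 0.
  by apply: (@cvg_geometric R D (3 / 4)); rewrite ger0_norm; lra.
move=> /cvgrPdist_lt /(_ (e / 2)) []; first by lra.
move=> N _ HN; exists N => m n Nm Nn.
have {}HN : D * (3 / 4) ^+ N < e / 2.
  have := HN N (leqnn N); rewrite /= sub0r normrN ger0_norm// mulr_ge0// exprn_ge0//; lra.
apply: (le_lt_trans (@nrm_tri (X N t) _ _)).
rewrite (nrm_distC (X N t)).
have := hD N (m - N)%N; have := hD N (n - N)%N; rewrite !subnKC//; lra.
Qed.

(* Junk for negative [t], where this is the flow at time [- t]. *)
Definition flow t : V :=
  sval (cid2 (@flow_approx_cvg `|t| (@normr_ge0 R R t))).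

Lemma flowK t : K (flow t).
Proof. by rewrite /flow; case: cid2. Qed.

Lemma flow_cvg t : 0 <= t -> nrm (X n t - flow t) @[n --> \oo] --> 0.
Proof. by move=> t0; rewrite /flow; case: cid2 => x /= _; rewrite ger0_norm. Qed.

Lemma flow0 : nrm (flow 0 - x0) = 0.
Proof.
rewrite nrm_distC.
have : nrm (X n 0 - flow 0) @[n --> \oo] --> 0 by exact: flow_cvg.
move=> c; apply/eqP; rewrite eq_le nrm_ge0 andbT.
by apply: (cvgr_to_ge c); apply: nearW => n; rewrite /X mul0r truncn0.
Qed.

Lemma flow_evi a b w : 0 <= a <= b -> K w ->
  nrm (flow b - w) <= nrm (expR (b - a) *: flow a - w).
Proof.
move=> /andP[a0 ab] Kw; have b0 := le_trans a0 ab.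
pose k n := Num.truncn (a * 2 ^+ n); pose l n := Num.truncn (b * 2 ^+ n).
pose s n := (l n - k n)%:R * h n.
have kl n : (k n <= l n)%N by apply: le_truncn; rewrite ler_wpM2r// exprn_ge0.
have sE n : s n = (l n)%:R * h n - (k n)%:R * h n by rewrite /s natrB// mulrBl.
have sb n : b - a - h n <= s n <= b - a + h n.
  rewrite sE; have /andP[] := truncn_dyadic n a0; have /andP[] := truncn_dyadic n b0.
  by rewrite -/(k n) -/(l n); lra.
have sc : s n @[n --> \oo] --> b - a.
  apply: (@squeeze_cvgr _ _ _ _ (fun n => b - a - h n) (fun n => b - a + h n)).
  - by apply: nearW => n; exact: sb.
  - by rewrite -[X in _ --> X]subr0; apply: cvgB; [exact: cvg_cst|exact: cvg_dyadic_step].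
  - by rewrite -[X in _ --> X]addr0; apply: cvgD; [exact: cvg_cst|exact: cvg_dyadic_step].
have ec : expR (s n) @[n --> \oo] --> expR (b - a).
  by apply: continuous_cvg => //; exact: continuous_expR.
have key n : nrm (flow b - w) <= nrm (X n b - flow b) + (expR (s n) * nrm (X n a - flow a)
    + `|expR (s n) - expR (b - a)| * nrm (flow a)) + nrm (expR (b - a) *: flow a - w).
  apply: (le_trans (@nrm_tri (X n b) _ _)); rewrite nrm_distC -addrA lerD2l.
  have -> : X n b = scheme (h n) (X n a) (l n - k n).
    by rewrite /X -(schemeD _ (k n)) subnKC.
  apply: (le_trans (scheme_evi _ _ (dyadic_step_ge0 _ _) Kw)); rewrite -/(s n).
  apply: (le_trans (@nrm_tri (expR (b - a) *: flow a) _ _)); rewrite lerD2r.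
  apply: (le_trans (@nrm_tri (expR (s n) *: flow a) _ _)).
  by rewrite -scalerBr -scalerBl !nrmZ (ger0_norm (expR_ge0 _)).
apply: (@cvgr_to_ge _ \oo _ R (fun n => nrm (X n b - flow b) + (expR (s n) * nrm (X n a - flow a)
    + `|expR (s n) - expR (b - a)| * nrm (flow a)) + nrm (expR (b - a) *: flow a - w))); last first.
  by apply: nearW => n; exact: key.
rewrite -[X in _ --> X]add0r; apply: cvgD; last exact: cvg_cst.
rewrite -[0]addr0; apply: cvgD; first exact: flow_cvg.
rewrite -[0]addr0; apply: cvgD.
  by rewrite -[0](mulr0 (expR (b - a))); apply: cvgM => //; exact: flow_cvg.
rewrite -[0](mul0r (nrm (flow a))); apply: cvgM; last exact: cvg_cst.
rewrite -[0](@normr0 _ R) -(subrr (expR (b - a))).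
by apply: cvg_norm; apply: cvgB => //; exact: cvg_cst.
Qed.

Lemma flow_energy a b : 0 <= a <= b ->
  nrm (flow b - flow a) ^+ 2 <= (b - a) / 2 * (nrm (flow b) ^+ 2 - nrm (flow a) ^+ 2).
Proof.
move=> /andP[a0 ab]; have b0 := le_trans a0 ab.
pose k n := Num.truncn (a * 2 ^+ n); pose l n := Num.truncn (b * 2 ^+ n).
pose s n := (l n - k n)%:R * (expR (h n) - 1).
have kl n : (k n <= l n)%N by apply: le_truncn; rewrite ler_wpM2r// exprn_ge0.
(* The quadratic bound on [expR h - 1] holds for [h <= 2^-1], hence the shifted index. *)
have sb n : b - a - h n.+1 <= s n.+1 <= b - a + h n.+1 + 2 * h n.+1 * (b - a + h n.+1).
  have /andP[e1 e2] := expR_sub1_le (dyadic_step_le_half R n).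
  have e3 := dyadic_step_gt0 R n.+1.
  have : (l n.+1 - k n.+1)%:R * h n.+1 = (l n.+1)%:R * h n.+1 - (k n.+1)%:R * h n.+1.
    by rewrite natrB// mulrBl.
  have /andP[] := truncn_dyadic n.+1 a0; have /andP[] := truncn_dyadic n.+1 b0.
  rewrite -/(k _) -/(l _) /s.
  have : 0 <= (l n.+1 - k n.+1)%:R :> R by [].
  move: (_ * h n.+1) (_ * h n.+1) => p q; move: (l n.+1 - k n.+1)%:R => r r0 ? ? ? ? pq.
  by apply/andP; split; nra.
have sc : s n.+1 @[n --> \oo] --> b - a.
  have hc : h n.+1 @[n --> \oo] --> 0 by rewrite (@cvg_shiftS _ h); exact: cvg_dyadic_step.
  apply: (@squeeze_cvgr _ _ _ _ (fun n => b - a - h n.+1)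
    (fun n => b - a + h n.+1 + 2 * h n.+1 * (b - a + h n.+1))).
  - by apply: nearW => n; exact: sb.
  - by rewrite -[X in _ --> X]subr0; apply: cvgB => //; exact: cvg_cst.
  - rewrite [X in _ --> X](_ : _ = b - a + 0 + 2 * 0 * (b - a + 0)); last by ring.
    apply: cvgD; first by apply: cvgD => //; exact: cvg_cst.
    by apply: cvgM; [apply: cvgM => //; exact: cvg_cst | apply: cvgD => //; exact: cvg_cst].
have nc c : 0 <= c -> nrm (X n.+1 c) @[n --> \oo] --> nrm (flow c).
  move=> c0; rewrite (@cvg_shiftS _ (fun n => nrm (X n c))).
  apply/cvgrPdist_le => e e0; have := flow_cvg c0 => /cvgrPdist_le /(_ _ e0).
  apply: filterS => n; rewrite sub0r normrN ger0_norm ?nrm_ge0// => h1.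
  by apply: le_trans h1; rewrite nrm_distC; exact: nrm_dist.
have dc : nrm (X n.+1 b - X n.+1 a) @[n --> \oo] --> nrm (flow b - flow a).
  rewrite (@cvg_shiftS _ (fun n => nrm (X n b - X n a))).
  have h0 : nrm (X n b - flow b) + nrm (X n a - flow a) @[n --> \oo] --> 0.
    by rewrite -[0]addr0; apply: cvgD; exact: flow_cvg.
  apply/cvgrPdist_le => e e0; have := h0 => /cvgrPdist_le /(_ _ e0).
  apply: filterS => n; rewrite sub0r normrN ger0_norm ?addr_ge0 ?nrm_ge0// => h1.
  apply: le_trans h1; apply: (le_trans (nrm_dist _ _)); rewrite -nrmN.
  have -> : - (flow b - flow a - (X n b - X n a)) = (X n b - flow b) - (X n a - flow a).
    by rewrite !opprB addrACA [RHS]addrACA; congr (_ + _); exact: addrC.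
  by apply: (le_trans (nrmD _ _)); rewrite nrmN.
apply: (@ler_cvg_to _ \oo _ R (fun n => nrm (X n.+1 b - X n.+1 a) ^+ 2)
  (fun n => s n.+1 / 2 * (nrm (X n.+1 b) ^+ 2 - nrm (X n.+1 a) ^+ 2))).
- by rewrite expr2; apply: cvgM.
- apply: cvgM; first by apply: cvgM => //; exact: cvg_cst.
  by apply: cvgB; rewrite expr2; apply: cvgM; exact: nc.
- apply: nearW => n.
  have := @scheme_energy (h n.+1) (l n.+1 - k n.+1) (k n.+1) (dyadic_step_ge0 _ _).
  by rewrite subnKC.
Qed.

Lemma flow_lipschitz a b : 0 <= a <= b ->
  nrm (flow b - flow a) <= (expR (b - a) - 1) * nrm (flow a).
Proof.
move=> ab; apply: (le_trans (flow_evi ab (flowK a))).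
by rewrite nrm_scaleB// subr_ge0 -expR0 ler_expR subr_ge0; case/andP: ab.
Qed.

End Sweeping.

(** * Weak derivatives from dyadic difference quotients *)

Section DyadicCells.
Variable R : realType.
Local Notation mu := (@lebesgue_measure R).
Local Notation h := (@dyadic_step R).

Definition cell_left n (x : R) : R := (Num.floor (x * 2 ^+ n))%:~R * h n.
(** The increment is taken across the whole cell containing [x], so the quotient is constant on
    cells: it is the conditional expectation of the derivative of [v] given the dyadic cells of
    level [n]. *)
Definition diff_quot (v : R -> R) n x :=
  (v (cell_left n x + h n) - v (cell_left n x)) / h n.
Definition cell n (k : int) : set R := `[k%:~R * h n, k%:~R * h n + h n[.
Definition cells n (k : int) (j : nat) : set R :=
  `[k%:~R * h n, (k + j%:Z)%:~R * h n[.
(** Half-open with integer endpoints, hence a union of cells at every level. *)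
Definition window (N : nat) : set R := `[- N%:R, N%:R[.

Lemma cell_left_itv n x : cell_left n x <= x < cell_left n x + h n.
Proof.
have := floor_itv (x * 2 ^+ n); rewrite /cell_left intrD mulr1z.
have := dyadic_step_gt0 R n; have := dyadic_stepV R n.
move: (h n) (2 ^+ n) (Num.floor _)%:~R => a b k e a0 /andP[k1 k2].
have xE : x = x * b * a by rewrite -mulrA (mulrC b) e mulr1.
rewrite xE; apply/andP; split; first by rewrite ler_pM2r.
by rewrite (_ : k * a + a = (k + 1) * a) ?ltr_pM2r//; ring.
Qed.

Lemma cell_leftE n k x : cell n k x -> cell_left n x = k%:~R * h n.
Proof.
rewrite /cell /= in_itv /= => /andP[k1 k2]; rewrite /cell_left; congr (_%:~R * _).
apply/floor_def; rewrite intrD mulr1z.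
have := dyadic_step_gt0 R n; have := dyadic_stepV R n.
have := exprn_gt0 n (ltr0Sn R 1).
move: (h n) (2 ^+ n) k1 k2 => a b k1 k2 b0 e a0.
have kE : k%:~R = k%:~R * a * b by rewrite -mulrA e mulr1.
rewrite kE; apply/andP; split; first by rewrite ler_pM2r.
by rewrite (_ : k%:~R * a * b + 1 = (k%:~R * a + a) * b) ?ltr_pM2r// mulrDl e.
Qed.

Lemma cell_floor n x : cell n (Num.floor (x * 2 ^+ n)) x.
Proof. by rewrite /cell /= in_itv /=; exact: cell_left_itv. Qed.

Lemma measurable_cell_left n : measurable_fun setT (cell_left n).
Proof.
apply: nondecreasing_measurable => // x y xy.
by rewrite ler_pM2r ?dyadic_step_gt0// ler_int le_floor// ler_pM2r// exprn_gt0.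
Qed.

Lemma cvg_cell_left x : cell_left n x @[n --> \oo] --> x.
Proof.
apply: (@squeeze_cvgr _ _ _ _ (fun n => x - h n) (fun=> x)).
- by apply: nearW => n; have /andP[] := cell_left_itv n x; lra.
- by rewrite -[X in _ --> X]subr0; apply: cvgB; [exact: cvg_cst|exact: cvg_dyadic_step].
- exact: cvg_cst.
Qed.

Lemma cvg_cell_right x : cell_left n x + h n @[n --> \oo] --> x.
Proof.
by rewrite -[X in _ --> X]addr0; apply: cvgD; [exact: cvg_cell_left|exact: cvg_dyadic_step].
Qed.

Lemma measurable_cell_comp (v : R -> R -> R) n :
  (forall x, measurable_fun setT (v ^~ x)) ->
  measurable_fun setT (fun z : R * R => v z.1 (cell_left n z.2)).
Proof.
move=> mv _ Y mY; rewrite setTI.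
rewrite (_ : _ @^-1` _ = \bigcup_(k in [set: int])
  ((v ^~ (k%:~R * h n)) @^-1` Y `*` cell n k)).
  apply: countable_bigcupT_measurable => // k; apply: measurableX; last exact: measurable_itv.
  by rewrite -[X in measurable X]setTI; exact: mv.
apply/seteqP; split => [[p x] /= Yv|[p x] /= [k _ [/= Yk kx]]].
  by exists (Num.floor (x * 2 ^+ n)) => //; split => //=; exact: cell_floor.
by rewrite (cell_leftE kx).
Qed.

(** Freezing the second variable at the left end of its cell gives a countable patchwork of
    measurable functions, which converges by continuity. *)
Lemma measurable_caratheodory (v : R -> R -> R) :
  (forall x, measurable_fun setT (v ^~ x)) -> (forall p, continuous (v p)) ->
  measurable_fun setT (uncurry2 v).
Proof.
move=> mv cv.
apply: (@measurable_fun_cvg _ _ _ _ (fun n (z : R * R) => v z.1 (cell_left n z.2))).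
  by move=> n; exact: measurable_cell_comp.
by move=> [p x] _; apply: continuous_cvg; [exact: cv|exact: cvg_cell_left].
Qed.

Lemma measurable_diff_quot (v : R -> R -> R) n : measurable_fun setT (uncurry2 v) ->
  measurable_fun setT (fun z : R * R => diff_quot (v z.1) n z.2).
Proof.
move=> mv; have h1 : measurable_fun setT (fun z : R * R => (z.1, cell_left n z.2)).
  apply/measurable_fun_pairP; split => /=; first exact: measurable_fst.
  exact: (measurableT_comp (measurable_cell_left n) measurable_snd).
have h2 : measurable_fun setT (fun z : R * R => (z.1, cell_left n z.2 + h n)).
  apply/measurable_fun_pairP; split => /=; first exact: measurable_fst.
  apply: measurable_funD => //.
  exact: (measurableT_comp (measurable_cell_left n) measurable_snd).
apply: measurable_funM => //; apply: measurable_funB.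
  exact: (measurableT_comp mv h2).
exact: (measurableT_comp mv h1).
Qed.

Lemma measurable_cell n k : @measurable _ (measurableTypeR R) (cell n k).
Proof. exact: measurable_itv. Qed.

Lemma mu_cell n k : mu (cell n k) = (h n)%:E.
Proof.
rewrite lebesgue_measure_itv /= lte_fin ltrDl dyadic_step_gt0.
by rewrite -EFinB addrAC subrr add0r.
Qed.

Lemma cell_endS n (k : int) (j : nat) :
  (k + j.+1%:Z)%:~R * h n = (k + j%:Z)%:~R * h n + h n :> R.
Proof.
have -> : k + j.+1%:Z = k + j%:Z + 1 by rewrite -addn1 PoszD addrA.
by rewrite intrD mulr1z mulrDl mul1r.
Qed.

Lemma cell_recr n (k : int) (j : nat) :
  cells n k j.+1 = cells n k j `|` cell n (k + j%:Z).
Proof.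
rewrite /cells.
have -> : (k + j.+1%:Z)%:~R * h n = (k + j%:Z)%:~R * h n + h n.
  by exact: cell_endS.
apply: itv_bndbnd_setU; rewrite bnd_simp.
  by rewrite ler_pM2r ?dyadic_step_gt0// ler_int lerDl.
by rewrite lerDl dyadic_step_ge0.
Qed.

Lemma cell_recr_disj n (k : int) (j : nat) :
  [disjoint cells n k j & cell n (k + j%:Z)].
Proof.
apply/disj_setPS => x /= []; rewrite /cell /cells /= !in_itv /= => /andP[_ a] /andP[b _].
by move: (le_lt_trans b a); rewrite ltxx.
Qed.

Lemma cells_integral_le (f g : R -> \bar R) n :
  measurable_fun setT f -> measurable_fun setT g ->
  (forall x, 0 <= f x)%E -> (forall x, 0 <= g x)%E ->
  (forall k, \int[mu]_(x in cell n k) f x <= \int[mu]_(x in cell n k) g x)%E ->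
  forall (k : int) (j : nat),
  (\int[mu]_(x in cells n k j) f x <=
   \int[mu]_(x in cells n k j) g x)%E.
Proof.
move=> mf mg f0 g0 fg k; elim => [|j IH].
  by rewrite /cells addr0 set_itvco0 ?lexx// !integral_set0.
rewrite cell_recr !ge0_integral_setU//; first exact: leeD.
all: try exact: cell_recr_disj.
all: try exact: measurable_itv.
all: by exact: measurable_funTS.
Qed.

Lemma window_cells n N : exists (k : int) (j : nat),
  window N = cells n k j.
Proof.
exists (- (N * 2 ^ n)%N%:Z), (2 * (N * 2 ^ n))%N.
have e : (N * 2 ^ n)%:R * h n = N%:R.
  by rewrite natrM natrX -mulrA (mulrC (2 ^+ n)) dyadic_stepV mulr1.
rewrite /window; congr [set` Interval (BLeft _) (BLeft _)].
  by rewrite mulrNz mulNr e.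
by rewrite mul2n -addnn PoszD addrA addNr add0r e.
Qed.

Variable v : R -> R.
Hypothesis cv : continuous v.

Lemma measurable_diff_quot1 n : measurable_fun setT (diff_quot v n).
Proof.
have mv := continuous_measurable_fun cv.
apply: measurable_funM => //; apply: measurable_funB.
  apply: (measurableT_comp mv).
  by apply: measurable_funD => //; exact: measurable_cell_left.
exact: (measurableT_comp mv (measurable_cell_left n)).
Qed.

Lemma diff_quot_bounded n (a b : R) : exists2 M, 0 <= M &
  forall x, x \in `[a, b[ -> `|diff_quot v n x| <= M.
Proof.
have hp := dyadic_step_gt0 R n.
have cvw : {within `[a - h n, b + h n], continuous v}.
  by apply: continuous_subspaceT.
have := compact_bounded (continuous_compact cvw (@segment_compact _ _ _)).
move=> [M [Mr HM]].
have B y : a - h n <= y <= b + h n -> `|v y| <= `|M| + 1.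
  move=> yab; apply: (HM (`|M| + 1)); last by exists y => //=; rewrite in_itv.
  by rewrite ltr_pwDr// ler_norm.
exists (2 * (`|M| + 1) / h n).
  by rewrite divr_ge0 ?mulr_ge0 ?addr_ge0// ltW.
move=> x; rewrite in_itv /= => /andP[ax xb].
rewrite normrM normfV (gtr0_norm hp) ler_pM2r ?invr_gt0//.
have /andP[l1 l2] := cell_left_itv n x.
apply: (le_trans (ler_normB _ _)).
have := B (cell_left n x + h n); have := B (cell_left n x).
by move=> h1 h2; have := h1 _; have := h2 _; lra.
Qed.

Lemma bounded_itv_integrable (f : R -> R) (a b M : R) : measurable_fun setT f ->
  (forall x, x \in `[a, b[ -> `|f x| <= M) -> mu.-integrable `[a, b[ (EFin \o f).
Proof.
move=> mf fM; apply: measurable_bounded_integrable => //.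
- by rewrite /= lebesgue_measure_itv /=; case: ifP => // _; rewrite -EFinB ltry.
- exact: measurable_funTS.
- exists M; split; first by rewrite num_real.
  by move=> M' MM' x /= xab; apply: le_trans (ltW MM'); exact: fM.
Qed.

Lemma diff_quot_integrable n (a b : R) :
  mu.-integrable `[a, b[ (EFin \o diff_quot v n).
Proof.
have [M _ HM] := diff_quot_bounded n a b.
by apply: bounded_itv_integrable HM; exact: measurable_diff_quot1.
Qed.

Lemma diff_quot_sqr_integrable n (a b : R) :
  mu.-integrable `[a, b[ (EFin \o (fun x => diff_quot v n x ^+ 2)).
Proof.
have [M M0 HM] := diff_quot_bounded n a b.
apply: (@bounded_itv_integrable _ _ _ (M ^+ 2)).
  by apply: measurable_funX; exact: measurable_diff_quot1.
by move=> x /HM xM; rewrite normrX lerXn2r ?nnegrE.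
Qed.

Lemma Rintegral_diff_quot n (k : int) (j : nat) :
  \int[mu]_(x in cells n k j) diff_quot v n x =
  v ((k + j%:Z)%:~R * h n) - v (k%:~R * h n).
Proof.
elim: j => [|j IH].
  by rewrite /cells addr0 set_itvco0 ?lexx// Rintegral_set0 subrr.
rewrite cell_recr Rintegral_setU//; last 3 first.
- exact: measurable_cell.
- by rewrite -cell_recr; exact: diff_quot_integrable.
- exact: cell_recr_disj.
rewrite IH.
have -> : \int[mu]_(x in cell n (k + j%:Z)) diff_quot v n x =
  \int[mu]_(x in cell n (k + j%:Z))
     ((v ((k + j%:Z)%:~R * h n + h n) - v ((k + j%:Z)%:~R * h n)) / h n).
  by apply: eq_Rintegral => x /set_mem xc; rewrite /diff_quot (cell_leftE xc).
rewrite Rintegral_cst; last exact: measurable_cell.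
rewrite [fine _](_ : _ = h n); last by rewrite /= mu_cell.
rewrite divfK; last by rewrite gt_eqF// dyadic_step_gt0.
have -> : (k + j.+1%:Z)%:~R * h n = (k + j%:Z)%:~R * h n + h n.
  by exact: cell_endS.
  ring.
exact: measurable_itv.
Qed.

Lemma dyadic_step_split n m : (n <= m)%N -> h n = (2 ^ (m - n))%:R * h m.
Proof.
move=> nm; rewrite -{2}(subnK nm) /dyadic_step exprD mulrA natrX -exprMn.
by rewrite divff// expr1n mul1r.
Qed.

Lemma Rintegral_diff_quot_cell n m k : (n <= m)%N ->
  \int[mu]_(x in cell n k) diff_quot v m x = v (k%:~R * h n + h n) - v (k%:~R * h n).
Proof.
move=> nm; have e := dyadic_step_split nm.
have e1 : k%:~R * h n = (k * (2 ^ (m - n))%:Z)%:~R * h m.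
  by rewrite e intrM mulrA.
have e2 : k%:~R * h n + h n = (k * (2 ^ (m - n))%:Z + (2 ^ (m - n))%:Z)%:~R * h m.
  by rewrite e1 intrD mulrDl -e.
by rewrite /cell e2 e1 -[LHS]/(\int[mu]_(x in cells m _ _) _) Rintegral_diff_quot.
Qed.

(** On a cell of level [n] the coarse quotient is the constant [c], which by telescoping is also the
    mean of the finer quotient; the cross term thus integrates to 0. This is the orthogonality of
    martingale increments. *)
Lemma diff_quot_cell_pythagoras n m k : (n <= m)%N ->
  (\int[mu]_(x in cell n k)
     ((diff_quot v m x - diff_quot v n x) ^+ 2 + diff_quot v n x ^+ 2)%:E =
   \int[mu]_(x in cell n k) (diff_quot v m x ^+ 2)%:E)%E.
Proof.
move=> nm; set c := (v (k%:~R * h n + h n) - v (k%:~R * h n)) / h n.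
have cE x : cell n k x -> diff_quot v n x = c by move=> xk; rewrite /diff_quot (cell_leftE xk).
have mc := measurable_cell n k.
have i1 : mu.-integrable (cell n k) (EFin \o diff_quot v m) by exact: diff_quot_integrable.
have i2 : mu.-integrable (cell n k) (EFin \o (fun x => diff_quot v m x ^+ 2)).
  exact: diff_quot_sqr_integrable.
have i3 : mu.-integrable (cell n k) (EFin \o (fun x => - (2 * c) * diff_quot v m x)).
  by apply: eq_integrable (integrableZl mc (- (2 * c)) i1).
have i4 : mu.-integrable (cell n k) (EFin \o (cst (2 * c ^+ 2))).
  apply/integrableP; split; first exact/measurable_EFinP.
  rewrite -[X in (X < _)%E]/(\int[mu]_(x in cell n k) (`|2 * c ^+ 2|)%:E)%E.
  by rewrite integral_cst//= mu_cell -EFinM ltry.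
have i5 : mu.-integrable (cell n k) (EFin \o (fun x => - (2 * c) * diff_quot v m x + 2 * c ^+ 2)).
  by apply: eq_integrable (integrableD mc i3 i4).
transitivity (\int[mu]_(x in cell n k) ((diff_quot v m x ^+ 2)%:E +
    (- (2 * c) * diff_quot v m x + 2 * c ^+ 2)%:E))%E.
  apply: eq_integral => x /set_mem xk; rewrite (cE _ xk) -EFinD; congr EFin; ring.
rewrite integralD//=.
rewrite -[X in (_ + X)%E]fineK; last exact: integrable_fin_num i5.
rewrite -[fine _]/(\int[mu]_(x in cell n k) (- (2 * c) * diff_quot v m x + 2 * c ^+ 2)).
suff -> : \int[mu]_(x in cell n k) (- (2 * c) * diff_quot v m x + 2 * c ^+ 2) = 0.
  by rewrite adde0.
rewrite (RintegralD mc i3 i4) (RintegralZl _ mc i1) (Rintegral_diff_quot_cell k nm).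
rewrite Rintegral_cst// [fine _](_ : _ = h n); last by rewrite /= mu_cell.
have hp := dyadic_step_gt0 R n.
have -> : v (k%:~R * h n + h n) - v (k%:~R * h n) = c * h n.
  by rewrite divfK// gt_eqF.
ring.
Qed.

Lemma diff_quot_pythagoras n m N : (n <= m)%N ->
  (\int[mu]_(x in window N) ((diff_quot v m x - diff_quot v n x) ^+ 2)%:E +
   \int[mu]_(x in window N) (diff_quot v n x ^+ 2)%:E =
   \int[mu]_(x in window N) (diff_quot v m x ^+ 2)%:E)%E.
Proof.
move=> nm.
have mn := measurable_diff_quot1 n; have mm := measurable_diff_quot1 m.
have e1 : measurable_fun setT (fun x => ((diff_quot v m x - diff_quot v n x) ^+ 2)%:E).
  by apply/measurable_EFinP; apply: measurable_funX; exact: measurable_funB.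
have e2 k : measurable_fun setT (fun x => ((diff_quot v k x) ^+ 2)%:E).
  by apply/measurable_EFinP; apply: measurable_funX; exact: measurable_diff_quot1.
have e3 : measurable_fun setT (fun x => ((diff_quot v m x - diff_quot v n x) ^+ 2
    + diff_quot v n x ^+ 2)%:E).
  by apply: (emeasurable_funD e1 (e2 n)).
rewrite -ge0_integralD//; last 5 first.
- exact: measurable_itv.
- by move=> x _; rewrite lee_fin sqr_ge0.
- exact: measurable_funTS.
- by move=> x _; rewrite lee_fin sqr_ge0.
- by apply: measurable_funTS; exact: (e2 n).
have [k [j ->]] := window_cells n N.
apply/eqP; rewrite eq_le; apply/andP; split; apply: cells_integral_le => //;
  try (by move=> x; rewrite lee_fin ?addr_ge0 ?sqr_ge0);
  by move=> i; rewrite diff_quot_cell_pythagoras.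
Qed.

End DyadicCells.

(** * Tonelli's theorem on rectangles and almost every slice *)

Section IteratedIntegrals.
Variable R : realType.
Local Notation mu := (@lebesgue_measure R).
Implicit Types (f : R * R -> \bar R) (D E : set (measurableTypeR R)).

Lemma measurable_inner_integral f D : measurable_fun setT f -> (forall z, 0 <= f z)%E ->
  measurable D -> measurable_fun setT (fun p => \int[mu]_(x in D) f (p, x))%E.
Proof.
move=> mf f0 mD.
have mp : measurable_fun setT (f \_ (setT `*` D)).
  by apply/(measurable_restrictT f) => //; [exact: measurableX | exact: measurable_funTS].
have p0 z : (0 <= (f \_ (setT `*` D)) z)%E by rewrite patchE; case: ifP.
have := @measurable_fun_fubini_tonelli_F _ _ (measurableTypeR R) (measurableTypeR R) R mu
  (f \_ (setT `*` D)) mp p0.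
apply: eq_measurable_fun => p _; rewrite /fubini_F [RHS]integral_mkcond.
apply: eq_integral => x _; rewrite !patchE.
by congr (if _ then _ else _); apply/idP/idP => /set_mem => [[_ ?]|?]; exact: mem_set.
Qed.

Lemma integral_swap f D E : measurable_fun setT f -> (forall z, 0 <= f z)%E ->
  measurable D -> measurable E ->
  (\int[mu]_(p in D) \int[mu]_(x in E) f (p, x) =
   \int[mu]_(x in E) \int[mu]_(p in D) f (p, x))%E.
Proof.
move=> mf f0 mD mE.
have mp : measurable_fun setT (f \_ (D `*` E)).
  by apply/(measurable_restrictT f) => //; [exact: measurableX | exact: measurable_funTS].
have p0 z : (0 <= (f \_ (D `*` E)) z)%E by rewrite patchE; case: ifP.
have <- : (\int[mu]_p \int[mu]_x (f \_ (D `*` E)) (p, x) =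
    \int[mu]_(p in D) \int[mu]_(x in E) f (p, x))%E.
  rewrite [RHS]integral_mkcond; apply: eq_integral => p _; rewrite patchE.
  case: ifPn => [/set_mem pD|/negP pD].
    rewrite [RHS]integral_mkcond; apply: eq_integral => x _; rewrite !patchE.
    by congr (if _ then _ else _); apply/idP/idP => /set_mem => [[_ ?]|?]; exact: mem_set.
  apply: integral0_eq => x _; rewrite patchE; case: ifPn => // /set_mem[/= pD' _].
  by case: pD; exact: mem_set.
have <- : (\int[mu]_x \int[mu]_p (f \_ (D `*` E)) (p, x) =
    \int[mu]_(x in E) \int[mu]_(p in D) f (p, x))%E.
  rewrite [RHS]integral_mkcond; apply: eq_integral => x _; rewrite patchE.
  case: ifPn => [/set_mem pD|/negP pD].
    rewrite [RHS]integral_mkcond; apply: eq_integral => p _; rewrite !patchE.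
    by congr (if _ then _ else _); apply/idP/idP => /set_mem => [[? _]|?]; exact: mem_set.
  apply: integral0_eq => p _; rewrite patchE; case: ifPn => // /set_mem[/= _ pD'].
  by case: pD; exact: mem_set.
exact: (@fubini_tonelli _ _ (measurableTypeR R) (measurableTypeR R) R mu mu
  (f \_ (D `*` E)) mp p0).
Qed.

Lemma integral_prod f D E : measurable_fun setT f -> (forall z, 0 <= f z)%E ->
  measurable D -> measurable E ->
  (\int[mu \x mu]_(z in D `*` E) f z = \int[mu]_(p in D) \int[mu]_(x in E) f (p, x))%E.
Proof.
move=> mf f0 mD mE.
have mp : measurable_fun setT (f \_ (D `*` E)).
  by apply/(measurable_restrictT f) => //; [exact: measurableX | exact: measurable_funTS].
have p0 z : (0 <= (f \_ (D `*` E)) z)%E by rewrite patchE; case: ifP.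
rewrite integral_mkcond.
rewrite (@fubini_tonelli1 _ _ (measurableTypeR R) (measurableTypeR R) R mu mu
  (f \_ (D `*` E)) mp p0).
rewrite [RHS]integral_mkcond; apply: eq_integral => p _; rewrite patchE.
case: ifPn => [/set_mem pD|/negP pD].
  rewrite [RHS]integral_mkcond; apply: eq_integral => x _; rewrite !patchE.
  by congr (if _ then _ else _); apply/idP/idP => /set_mem => [[_ ?]|?]; exact: mem_set.
apply: integral0_eq => x _; rewrite patchE; case: ifPn => // /set_mem[/= pD' _].
by case: pD; exact: mem_set.
Qed.

Lemma measurable_window N : @measurable _ (measurableTypeR R) (@window R N).
Proof. exact: measurable_itv. Qed.

Lemma window_subset m n : (m <= n)%N -> @window R m `<=` @window R n.
Proof.
move=> mn x; rewrite /window /= !in_itv /= => /andP[a b].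
have mn' : m%:R <= n%:R :> R by rewrite ler_nat.
by apply/andP; split; lra.
Qed.

Lemma window_cover (x : R) : exists N, window N x.
Proof.
exists (Num.truncn `|x|).+1; rewrite /window /= in_itv /=.
have h := truncnS_gt `|x|; apply/andP; split; have := ler_norm x; have := ler_norm (- x);
  rewrite normrN; lra.
Qed.

Lemma ae_inner_finite f : measurable_fun setT f -> (forall z, 0 <= f z)%E ->
  (forall N, \int[mu]_(p in window N) \int[mu]_(x in window N) f (p, x) < +oo)%E ->
  {ae mu, forall p, forall N, (\int[mu]_(x in window N) f (p, x) < +oo)%E}.
Proof.
move=> mf f0 fin.
have h N : {ae mu, forall p, window N p -> (\int[mu]_(x in window N) f (p, x))%E \is a fin_num}.
  apply: integrable_ae; first exact: measurable_window.
  apply/integrableP; split.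
    by apply: measurable_funTS; apply: measurable_inner_integral => //; exact: measurable_window.
  under eq_integral do rewrite gee0_abs ?integral_ge0//.
  exact: fin.
have := ae_foralln h; apply: filterS => p hp N.
have [M Mp] := window_cover p.
(* The bound at level [N] speaks only of parameters inside that window, so the window is enlarged
   until it contains [p]. *)
have Mp' : window (maxn M N) p by apply: window_subset Mp; exact: leq_maxl.
have := hp _ Mp'; rewrite fin_numElt => /andP[_].
apply: le_lt_trans; apply: ge0_subset_integral => //.
- exact: measurable_window.
- exact: measurable_window.
- by apply: measurable_funTS; apply: (measurableT_comp mf); exact: pair1_measurable.
- by apply: window_subset; exact: leq_maxr.
Qed.

End IteratedIntegrals.

(** [G m n] is the increment of a nondecreasing bounded sequence, so it is at most [e] beyond an
    index where [E] is within [e] of its supremum. *)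
Lemma increment_small (R : realType) (E : nat -> \bar R) (G : nat -> nat -> \bar R)
    (C e : R) :
  (forall n, 0 <= E n)%E -> (forall m n, 0 <= G m n)%E -> (forall n, E n <= C%:E)%E ->
  (forall m n, (n <= m)%N -> (G m n + E n = E m)%E) -> 0 < e ->
  exists n0, forall m n, (n0 <= n)%N -> (n <= m)%N -> (G m n <= e%:E)%E.
Proof.
move=> E0 G0 EC GE e0.
have fin n : E n \is a fin_num.
  by rewrite ge0_fin_numE//; apply: le_lt_trans (EC n) _; rewrite ltry.
have [F FE] : exists F : nat -> R, forall n, E n = (F n)%:E.
  by exists (fun n => fine (E n)) => n; rewrite fineK.
have hS : has_sup (range F).
  split; first by exists (F 0%N), 0%N.
  by exists C => _ [n _ <-]; rewrite -lee_fin -FE.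
have [_ [n0 _ <-] hn0] := sup_adherent e0 hS.
have mono a b : (a <= b)%N -> F a <= F b.
  by move=> ab; rewrite -lee_fin -!FE -(GE _ _ ab) leeDr.
exists n0 => m n n0n nm.
have hm : F m <= sup (range F) by apply: ub_le_sup => //; case: hS.
have := mono _ _ n0n; have := GE _ _ nm; rewrite !FE.
case: (G m n) (G0 m n) => // r _; rewrite -EFinD lee_fin => -[] rE; rewrite -rE in hm.
by move: (sup _) (F n0) (F n) hn0 hm => s a b; lra.
Qed.

Section Derivative.
Variables (R : realType) (d : nat) (v : 'I_d -> R -> R -> R).
Local Notation mu := (@lebesgue_measure R).
Local Notation W := (@window R).
Hypothesis mv : forall i, measurable_fun setT (uncurry2 (v i)).
Hypothesis cv : forall i p, continuous (v i p).

(** [p] is the parameter and [x] the variable of differentiation. Summing over components lets one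
    subsequence serve all of them. *)
Definition dq_energy N n : \bar R := (\sum_(i < d)
  \int[mu]_(p in W N) \int[mu]_(x in W N) (diff_quot (v i p) n x ^+ 2)%:E)%E.
Hypothesis dq_bound : forall N, exists C : R, forall n, (dq_energy N n <= C%:E)%E.

Definition dq_gap N m n : \bar R := (\sum_(i < d)
  \int[mu]_(p in W N) \int[mu]_(x in W N)
    ((diff_quot (v i p) m x - diff_quot (v i p) n x) ^+ 2)%:E)%E.

Lemma dq_energy_ge0 N n : (0 <= dq_energy N n)%E.
Proof.
by apply: sume_ge0 => i _; apply: integral_ge0 => p _; apply: integral_ge0 => x _;
  rewrite lee_fin sqr_ge0.
Qed.

Lemma dq_gap_ge0 N m n : (0 <= dq_gap N m n)%E.
Proof.
by apply: sume_ge0 => i _; apply: integral_ge0 => p _; apply: integral_ge0 => x _;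
  rewrite lee_fin sqr_ge0.
Qed.

Lemma measurable_dq_sqr i n :
  measurable_fun setT (fun z : R * R => (diff_quot (v i z.1) n z.2 ^+ 2)%:E).
Proof.
by apply/measurable_EFinP; apply: measurable_funX; exact: measurable_diff_quot (mv i).
Qed.

Lemma measurable_dq_gap_sqr i m n :
  measurable_fun setT (fun z : R * R =>
    ((diff_quot (v i z.1) m z.2 - diff_quot (v i z.1) n z.2) ^+ 2)%:E).
Proof.
by apply/measurable_EFinP; apply: measurable_funX; apply: measurable_funB;
  exact: measurable_diff_quot (mv i).
Qed.

Lemma dq_energyD N m n : (n <= m)%N ->
  (dq_gap N m n + dq_energy N n = dq_energy N m)%E.
Proof.
move=> nm; rewrite /dq_gap /dq_energy -big_split /=; apply: eq_bigr => i _.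
rewrite -ge0_integralD//; last 5 first.
- exact: measurable_window.
- by move=> p _; apply: integral_ge0 => x _; rewrite lee_fin sqr_ge0.
- apply: measurable_funTS.
  apply: (measurable_inner_integral (measurable_dq_gap_sqr i m n)); last exact: measurable_window.
  by move=> z; rewrite lee_fin sqr_ge0.
- by move=> p _; apply: integral_ge0 => x _; rewrite lee_fin sqr_ge0.
- apply: measurable_funTS.
  apply: (measurable_inner_integral (measurable_dq_sqr i n)); last exact: measurable_window.
  by move=> z; rewrite lee_fin sqr_ge0.
by apply: eq_integral => p _; exact: (diff_quot_pythagoras (@cv i p) N nm).
Qed.

Lemma dq_gap_window M N m n : (M <= N)%N -> (dq_gap M m n <= dq_gap N m n)%E.
Proof.
move=> MN; apply: lee_sum => i _.
have s0 p x : (0 <= ((diff_quot (v i p) m x - diff_quot (v i p) n x) ^+ 2)%:E)%E.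
  by rewrite lee_fin sqr_ge0.
have mI K : measurable_fun setT (fun p => \int[mu]_(x in W K)
    ((diff_quot (v i p) m x - diff_quot (v i p) n x) ^+ 2)%:E)%E.
  apply: (measurable_inner_integral (measurable_dq_gap_sqr i m n)); last exact: measurable_window.
  by move=> z; exact: s0.
apply: (@le_trans _ _ (\int[mu]_(p in W M) \int[mu]_(x in W N)
    ((diff_quot (v i p) m x - diff_quot (v i p) n x) ^+ 2)%:E)%E).
  apply: ge0_le_integral.
  - exact: measurable_window.
  - by move=> p _; apply: integral_ge0.
  - by apply: measurable_funTS; exact: mI.
  - by apply: measurable_funTS; exact: mI.
  - move=> p _; apply: ge0_subset_integral => //; last exact: window_subset.
    + exact: measurable_window.
    + exact: measurable_window.
    + apply: measurable_funTS.
      exact: (measurableT_comp (measurable_dq_gap_sqr i m n) (pair1_measurable p)).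
apply: ge0_subset_integral; last exact: window_subset.
- exact: measurable_window.
- exact: measurable_window.
- by apply: measurable_funTS; exact: mI.
- by move=> p _; apply: integral_ge0.
Qed.

Lemma dq_gap_small N (e : R) : 0 < e ->
  exists n0, forall m n, (n0 <= n)%N -> (n <= m)%N -> (dq_gap N m n <= e%:E)%E.
Proof.
move=> e0; have [C HC] := dq_bound N.
exact: (increment_small (@dq_energy_ge0 N) (@dq_gap_ge0 N) HC (@dq_energyD N)).
Qed.

Lemma dq_subseq : exists nk : nat -> nat,
  [/\ forall k, (k <= nk k)%N, forall k, (nk k <= nk k.+1)%N &
  forall k, (dq_gap k (nk k.+1) (nk k) <= (4^-1 ^+ k)%:E)%E].
Proof.
have /choice[n0 H] k : exists n0, forall m n, (n0 <= n)%N -> (n <= m)%N ->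
    (dq_gap k m n <= (4^-1 ^+ k)%:E)%E by apply: dq_gap_small; rewrite exprn_gt0.
(* The partial sum makes the sequence monotone and at least [n0 k], the summand [k] makes it at
   least [k]. The k-th gap is measured on the k-th window, so the same subsequence works for all
   windows. *)
pose nk k := (\sum_(i < k.+1) n0 i + k)%N.
have nkS k : (nk k <= nk k.+1)%N.
  by rewrite /nk [X in (_ <= X + _)%N]big_ord_recr /= leq_add// leq_addr.
exists nk; split => // k; first exact: leq_addl.
by apply: H => //; rewrite /nk big_ord_recr /= -addnA addnC -addnA leq_addr.
Qed.


Lemma nneseries_ge_term (u : nat -> \bar R) k : (forall n, 0 <= u n)%E ->
  (u k <= \sum_(0 <= n <oo) u n)%E.
Proof.
move=> u0; apply: le_trans (@nneseries_lim_ge _ u xpredT 0%N k.+1 (fun n _ _ => u0 n)).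
by rewrite big_nat_recr //= leeDr// sume_ge0.
Qed.

Lemma geometric_cvg (u : nat -> R) (C q : R) : 0 <= C -> 0 <= q < 1 ->
  (forall n, `|u n.+1 - u n| <= C * q ^+ n) ->
  cvgn u /\ forall n, `|u n - limn u| <= C / (1 - q) * q ^+ n.
Proof.
move=> C0 q01 hu.
have hg n m : `|u (n + m)%N - u n| <= C / (1 - q) * q ^+ n.
  have nE (x : R^o) : seminorm (fun x y : R^o => x * y) x = `|x|.
    by rewrite /seminorm -expr2 sqrtr_sqr.
  have := @nrm_dist_geom R R^o (fun x y => x * y) (fun x y => mulrC x y)
    (fun x y z => mulrDl x y z) (fun a x z => esym (mulrA a x z))
    (fun x => sqr_ge0 x) u C q C0 q01.
  move=> hn; apply: (@le_trans _ _ _ _ _ _ (hn _ n m)).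
    by rewrite le_eqVlt; apply/orP; left; apply/eqP; exact/esym/nE.
  by move=> k; apply: le_trans (hu k); rewrite le_eqVlt; apply/orP; left; apply/eqP; exact/nE.
have B0 : 0 <= C / (1 - q) by rewrite divr_ge0//; lra.
have cu : cvgn u.
  apply/cauchy_cvgP/cauchy_exP => e e0.
  have : C / (1 - q) * q ^+ n @[n --> \oo] --> 0.
    by apply: (@cvg_geometric R _ q); rewrite ger0_norm; lra.
  move=> /cvgrPdist_lt /(_ e e0) [N _ HN].
  exists (u N); exists N => // m /= Nm.
  rewrite /ball /= distrC -(subnKC Nm); apply: (le_lt_trans (hg _ _)).
  have := HN N (leqnn N); rewrite /= sub0r normrN ger0_norm// mulr_ge0// exprn_ge0//; lra.
split=> // n; rewrite distrC.
apply: (@cvgr_to_le _ \oo _ R (fun m => `|u (n + m)%N - u n|) _ _ _); last first.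
  by apply: nearW => m; exact: hg.
apply: cvg_norm; apply: cvgB; last exact: cvg_cst.
have -> : (fun m => u (n + m)%N) = (fun m => u (m + n)%N) by apply/funext => m; rewrite addnC.
by rewrite (cvg_shiftn n u).
Qed.

(* By Pythagoras the quotients are Cauchy in [L^2]; along a subsequence with gaps
   [4^-k], [H] is the sum of the squared increments weighted by [2^k]. *)
Theorem sobolev_derivative :
  exists (g : 'I_d -> R -> R -> R) (nk : nat -> nat) (H : R * R -> \bar R),
  [/\ forall i, measurable_fun setT (uncurry2 (g i)),
      measurable_fun setT H, forall z, (0 <= H z)%E &
      forall N, (\int[mu]_(p in W N) \int[mu]_(x in W N) H (p, x) < +oo)%E] /\
  [/\ forall k, (k <= nk k)%N,
      forall i k p x, (((diff_quot (v i p) (nk k) x - g i p x) ^+ 2)%:E <=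
        (16 * (9 / 16) ^+ k)%:E * H (p, x))%E,
      forall p x, (forall i, g i p x = 0) \/
        (forall i, diff_quot (v i p) (nk k) x @[k --> \oo] --> g i p x) &
      forall p p', (forall i, v i p = v i p') -> forall i, g i p = g i p'].
Proof.
have [nk [nk_ge nk_mono nk_gap]] := dq_subseq.
pose DQ i k (z : R * R) := diff_quot (v i z.1) (nk k) z.2.
pose T k (z : R * R) : R := 2 ^+ k * \sum_(i < d) (DQ i k.+1 z - DQ i k z) ^+ 2.
have T0 k z : 0 <= T k z by rewrite mulr_ge0 ?exprn_ge0// sumr_ge0// => i _; exact: sqr_ge0.
have mDQ i k : measurable_fun setT (DQ i k) by exact: measurable_diff_quot (mv i).
have T0' k z : (0 <= (T k z)%:E)%E by rewrite lee_fin.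
have mT k : measurable_fun setT (EFin \o T k).
  apply/measurable_EFinP; apply: measurable_funM => //; apply: measurable_sum => i.
  by apply: measurable_funX; apply: measurable_funB.
pose H z := (\sum_(0 <= k <oo) (T k z)%:E)%E.
have H0 z : (0 <= H z)%E by apply: nneseries_ge0 => k _ _; rewrite lee_fin.
have mH : measurable_fun setT H.
  exact: (@ge0_emeasurable_sum _ _ R setT (fun k z => (T k z)%:E) xpredT
    (fun k z _ _ => T0' k z) (fun k _ => mT k)).
(* Where the series [H] diverges the quotients are replaced by 0; the limit then exists at every
   point. *)
pose A := [set z | (H z < +oo)%E].
have mA : measurable A.
  by rewrite -[A]setTI; exact: emeasurable_fun_infty_o.
pose u i z k := (DQ i k \_ A) z.
have uP i z : A z -> `|fine (H z)| = fine (H z) /\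
    forall k, (u i z k.+1 - u i z k) ^+ 2 <= fine (H z) * (9 / 16) ^+ k.
  move=> Az; have Hf : H z \is a fin_num by rewrite ge0_fin_numE.
  split; first by rewrite ger0_norm// fine_ge0.
  move=> k; rewrite /u !patchE !mem_set//.
  have : ((T k z)%:E <= H z)%E.
    by apply: (@nneseries_ge_term (fun k => (T k z)%:E)).
  rewrite -(fineK Hf) lee_fin /T (bigD1 i)//= => hT.
  have s0 : 0 <= \sum_(j < d | j != i) (DQ j k.+1 z - DQ j k z) ^+ 2.
    by apply: sumr_ge0 => j _; exact: sqr_ge0.
  have F0 : 0 <= fine (H z) by exact: fine_ge0.
  (* The natural rate 2^-k is weakened to (9/16)^k, the square of (3/4)^k, so that its square root
     is rational. *)
  apply: (@le_trans _ _ (fine (H z) * 2^-1 ^+ k)).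
    rewrite exprVn ler_pdivlMr ?exprn_gt0// mulrC.
    by apply: le_trans hT; rewrite ler_pM2l ?exprn_gt0// lerDl.
  by apply: ler_wpM2l => //; apply: lerXn2r; rewrite ?nnegrE; lra.
have uc i z : cvgn (u i z) /\ forall k, (((u i z k - limn (u i z)) ^+ 2)%:E <=
    (16 * (9 / 16) ^+ k)%:E * H z)%E.
  have q01 : 0 <= (3 / 4 : R) < 1 by lra.
  have [Az|nAz] := pselect (A z); last first.
    have uE : u i z = fun=> 0 by apply/funext => k; rewrite /u patchE memNset.
    rewrite uE; split; first exact: is_cvg_cst.
    move=> k; rewrite lim_cst// subrr expr0n /=.
    by rewrite mule_ge0// lee_fin mulr_ge0// exprn_ge0//; lra.
  have [_ hu] := uP i z Az.
  have Hf : H z \is a fin_num by rewrite ge0_fin_numE.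
  have F0 : 0 <= fine (H z) by exact: fine_ge0.
  have q2 k : (9 / 16) ^+ k = ((3 / 4) ^+ k) ^+ 2 :> R by rewrite exprAC; congr (_ ^+ _); lra.
  have q0 k : 0 <= (3 / 4) ^+ k :> R by rewrite exprn_ge0//; lra.
  have [|cu lu] := @geometric_cvg (u i z) (Num.sqrt (fine (H z))) (3 / 4) (sqrtr_ge0 _) q01.
    move=> k; rewrite -ler_sqr ?nnegrE ?mulr_ge0 ?sqrtr_ge0//.
    by rewrite exprMn sqr_sqrtr// -q2 real_normK ?num_real.
  split=> // k; rewrite -(fineK Hf) -EFinM lee_fin.
  rewrite -[(_ - _) ^+ 2]real_normK ?num_real//.
  (* Summing the geometric tail costs 1 / (1 - 3/4) = 4, whose square is the constant 16. *)
  apply: (@le_trans _ _ ((Num.sqrt (fine (H z)) / (1 - 3 / 4) * (3 / 4) ^+ k) ^+ 2)).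
    by rewrite lerXn2r ?nnegrE ?mulr_ge0 ?sqrtr_ge0// invr_ge0; lra.
  rewrite [leLHS]exprMn -q2 [(_ / _) ^+ 2]exprMn sqr_sqrtr//.
  have -> : (1 - 3 / 4 : R)^-1 ^+ 2 = 16.
    by rewrite (_ : 1 - 3 / 4 = 4^-1 :> R) ?invrK; lra.
  by rewrite le_eqVlt; apply/orP; left; apply/eqP; ring.
pose g i p x := limn (u i (p, x)).
exists g, nk, H; split; split => //.
- move=> i; apply: (@measurable_fun_cvg _ _ _ _ (fun k z => u i z k)).
    move=> k; apply/(measurable_restrictT (DQ i k)) => //; exact: measurable_funTS.
  by move=> [p x] _; exact: (uc i (p, x)).1.
- move=> N; have [C HC] := dq_bound N.
  have mW := @measurable_window R N.
  have C0 : 0 <= C by rewrite -lee_fin; apply: le_trans (HC 0%N); exact: dq_energy_ge0.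
  have -> : (\int[mu]_(p in W N) \int[mu]_(x in W N) H (p, x) =
      \sum_(0 <= k <oo) (2 ^+ k)%:E * dq_gap N (nk k.+1) (nk k))%E.
    transitivity (\int[mu]_(p in W N) \sum_(0 <= k <oo) \int[mu]_(x in W N) (T k (p, x))%:E)%E.
      apply: eq_integral => p _; rewrite integral_nneseries// => k.
      by apply: measurable_funTS; exact: (measurableT_comp (mT k) (pair1_measurable p)).
    rewrite integral_nneseries//; last 2 first.
    - move=> k; apply: measurable_funTS.
      exact: (measurable_inner_integral (mT k) (T0' k) mW).
    - by move=> k p _; exact: integral_ge0.
    apply: eq_eseriesr => k _; rewrite /dq_gap.
    have c0 : 0 <= 2 ^+ k :> R by exact: exprn_ge0.
    pose f i (z : R * R) := ((DQ i k.+1 z - DQ i k z) ^+ 2)%:E : \bar R.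
    have f0 i z : (0 <= f i z)%E by rewrite lee_fin sqr_ge0.
    have mf i : measurable_fun setT (f i) by exact: measurable_dq_gap_sqr.
    have mfp i p : measurable_fun (W N) (fun x => f i (p, x)).
      by apply: measurable_funTS; exact: (measurableT_comp (mf i) (pair1_measurable p)).
    have mfI i : measurable_fun (W N) (fun p => \int[mu]_(x in W N) f i (p, x))%E.
      by apply: measurable_funTS; exact: (measurable_inner_integral (mf i) (f0 i) mW).
    transitivity (\int[mu]_(p in W N) ((2 ^+ k)%:E * \sum_(i < d) \int[mu]_(x in W N) f i (p, x)))%E.
      apply: eq_integral => p _.
      rewrite -ge0_integral_sum//; last by move=> i; exact: mfp.
      rewrite -ge0_integralZl//; last 2 first.
      - by apply: emeasurable_sum => i; exact: mfp.
      - by move=> x _; apply: sume_ge0.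
      by apply: eq_integral => x _; rewrite sumEFin -EFinM.
    rewrite ge0_integralZl//; last 2 first.
    - by apply: emeasurable_sum => i; exact: mfI.
    - by move=> p _; apply: sume_ge0 => i _; exact: integral_ge0.
    rewrite ge0_integral_sum//.
    all: try exact: mfI.
    by move=> i p _; exact: integral_ge0.
  (* For k > N the gap on window N is at most the one on the larger window k, bounded by 4^-k. The
     finitely many k <= N are bounded by the energy [C], and 4^N compensates 4^-k there. *)
  pose c : R := 4 ^+ N * C + 1.
  have c0 : 0 <= c by rewrite addr_ge0// mulr_ge0// exprn_ge0.
  apply: (@le_lt_trans _ _ (\sum_(0 <= k <oo) ((2 * c) / (2 ^ (k + 0.+1))%:R)%:E)%E); last first.
    by have /cvg_lim -> := @cvg_geometric_eseries_half R (2 * c) 0; rewrite // ltry.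
  apply: lee_nneseries => [k _ _|k _].
    by rewrite mule_ge0 ?dq_gap_ge0// lee_fin exprn_ge0.
  have p2 : 0 < 2 ^+ k :> R by exact: exprn_gt0.
  have i2 : 0 < 2^-1 ^+ k :> R by exact: exprn_gt0.
  have -> : 2 * c / (2 ^ (k + 1))%:R = 2 ^+ k * (c * (4^-1 ^+ k)) :> R.
    rewrite addn1 expnS natrM natrX.
    have -> : 4^-1 ^+ k = 2^-1 ^+ k * 2^-1 ^+ k :> R by rewrite -exprMn; congr (_ ^+ _); lra.
    rewrite exprVn; move: (2 ^+ k) p2 => P P0.
    by field; exact: lt0r_neq0.
  rewrite EFinM; apply: lee_wpmul2l; first by rewrite lee_fin ltW.
  have [kN|Nk] := leqP k N; last first.
    apply: (le_trans (dq_gap_window _ _ (ltnW Nk))); apply: (le_trans (nk_gap k)).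
    rewrite lee_fin ler_peMl ?exprn_ge0// /c lerDr mulr_ge0// exprn_ge0//.
  apply: (@le_trans _ _ (dq_energy N (nk k.+1))).
    by rewrite -(dq_energyD N (nk_mono k)) leeDl// dq_energy_ge0.
  apply: (le_trans (HC _)); rewrite lee_fin exprVn ler_pdivlMr ?exprn_gt0// /c mulrC.
  apply: (@le_trans _ _ (4 ^+ N * C)); last by rewrite lerDl.
  by rewrite ler_wpM2r// ler_weXn2l// ler1n.
- move=> i k p x; have [Ax|nAx] := pselect (A (p, x)).
    have := (uc i (p, x)).2 k; rewrite {1}/u patchE mem_set//.
  have -> : H (p, x) = +oo%E.
    by apply/eqP; rewrite eq_le leey /= leNgt; apply/negP.
  by rewrite gt0_muley ?leey// lte_fin mulr_gt0// exprn_gt0//; lra.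
- move=> p x; have [Ax|nAx] := pselect (A (p, x)); [right|left] => i.
    have e : u i (p, x) = fun k => diff_quot (v i p) (nk k) x.
      by apply/funext => k; rewrite /u patchE mem_set.
    by have := (uc i (p, x)).1; rewrite /g e.
  by rewrite /g (_ : u i (p, x) = fun=> 0) ?lim_cst//; apply/funext => k; rewrite /u patchE memNset.
(* The construction depends on [p] only through the functions [v i p]. This will make the time
   derivative exactly periodic in space. *)
- move=> p p' vp i; apply/funext => x; rewrite /g.
  have DE j k : DQ j k (p, x) = DQ j k (p', x) by rewrite /DQ /= vp.
  have HE : H (p, x) = H (p', x).
    apply: eq_eseriesr => k _; rewrite /T; congr (_ * _)%:E.
    by apply: eq_bigr => j _; rewrite !DE.
  congr (limn _); apply/funext => k; rewrite /u !patchE DE.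
  suff -> : ((p, x) \in A) = ((p', x) \in A) by [].
  by apply/idP/idP => /set_mem ?; apply: mem_set; rewrite /A /= ?HE// -HE.
Qed.

End Derivative.

(** * The limit of the quotients integrates to the function *)

Section SobolevAC.
Variable R : realType.
Local Notation mu := (@lebesgue_measure R).
Local Notation W := (@window R).
Local Notation h := (@dyadic_step R).

Lemma EFin_Rintegral (D : set R) (f : R -> R) : measurable D ->
  mu.-integrable D (EFin \o f) -> (\int[mu]_(x in D) f x)%:E = (\int[mu]_(x in D) (f x)%:E)%E.
Proof. by move=> mD fi; rewrite fineK// integrable_fin_num. Qed.

(** The integral telescopes up to the cell containing [x], and the remaining piece of that cell
    contributes at most one cell increment of [w]. Both error terms vanish as [n] grows, by
    continuity of [w] at [x]. *)
Lemma Rintegral_diff_quot_approx (w : R -> R) n (N : nat) x : continuous w -> - N%:R <= x ->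
  `|\int[mu]_(y in `[- N%:R, x[) diff_quot w n y - (w x - w (- N%:R))| <=
  `|w (cell_left n x) - w x| + `|w (cell_left n x + h n) - w (cell_left n x)|.
Proof.
move=> cw Nx; have hp := dyadic_step_gt0 R n.
pose k : int := - (N * 2 ^ n)%N%:Z.
have kE : k%:~R * h n = - N%:R :> R.
  rewrite /k mulrNz mulNr; congr (- _).
  rewrite -[_%:~R]/((N * 2 ^ n)%:R).
  by rewrite natrM natrX -mulrA (mulrC (2 ^+ n)) dyadic_stepV mulr1.
pose m := Num.floor (x * 2 ^+ n).
have km : k <= m.
  have e : k%:~R = - N%:R * 2 ^+ n :> R by rewrite -kE -mulrA dyadic_stepV mulr1.
  by rewrite floor_ge_int e ler_pM2r ?exprn_gt0.
have [j jE] : exists j : nat, m = k + j%:Z.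
  by exists `|m - k|%N; rewrite gez0_abs ?subr_ge0// [RHS]addrC subrK.
have xE : cell_left n x = (k + j%:Z)%:~R * h n by rewrite /cell_left -/m jE.
have /andP[x1 x2] := cell_left_itv n x.
have Nxl : - N%:R <= cell_left n x.
  by rewrite xE -kE ler_pM2r// ler_int lerDl.
have sp : `[- N%:R, x[%classic = cells n k j `|` `[cell_left n x, x[%classic :> set R.
  by rewrite /cells kE -xE; apply: itv_bndbnd_setU; rewrite bnd_simp.
rewrite sp Rintegral_setU//; last 3 first.
- exact: measurable_itv.
- by rewrite -sp; exact: diff_quot_integrable.
- apply/disj_setPS => y /= []; rewrite /cells /= !in_itv /= -xE => /andP[_ a] /andP[b _].
  by move: (le_lt_trans b a); rewrite ltxx.
rewrite Rintegral_diff_quot// -xE kE.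
set c := (w (cell_left n x + h n) - w (cell_left n x)) / h n.
have -> : \int[mu]_(y in `[cell_left n x, x[) diff_quot w n y =
  \int[mu]_(y in `[cell_left n x, x[) c.
  apply: eq_Rintegral => y /set_mem /=; rewrite in_itv /= => /andP[y1 y2].
  rewrite /diff_quot (@cell_leftE _ n m y)//.
  by rewrite /cell /= in_itv /= y1 (lt_trans y2).
rewrite Rintegral_cst; last exact: measurable_itv.
have -> : fine (mu `[cell_left n x, x[%classic) = x - cell_left n x.
  rewrite lebesgue_measure_itv /= lte_fin; case: ltP => // xl /=.
  by apply/esym/eqP; rewrite subr_eq0 eq_le xl x1.
have -> : w (cell_left n x) - w (- N%:R) + c * (x - cell_left n x) - (w x - w (- N%:R)) =
  (w (cell_left n x) - w x) + c * (x - cell_left n x) by ring.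
apply: (le_trans (ler_normD _ _)); rewrite lerD2l.
rewrite normrM /c normrM normfV (gtr0_norm hp) -mulrA ler_piMr//.
rewrite mulrC ler_pdivrMr// mul1r ger0_norm ?subr_ge0//; lra.
Qed.

Variables (w g : R -> R) (H : R -> \bar R) (nk : nat -> nat).
Hypotheses (cw : continuous w) (mg : measurable_fun setT g)
  (mH : measurable_fun setT H) (H0 : forall x, (0 <= H x)%E)
  (finH : forall N, (\int[mu]_(x in W N) H x < +oo)%E)
  (nk_ge : forall k, (k <= nk k)%N)
  (approx : forall k x, (((diff_quot w (nk k) x - g x) ^+ 2)%:E <=
     (16 * (9 / 16) ^+ k)%:E * H x)%E).

(* [|y| <= (e + y^2/e)/2] with [e = (3/4)^k] turns the L^2 rate into an L^1 rate. *)
Lemma diff_quot_L1 k x :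
  (`|diff_quot w (nk k) x - g x|%:E <= ((3 / 4) ^+ k)%:E * (1 + 8%:E * H x))%E.
Proof.
have q0 : 0 < (3 / 4) ^+ k :> R by rewrite exprn_gt0//; lra.
have := approx k x; case: (H x) (H0 x) => [r|_ _|//].
  rewrite lee_fin => r0; rewrite -EFinM lee_fin => hr.
  rewrite -[(1 + _)%E]/((1 + 8 * r)%:E) -EFinM lee_fin.
  have q2 : (9 / 16) ^+ k = ((3 / 4) ^+ k) ^+ 2 :> R by rewrite exprAC; congr (_ ^+ _); lra.
  move: hr; rewrite q2 -[(_ - _) ^+ 2]real_normK ?num_real//.
  move: (`|_|) ((3 / 4) ^+ k) q0 => y q q0 hy.
  rewrite -(ler_pM2l q0).
  have := sqr_ge0 (y - q); nra.
by rewrite gt0_muley ?lte_fin// addey// gt0_muley ?lte_fin// leey.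
Qed.

Lemma itv_window (a b : R) : exists N, `[a, b] `<=` W N.
Proof.
have [M aM] := window_cover a; have [N bN] := window_cover b.
exists (maxn M N) => x /=; rewrite in_itv /= => /andP[ax xb].
have := window_subset (leq_maxl M N) aM; have := window_subset (leq_maxr M N) bN.
by rewrite /window /= !in_itv /= => /andP[_ b2] /andP[a1 _]; apply/andP; split; lra.
Qed.

Lemma H_itv_finite (a b : R) : (\int[mu]_(x in `[a, b]) (1 + 8%:E * H x) < +oo)%E.
Proof.
have [N sN] := itv_window a b.
have m8 D : measurable D -> measurable_fun D (fun x => 8%:E * H x)%E.
  by move=> mD; apply: measurable_funTS; exact: measurable_funeM.
rewrite ge0_integralD//; last 2 first.
- by move=> x _; rewrite mule_ge0// lee_fin.
- exact: m8.
apply: lte_add_pinfty.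
  rewrite integral_cst//= mul1e lebesgue_measure_itv /=.
  by case: ifP => _; rewrite ?ltry// -EFinB ltry.
rewrite ge0_integralZl//; last exact: measurable_funTS.
apply: lte_mul_pinfty; [by []|by []|].
apply: le_lt_trans (finH N); apply: ge0_subset_integral => //.
- exact: measurable_itv.
- exact: measurable_funTS.
Qed.

Lemma itvco_cc (a b : R) : `[a, b[ `<=` `[a, b].
Proof. by move=> x /=; rewrite !in_itv /= => /andP[-> /ltW]. Qed.

Lemma sobolev_integrable (a b : R) : mu.-integrable `[a, b] (EFin \o g).
Proof.
have ib : mu.-integrable `[a, b] (EFin \o diff_quot w (nk 0)).
  apply: integrableS (diff_quot_integrable cw (nk 0) a (b + 1)) => //.
  by move=> x /=; rewrite !in_itv /= => /andP[-> ?]; lra.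
have ie : mu.-integrable `[a, b] (EFin \o (fun x => g x - diff_quot w (nk 0) x)).
  apply/integrableP; split.
    apply: measurable_funTS; apply/measurable_EFinP; apply: measurable_funB => //.
    exact: measurable_diff_quot1.
  apply: le_lt_trans (H_itv_finite a b); apply: ge0_le_integral => //.
  - apply: measurable_funTS; apply: measurableT_comp => //; apply/measurable_EFinP.
    by apply: measurable_funB => //; exact: measurable_diff_quot1.
  - apply: measurable_funTS; apply: emeasurable_funD => //; exact: measurable_funeM.
  - by move=> x _; have := diff_quot_L1 0 x; rewrite expr0 mul1e /= distrC.
apply: eq_integrable (integrableD _ ib ie) => //.
by move=> x _ /=; rewrite -EFinD addrC subrK.
Qed.

Lemma Rintegral_diff_quot_cvg (a b : R) :
  \int[mu]_(x in `[a, b[) diff_quot w (nk k) x @[k --> \oo] -->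
  \int[mu]_(x in `[a, b[) g x.
Proof.
pose B := fine (\int[mu]_(x in `[a, b]) (1 + 8%:E * H x))%E.
have s0 x : (0 <= 1 + 8%:E * H x)%E by rewrite adde_ge0// mule_ge0// lee_fin.
have Bf : (\int[mu]_(x in `[a, b]) (1 + 8%:E * H x))%E \is a fin_num.
  by rewrite ge0_fin_numE ?H_itv_finite// integral_ge0.
have ig : mu.-integrable `[a, b[ (EFin \o g).
  by apply: integrableS (sobolev_integrable a b) => //; exact: itvco_cc.
have est k : `|\int[mu]_(x in `[a, b[) diff_quot w (nk k) x - \int[mu]_(x in `[a, b[) g x|
    <= (3 / 4) ^+ k * B.
  have id := diff_quot_integrable cw (nk k) a b.
  rewrite -RintegralB//.
  have iB : mu.-integrable `[a, b[ (EFin \o (fun x => diff_quot w (nk k) x - g x)).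
    by apply: eq_integrable (integrableB _ id ig).
  apply: (le_trans (le_normr_Rintegral _ iB)) => //.
  rewrite -lee_fin EFinM (fineK Bf) EFin_Rintegral//; last first.
    by have := integrable_norm iB; apply: eq_integrable.
  have q0 : 0 <= (3 / 4) ^+ k :> R by rewrite exprn_ge0//; lra.
  rewrite -ge0_integralZl//; last first.
    by apply: measurable_funTS; apply: emeasurable_funD => //; exact: measurable_funeM.
  have md : measurable_fun setT (fun x => `|diff_quot w (nk k) x - g x|%:E).
    apply/measurable_EFinP; apply: measurableT_comp => //.
    by apply: measurable_funB => //; exact: measurable_diff_quot1.
  apply: (@le_trans _ _ (\int[mu]_(x in `[a, b]) `|diff_quot w (nk k) x - g x|%:E)%E).
    apply: ge0_subset_integral => //; first exact: measurable_funTS.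
    exact: itvco_cc.
  apply: ge0_le_integral => //.
  - exact: measurable_funTS.
  - apply: measurable_funTS; apply: measurable_funeM.
    by apply: emeasurable_funD => //; exact: measurable_funeM.
  - by move=> x _; exact: diff_quot_L1.
apply/cvgrPdist_le => e e0.
have : (3 / 4) ^+ k * B @[k --> \oo] --> 0.
  rewrite -[0](mul0r B); apply: cvgM; last exact: cvg_cst.
  by apply: cvg_expr; rewrite ger0_norm; lra.
move=> /cvgrPdist_le /(_ e e0); apply: filterS => k; rewrite sub0r normrN => hk.
by rewrite distrC; apply: (le_trans (est k)); apply: le_trans hk; exact: ler_norm.
Qed.

Lemma sobolev_window (N : nat) x : - N%:R <= x ->
  w x - w (- N%:R) = \int[mu]_(y in `[- N%:R, x[) g y.
Proof.
move=> Nx; have := @Rintegral_diff_quot_cvg (- N%:R) x => h1.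
apply/esym/(cvg_unique _ h1) => //.
have nkoo : nk k @[k --> \oo] --> \oo.
  move=> A [M _ HA]; exists M => // k /= Mk; apply: HA; exact: leq_trans (nk_ge k).
pose r n := `|w (cell_left n x) - w x| + `|w (cell_left n x + h n) - w (cell_left n x)|.
have r0 : r n @[n --> \oo] --> 0.
  have c1 : w (cell_left n x) @[n --> \oo] --> w x.
    by apply: continuous_cvg; [exact: cw|exact: cvg_cell_left].
  have c2 : w (cell_left n x + h n) @[n --> \oo] --> w x.
    by apply: continuous_cvg; [exact: cw|exact: cvg_cell_right].
  rewrite -[0]addr0 -{1}(@normr0 _ R) -{1}(subrr (w x)) -(@normr0 _ R) -(subrr (w x)).
  by apply: cvgD; apply: cvg_norm; apply: cvgB => //; exact: cvg_cst.
have {}r0 : r (nk k) @[k --> \oo] --> 0 by apply: (cvg_comp _ _ nkoo r0).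
apply/cvgrPdist_le => e e0; move: r0 => /cvgrPdist_le /(_ e e0); apply: filterS => k.
rewrite sub0r normrN => hk; rewrite distrC.
apply: (le_trans (Rintegral_diff_quot_approx _ cw Nx)).
by apply: le_trans hk; exact: ler_norm.
Qed.

Lemma sobolev_AC : AC_loc w g.
Proof.
move=> b c bc; split; first exact: sobolev_integrable.
have [N sN] := itv_window b c.
have Nb : - N%:R <= b.
  by have /sN : [set` `[b, c]] b by [rewrite /= in_itv /= lexx]; rewrite /window /= in_itv /= => /andP[].
have Nc := le_trans Nb bc.
have -> : w c - w b = (w c - w (- N%:R)) - (w b - w (- N%:R)) by ring.
rewrite !sobolev_window//.
have sp : `[- N%:R, c[%classic = `[- N%:R, b[%classic `|` `[b, c[%classic :> set R.
  by apply: itv_bndbnd_setU; rewrite bnd_simp.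
rewrite sp Rintegral_setU//.
- rewrite addrAC subrr add0r Rintegral_itv_bndo_bndc//.
  by apply: integrableS (sobolev_integrable b c) => //; exact: itvco_cc.
- rewrite -sp; apply: integrableS (sobolev_integrable (- N%:R) c) => //; exact: itvco_cc.
- apply/disj_setPS => y /= []; rewrite !in_itv /= => /andP[_ a1] /andP[b1 _].
  by move: (le_lt_trans b1 a1); rewrite ltxx.
Qed.

End SobolevAC.

(** * The convex set of periodic 1-Lipschitz curves *)

Lemma cvg_bigsum (R : realType) (T : Type) (F : set_system T) (I : finType)
    (f : I -> T -> R) (l : I -> R) : Filter F ->
  (forall i, f i x @[x --> F] --> l i) -> \sum_i f i x @[x --> F] --> \sum_i l i.
Proof.
by move=> FF h; apply: cvg_big => [|i _]; [exact: add_continuous|exact: h].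
Qed.

Lemma cvg_sqr (R : realType) (T : Type) (F : set_system T) (f : T -> R) (l : R) : Filter F ->
  f x @[x --> F] --> l -> f x ^+ 2 @[x --> F] --> l ^+ 2.
Proof.
move=> FF h; rewrite expr2 (_ : (fun x => f x ^+ 2) = (fun x => f x * f x)).
  exact: cvgM.
by apply/funext => s; rewrite expr2.
Qed.

Section ContinuousCurves.
Variables (R : realType) (d : nat).
Local Notation mu := (@lebesgue_measure R).

(** The ambient vector space consists of all continuous curves on the line. Periodicity belongs to
    the convex set [Lip1], and completeness is established only inside that set. *)
Definition cont_curve : {pred ('I_d -> R -> R^o)} :=
  fun x => `[< forall i, continuous (x i) >].

Lemma cont_curve_submod_closed : submod_closed cont_curve.
Proof.
split=> [|a x y /asboolP cx /asboolP cy]; apply/asboolP => i s.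
  exact: cvg_cst.
rewrite -[X in continuous_at _ X]/(fun s : R => a * x i s + y i s).
by apply: cvgD; [apply: cvgM; [exact: cvg_cst|exact: cx]|exact: cy].
Qed.

HB.instance Definition _ := GRing.isSubmodClosed.Build R ('I_d -> R -> R^o) cont_curve
  cont_curve_submod_closed.

Definition curve := {x | x \in cont_curve}.
HB.instance Definition _ := SubType.on curve.
HB.instance Definition _ := Choice.on curve.
HB.instance Definition _ := [SubChoice_isSubLmodule of curve by <:].

Definition cv (x : curve) (i : 'I_d) (s : R) : R := val x i s.

Lemma curveD (x y : curve) i s : cv (x + y) i s = cv x i s + cv y i s.
Proof. by []. Qed.
Lemma curveZ a (x : curve) i s : cv (a *: x) i s = a * cv x i s.
Proof. by []. Qed.
Lemma curveB (x y : curve) i s : cv (x - y) i s = cv x i s - cv y i s.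
Proof. by []. Qed.
Lemma curve0 i s : cv 0 i s = 0.
Proof. by []. Qed.

Lemma curve_continuous (x : curve) i : continuous (cv x i).
Proof. by move: i; apply/asboolP; exact: (valP x). Qed.

Definition mkcurve (f : 'I_d -> R -> R) (cf : forall i, continuous (f i)) : curve :=
  Sub (f : 'I_d -> R -> R^o) (introT (asboolP _) cf).

Lemma mkcurveE f cf i s : cv (@mkcurve f cf) i s = f i s.
Proof. by rewrite /cv /mkcurve SubK. Qed.

Lemma continuous_itv_integrable (f : R -> R) (a b : R) : continuous f ->
  mu.-integrable `[a, b] (EFin \o f).
Proof.
move=> cf; apply: continuous_compact_integrable; first exact: segment_compact.
exact: continuous_subspaceT.
Qed.

Lemma continuous_sqr (f : R -> R) : continuous f -> continuous (fun s => f s ^+ 2).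
Proof.
by move=> cf s; apply: cvg_sqr; exact: cf.
Qed.

Lemma continuous_bigsum (I : finType) (f : I -> R -> R) :
  (forall i, continuous (f i)) -> continuous (fun s => \sum_i f i s).
Proof.
by move=> cf s; apply: cvg_bigsum => i; exact: cf.
Qed.

Definition cdot (x y : curve) : R :=
  \int[mu]_(s in `[0, 1]) dotp (cv x ^~ s) (cv y ^~ s).

Lemma dotp_continuous (x y : curve) : continuous (fun s => dotp (cv x ^~ s) (cv y ^~ s)).
Proof.
apply: continuous_bigsum => i s; apply: cvgM; exact: curve_continuous.
Qed.

Lemma dotp_integrable (x y : curve) a b :
  mu.-integrable `[a, b] (EFin \o (fun s => dotp (cv x ^~ s) (cv y ^~ s))).
Proof. by apply: continuous_itv_integrable; exact: dotp_continuous. Qed.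

Lemma cdotC x y : cdot x y = cdot y x.
Proof.
by apply: eq_Rintegral => s _; apply: eq_bigr => i _; rewrite mulrC.
Qed.

Lemma cdotDl x y z : cdot (x + y) z = cdot x z + cdot y z.
Proof.
rewrite /cdot -RintegralD//; [|exact: dotp_integrable|exact: dotp_integrable].
apply: eq_Rintegral => s _; rewrite /dotp -big_split /=.
by apply: eq_bigr => i _; rewrite curveD mulrDl.
Qed.

Lemma cdotZl a x z : cdot (a *: x) z = a * cdot x z.
Proof.
rewrite /cdot -RintegralZl//; last exact: dotp_integrable.
apply: eq_Rintegral => s _; rewrite /dotp mulr_sumr.
by apply: eq_bigr => i _; rewrite curveZ mulrA.
Qed.

Lemma dotpp (v : 'I_d -> R) : dotp v v = sqnorm v.
Proof. by apply: eq_bigr => i _; rewrite expr2. Qed.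

Lemma sqnorm_ge0 (v : 'I_d -> R) : 0 <= sqnorm v.
Proof. by apply: sumr_ge0 => i _; exact: sqr_ge0. Qed.

Lemma cdot_ge0 x : 0 <= cdot x x.
Proof. by apply: Rintegral_ge0 => s _; rewrite dotpp sqnorm_ge0. Qed.

Local Notation nrm := (seminorm cdot).

Definition Lip1 : set curve := [set x |
  (forall i, periodic1 (cv x i)) /\
  forall s t, sqnorm (fun i => cv x i s - cv x i t) <= (s - t) ^+ 2].

Lemma Lip1_0 : Lip1 0.
Proof.
split=> [i s|s t]; rewrite ?curve0//.
rewrite /sqnorm big1 ?sqr_ge0// => i _; by rewrite !curve0 subr0 expr0n.
Qed.

Lemma Lip1_conv (l : R) x y : 0 <= l <= 1 -> Lip1 x -> Lip1 y ->
  Lip1 (l *: x + (1 - l) *: y).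
Proof.
move=> /andP[l0 l1] [px Lx] [py Ly]; split.
  by move=> i s; rewrite !curveD !curveZ px py.
move=> s t.
apply: (@le_trans _ _ (l * sqnorm (fun i => cv x i s - cv x i t) +
  (1 - l) * sqnorm (fun i => cv y i s - cv y i t))).
  rewrite /sqnorm !mulr_sumr -big_split /=; apply: ler_sum => i _.
  rewrite !curveD !curveZ.
  move: (cv x i s) (cv x i t) (cv y i s) (cv y i t) => a b c e.
  have := mulr_ge0 (mulr_ge0 l0 (_ : 0 <= 1 - l)) (sqr_ge0 ((a - b) - (c - e))).
  by rewrite subr_ge0 => /(_ l1); lra.
have := ler_wpM2l l0 (Lx s t); have := ler_wpM2l (_ : 0 <= 1 - l) (Ly s t).
by rewrite subr_ge0 => /(_ l1); lra.
Qed.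

Lemma periodic1_int (f : R -> R) (k : int) s : periodic1 f -> f (s + k%:~R) = f s.
Proof.
move=> pf; have pn (n : nat) t : f (t + n%:R) = f t.
  by elim: n => [|n IH]; rewrite ?addr0// -natr1 addrA pf IH.
case: k => n; first exact: pn.
by rewrite NegzE mulrNz -[LHS](pn n.+1) subrK.
Qed.

Lemma periodic1_unit (f : R -> R) s : periodic1 f -> exists2 t, 0 <= t <= 1 & f s = f t.
Proof.
move=> pf; exists (s - (Num.floor s)%:~R).
  by have := floor_itv s; rewrite intrD mulr1z; lra.
by rewrite -(periodic1_int (Num.floor s) (s - _) pf) subrK.
Qed.

(* A Lipschitz function that is large somewhere is large on an interval of proportional length. *)
Lemma lipschitz_sup_le (w : R -> R) (e : R) : continuous w ->
  (forall s t, `|w s - w t| <= 2 * `|s - t|) -> 0 < e <= 1 ->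
  \int[mu]_(s in `[0, 1]) (w s ^+ 2) < e ^+ 3 / 16 ->
  forall s, 0 <= s <= 1 -> `|w s| <= e.
Proof.
move=> cw Lw /andP[e0 e1] hw s s01; rewrite leNgt; apply/negP => es.
(* An interval of length e / 4 beginning or ending at [s], whichever side fits in [0, 1]. The
   Lipschitz constant 2 keeps |w| >= e / 2 on it, which yields (e / 2)^2 (e / 4) = e^3 / 16. *)
have [a [a0 a1 sa]] : exists a, [/\ 0 <= a, a + e / 4 <= 1 & forall t, a <= t <= a + e / 4 -> `|s - t| <= e / 4].
  have [s12|s12] := leP s (1 / 2); [exists s | exists (s - e / 4)].
  - by split; [lra|lra|move=> t ht; rewrite ler_norml; lra].
  - by split; [lra|lra|move=> t ht; rewrite ler_norml; lra].
have cw2 : continuous (fun s => w s ^+ 2).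
  exact: continuous_sqr.
move: hw; rewrite ltNge => /negP; apply.
have -> : e ^+ 3 / 16 = \int[mu]_(s in `[a, a + e / 4]) (e ^+ 2 / 4).
  rewrite Rintegral_cst//= lebesgue_measure_itv /= lte_fin ltrDl.
  have -> : 0 < e / 4 by lra.
  by rewrite -EFinB /= addrAC subrr add0r; lra.
rewrite -lee_fin !EFin_Rintegral//; last 2 first.
- exact: continuous_itv_integrable.
- by apply: continuous_itv_integrable => ?; exact: cvg_cst.
apply: (@le_trans _ _ (\int[mu]_(x in `[a, (a + e / 4)%R]) (w x ^+ 2)%:E)%E).
  apply: ge0_le_integral => //.
  - by move=> x _; rewrite lee_fin divr_ge0// sqr_ge0.
  - apply: measurable_funTS; apply/measurable_EFinP; exact: continuous_measurable_fun.
  - move=> x /=; rewrite in_itv /= => xa; rewrite lee_fin -[w x ^+ 2]real_normK ?num_real//.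
    have h1 := Lw s x; have h2 := sa _ xa.
    have h3 : e / 2 <= `|w x|.
      by have := ler_normD (w s - w x) (w x); rewrite subrK; lra.
    have -> : e ^+ 2 / 4 = (e / 2) ^+ 2 by field.
    by rewrite lerXn2r ?nnegrE//; lra.
apply: ge0_subset_integral => //.
- apply: measurable_funTS; apply/measurable_EFinP; exact: continuous_measurable_fun.
- by move=> x _; rewrite lee_fin sqr_ge0.
- by move=> x /=; rewrite !in_itv /=; lra.
Qed.

Lemma sqnorm_le_comp (v : 'I_d -> R) i : v i ^+ 2 <= sqnorm v.
Proof.
by rewrite /sqnorm (bigD1 i)//= lerDl sumr_ge0// => j _; exact: sqr_ge0.
Qed.

Lemma Lip1_comp x i s t : Lip1 x -> `|cv x i s - cv x i t| <= `|s - t|.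
Proof.
move=> [_ L]; rewrite -ler_sqr ?nnegrE// !real_normK ?num_real//.
by apply: le_trans (L s t); exact: (sqnorm_le_comp (fun i => cv x i s - cv x i t)).
Qed.

(** A difference of two curves of [Lip1] has Lipschitz components of constant 2, so its L^2 seminorm
    controls its sup norm. This makes [Lip1] complete for the seminorm and turns L^2 continuity of a
    path into pointwise continuity. *)
Lemma Lip1_sup x y (e : R) : Lip1 x -> Lip1 y -> 0 < e <= 1 ->
  nrm (x - y) ^+ 2 < e ^+ 3 / 16 -> forall i s, `|cv x i s - cv y i s| <= e.
Proof.
move=> Kx Ky e01 h i s.
have cw : continuous (fun s => cv x i s - cv y i s).
  by move=> t; apply: cvgB; exact: curve_continuous.
have pw : periodic1 (fun s => cv x i s - cv y i s).
  by move=> t; rewrite Kx.1 Ky.1.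
have [t t01 ->] := periodic1_unit s pw.
apply: (lipschitz_sup_le cw) => //.
  move=> a b; have := Lip1_comp i a b Kx; have := Lip1_comp i a b Ky.
  have -> : cv x i a - cv y i a - (cv x i b - cv y i b) =
    (cv x i a - cv x i b) - (cv y i a - cv y i b) by ring.
  by have := ler_normB (cv x i a - cv x i b) (cv y i a - cv y i b); lra.
apply: le_lt_trans h; rewrite /seminorm sqr_sqrtr ?cdot_ge0// /cdot.
apply: le_Rintegral => //.
- by apply: continuous_itv_integrable; exact: continuous_sqr.
- exact: dotp_integrable.
- by move=> u _; rewrite dotpp; exact: (sqnorm_le_comp (fun i => cv x i u - cv y i u)).
Qed.

Lemma nrm_le_sup x y (e : R) : 0 <= e ->
  (forall i s, `|cv x i s - cv y i s| <= e) -> nrm (x - y) ^+ 2 <= d%:R * e ^+ 2.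
Proof.
move=> e0 h; rewrite /seminorm sqr_sqrtr ?cdot_ge0// /cdot.
have -> : d%:R * e ^+ 2 = \int[mu]_(s in `[0, 1]) (d%:R * e ^+ 2).
  by rewrite Rintegral_cst//= lebesgue_measure_itv /= lte_fin ltr01 -EFinB /=; lra.
apply: le_Rintegral => //.
- exact: dotp_integrable.
- by apply: continuous_itv_integrable => ?; exact: cvg_cst.
move=> s _; rewrite /dotp -[d in leRHS]card_ord -sumr_const mulr_suml.
apply: ler_sum => i _; rewrite mul1r curveB -expr2 -[_ ^+ 2]real_normK ?num_real//.
by rewrite lerXn2r ?nnegrE.
Qed.

Lemma Lip1_complete (u : nat -> curve) : (forall n, Lip1 (u n)) ->
  (forall e : R, 0 < e -> exists N, forall m n, (N <= m)%N -> (N <= n)%N ->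
     nrm (u m - u n) < e) ->
  exists2 x, Lip1 x & nrm (u n - x) @[n --> \oo] --> 0.
Proof.
move=> Ku cu.
have sup e : 0 < e <= 1 -> exists N, forall m n, (N <= m)%N -> (N <= n)%N ->
    forall i s, `|cv (u m) i s - cv (u n) i s| <= e.
  move=> e01; have e3 : 0 < e ^+ 3 / 16 by rewrite divr_gt0// exprn_gt0//; lra.
  have [|N HN] := cu (Num.sqrt (e ^+ 3 / 16)); first by rewrite sqrtr_gt0.
  exists N => m n Nm Nn i s; apply: Lip1_sup => //.
  rewrite -[ltRHS]sqr_sqrtr ?ltW// ltr_sqr ?nnegrE ?sqrtr_ge0//; exact: HN.
pose l i s := limn (fun n => cv (u n) i s).
have cl i s : cv (u n) i s @[n --> \oo] --> l i s.
  suff : cvgn (fun n => cv (u n) i s) by [].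
  apply/cauchy_cvgP/cauchy_exP => e e0.
  pose e' := Num.min (e / 2) 1.
  have [|N HN] := sup e'.
    by rewrite /e' lt_min ge_min lexx orbT andbT ltr01 andbT; lra.
  exists (cv (u N) i s); exists N => // m /= Nm; rewrite /ball /=.
  apply: le_lt_trans (HN _ _ (leqnn N) Nm i s) _.
  by rewrite /e' gt_min; apply/orP; left; lra.
have lsup e : 0 < e <= 1 -> exists N, forall n, (N <= n)%N ->
    forall i s, `|cv (u n) i s - l i s| <= e.
  move=> e01; have [N HN] := sup e e01; exists N => n Nn i s.
  rewrite distrC; apply: (@cvgr_to_le _ \oo _ R (fun m => `|cv (u m) i s - cv (u n) i s|)).
    by apply: cvg_norm; apply: cvgB; [exact: cl|exact: cvg_cst].
  by exists N => // m /= Nm; exact: HN.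
have Ll s t : sqnorm (fun i => l i s - l i t) <= (s - t) ^+ 2.
  apply: (@cvgr_to_le _ \oo _ R (fun n => sqnorm (fun i => cv (u n) i s - cv (u n) i t))).
    by apply: cvg_bigsum => i; apply: cvg_sqr; apply: cvgB; exact: cl.
  by apply: nearW => n; case: (Ku n).
have cl' i : continuous (l i).
  move=> s; apply/cvgrPdist_le => /= e e0; near=> t.
  have : `|l i s - l i t| <= `|s - t|.
    rewrite -ler_sqr ?nnegrE// !real_normK ?num_real//.
    by apply: le_trans (Ll s t); exact: (sqnorm_le_comp (fun i => l i s - l i t)).
  move/le_trans; apply; near: t.
  by have : (fun t : R => t) @ s --> s by []; move/cvgrPdist_le => /(_ e e0).
exists (mkcurve cl').
  split=> [i s|s t].
    rewrite !mkcurveE /l; congr (limn _); apply/funext => n; exact: (Ku n).1.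
  by under [sqnorm _]eq_bigr do rewrite !mkcurveE; exact: Ll.
apply/cvgrPdist_le => e e0.
pose e' := Num.min (e / (d%:R + 1)) 1.
have d1 : 0 < d%:R + 1 :> R by rewrite ltr_wpDl.
have e'0 : 0 < e' by rewrite /e' lt_min ltr01 andbT divr_gt0.
have e'e : e' * (d%:R + 1) <= e.
  by rewrite -ler_pdivlMr// /e' ge_min lexx.
have [|N HN] := lsup e'; first by rewrite e'0 /e' ge_min lexx orbT.
exists N => // n /= Nn; rewrite sub0r normrN ger0_norm ?sqrtr_ge0//.
rewrite -ler_sqr ?nnegrE ?sqrtr_ge0// ?(ltW e0)//.
apply: (@le_trans _ _ (d%:R * e' ^+ 2)).
  by apply: nrm_le_sup => [|i s]; rewrite ?(ltW e'0)// mkcurveE; exact: HN.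
apply: (@le_trans _ _ ((e' * (d%:R + 1)) ^+ 2)); last first.
  by rewrite lerXn2r ?nnegrE ?mulr_ge0// ltW.
rewrite exprMn mulrC ler_wpM2l ?sqr_ge0//.
have := ler0n R d; nra.
Unshelve. all: by end_near.
Qed.

End ContinuousCurves.

(** * Absolutely continuous functions *)

Section LocalAC.
Variable R : realType.
Local Notation mu := (@lebesgue_measure R).
Local Notation h := (@dyadic_step R).

Lemma lebesgue_measure_shift (c : R) (A : set R) : measurable A ->
  mu A = mu ((fun x => x + c) @^-1` A).
Proof.
move=> mA.
have mphi : measurable_fun setT (fun x : measurableTypeR R => x + c : measurableTypeR R).
  by apply: measurable_funD.
rewrite (@lebesgue_measure_unique R
  (measure_function_pushforward__canonical__measure_function_Measure mu mphi))// => X [[a b] _ <-].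
rewrite -[RHS]/(mu ((fun x => x + c) @^-1` `]a, b]%classic)).
have -> : (fun x => x + c) @^-1` `]a, b]%classic = `]a - c, b - c]%classic :> set R.
  by apply/seteqP; split => x /=; rewrite !in_itv /= => /andP[? ?]; apply/andP; split; lra.
rewrite !lebesgue_measure_itv /= !lte_fin ltrD2r; case: ifP => // _.
by congr EFin; ring.
Qed.

Lemma ge0_integral_shift (c : R) (D : set R) (f : R -> \bar R) : measurable D ->
  measurable_fun D f -> (forall x, D x -> (0 <= f x)%E) ->
  (\int[mu]_(x in D) f x = \int[mu]_(x in (fun x => x + c)%R @^-1` D) f (x + c)%R)%E.
Proof.
move=> mD mf f0.
have mphi : measurable_fun setT (fun x : measurableTypeR R => x + c : measurableTypeR R).
  by apply: measurable_funD.
rewrite -[RHS](ge0_integral_pushforward mphi mu mD mf); last first.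
  by move=> x /set_mem; exact: f0.
apply: (@eq_measure_integral _ _ _ _
  (measure_function_pushforward__canonical__measure_function_Measure mu mphi)) => A mA _.
exact: lebesgue_measure_shift.
Qed.

Lemma integral_itv_shift (c a b : R) (f : R -> \bar R) : measurable_fun setT f ->
  (\int[mu]_(x in `[(a + c)%R, (b + c)%R]) f x = \int[mu]_(x in `[a, b]) f (x + c)%R)%E.
Proof.
move=> mf; rewrite [LHS]integralE [RHS]integralE.
have pre : (fun x => x + c) @^-1` `[a + c, b + c]%classic = `[a, b]%classic :> set R.
  by apply/seteqP; split => x /=; rewrite !in_itv /= !lerD2r.
have mp : measurable_fun setT f^\+%E by exact: measurable_funepos.
have mn : measurable_fun setT f^\-%E by exact: measurable_funeneg.
have e1 := @ge0_integral_shift c `[a + c, b + c]%classic _ (measurable_itv _)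
  (measurable_funTS mp) (fun x _ => funepos_ge0 f x).
have e2 := @ge0_integral_shift c `[a + c, b + c]%classic _ (measurable_itv _)
  (measurable_funTS mn) (fun x _ => funeneg_ge0 f x).
congr (_ - _)%E; [apply: (etrans e1)|apply: (etrans e2)].
  by rewrite [X in integral _ X _ = _]pre; apply: eq_integral => x _; rewrite !funepos.unlock.
by rewrite [X in integral _ X _ = _]pre; apply: eq_integral => x _; rewrite !funeneg.unlock.
Qed.

Lemma Rintegral_itv_cat (a b c : R) (f : R -> R) : a <= b <= c ->
  mu.-integrable `[a, c] (EFin \o f) ->
  \int[mu]_(x in `[a, c]) f x = \int[mu]_(x in `[a, b]) f x + \int[mu]_(x in `[b, c]) f x.
Proof.
move=> /andP[ab bc] fi.
have sp : `[a, c]%classic = `[a, b[%classic `|` `[b, c]%classic :> set R.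
  by apply: itv_bndbnd_setU; rewrite bnd_simp.
rewrite sp Rintegral_setU//.
- congr (_ + _); apply: Rintegral_itv_bndo_bndc.
  by apply: integrableS fi => // x /=; rewrite !in_itv /= => /andP[-> ?]; lra.
- by rewrite -sp.
- apply/disj_setPS => y /= []; rewrite !in_itv /= => /andP[_ a1] /andP[b1 _].
  by move: (le_lt_trans b1 a1); rewrite ltxx.
Qed.

(** For each sign of [s] one of the two integrals vanishes: this is the oriented integral from 0 to
    [s]. *)
Definition primitive (f : R -> R) (s : R) : R :=
  \int[mu]_(x in `[0, s]) f x - \int[mu]_(x in `[s, 0]) f x.

Definition locally_int (f : R -> R) := forall a b, mu.-integrable `[a, b] (EFin \o f).

Lemma Rintegral_itv_empty (a b : R) f : b <= a -> \int[mu]_(x in `[a, b]) f x = 0.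
Proof.
rewrite le_eqVlt => /orP[/eqP ->|ba].
  by rewrite set_itv1 Rintegral_set1.
by rewrite set_itv_ge ?Rintegral_set0// bnd_simp -ltNge.
Qed.

Lemma primitive_AC f : locally_int f -> AC_loc (primitive f) f.
Proof.
move=> fi b c bc; split; first exact: fi.
rewrite /primitive.
have [b0|b0] := leP 0 b.
  have c0 := le_trans b0 bc.
  rewrite (Rintegral_itv_empty _ b0) (Rintegral_itv_empty _ c0) !subr0.
  by rewrite (@Rintegral_itv_cat 0 b c) ?b0//; ring.
have [c0|c0] := leP 0 c.
  rewrite (Rintegral_itv_empty _ (ltW b0)) (Rintegral_itv_empty _ c0).
  rewrite (@Rintegral_itv_cat b 0 c) ?c0 ?(ltW b0)//; ring.
rewrite (Rintegral_itv_empty _ (ltW b0)) (Rintegral_itv_empty _ (ltW c0)).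
by rewrite (@Rintegral_itv_cat b c 0) ?(ltW c0) ?bc//; ring.
Qed.

Lemma primitive0 f : primitive f 0 = 0.
Proof. by rewrite /primitive subrr. Qed.

Lemma AC_continuous (F f : R -> R) : AC_loc F f -> continuous F.
Proof.
move=> HF s.
have ab : s - 1 <= s + 1 by lra.
have [fi _] := HF _ _ ab.
have FE : {in `[s - 1, s + 1], F =1 fun x => F (s - 1) + parameterized_integral mu (s - 1) x f}.
  move=> x; rewrite in_itv /= => /andP[sx _].
  by have [_ e] := HF _ _ sx; rewrite /parameterized_integral -e addrC subrK.
have := parameterized_integral_continuous ab fi.
rewrite continuous_within_itvP; last by lra.
move=> [ci _ _].
have sin : s \in `]s - 1, s + 1[ by rewrite in_itv /=; apply/andP; split; lra.
have c1 := ci _ sin.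
have c2 : (fun x => F (s - 1) + parameterized_integral mu (s - 1) x f) x @[x --> s] --> F s.
  rewrite [X in _ --> X]FE; last by rewrite in_itv /=; apply/andP; split; lra.
  by apply: cvgD; [exact: cvg_cst|exact: c1].
apply: cvg_trans c2; apply: near_eq_cvg.
near=> x; apply/esym/FE; rewrite in_itv /=.
have : x \in `]s - 1, s + 1[ by near: x; exact: near_in_itvoo.
by rewrite in_itv /= => /andP[/ltW -> /ltW ->].
Unshelve. all: by end_near.
Qed.

Lemma Rintegral_periodic f s : measurable_fun setT f -> locally_int f -> periodic1 f ->
  \int[mu]_(x in `[s, s + 1]) f x = \int[mu]_(x in `[0, 1]) f x.
Proof.
move=> mf fi pf.
have sh a b : \int[mu]_(x in `[a + 1, b + 1]) f x = \int[mu]_(x in `[a, b]) f x.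
  rewrite /Rintegral integral_itv_shift; last exact/measurable_EFinP.
  by congr fine; apply: eq_integral => x _; rewrite pf.
have P := primitive_AC fi.
have e a b : a <= b -> primitive f b - primitive f a = \int[mu]_(x in `[a, b]) f x.
  by move=> ab; have [] := P _ _ ab.
have s1 : s <= s + 1 by lra.
have p01 : (0 : R) <= 1 by lra.
rewrite -e// -e//.
have [s0|s0] := leP 0 s.
  have := sh 0 s; rewrite add0r -!e//; [lra|lra].
have := sh s 0; rewrite add0r -!e//; [lra|exact: ltW|lra].
Qed.

Lemma AC_locally_int (F f : R -> R) : AC_loc F f -> locally_int f.
Proof.
move=> HF a b; have [ab|ba] := leP a b; first by have [] := HF _ _ ab.
by rewrite set_itv_ge ?integrable_set0// bnd_simp -ltNge.
Qed.

Lemma continuous_bounded_itv (u : R -> R) (a b : R) : continuous u ->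
  exists2 M, 0 <= M & forall x, a <= x <= b -> `|u x| <= M.
Proof.
move=> cu.
have [M [_ HM]] : bounded_set (u @` `[a, b]).
  apply: compact_bounded; apply: continuous_compact; last exact: segment_compact.
  exact: continuous_subspaceT.
exists (`|M| + 1); first by rewrite addr_ge0.
move=> x xab; apply: (HM (`|M| + 1)); last by exists x => //=; rewrite in_itv.
by rewrite ltr_pwDr// ler_norm.
Qed.

(** [p] stands for the identity or for an end of the dyadic cell of the point, which is at distance
    at most 1. *)
Lemma locally_int_mul (f w p : R -> R) : measurable_fun setT f -> locally_int f ->
  continuous w -> measurable_fun setT p -> (forall x, `|p x - x| <= 1) ->
  locally_int (fun x => w (p x) * f x).
Proof.
move=> mf fi cw mp p1 a b.
have [M M0 HM] := continuous_bounded_itv (a - 1) (b + 1) cw.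
apply: (@le_integrable _ _ _ mu _ _ _ (EFin \o (fun x => M * f x))) => //.
- apply: measurable_funTS; apply/measurable_EFinP; apply: measurable_funM => //.
  exact: (measurableT_comp (continuous_measurable_fun cw) mp).
- move=> x /=; rewrite in_itv /= => xab; rewrite lee_fin !normrM ler_wpM2r//.
  by rewrite [leRHS]ger0_norm// HM//; have := p1 x; rewrite ler_norml; lra.
- by apply: eq_integrable (integrableZl _ M (fi a b)).
Qed.

Lemma locally_intD f g : locally_int f -> locally_int g -> locally_int (fun x => f x + g x).
Proof. by move=> fi gi a b; apply: eq_integrable (integrableD _ (fi a b) (gi a b)). Qed.

Lemma locally_intZ c f : locally_int f -> locally_int (fun x => c * f x).
Proof. by move=> fi a b; apply: eq_integrable (integrableZl _ c (fi a b)). Qed.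

Lemma locally_int_co f (a b : R) : locally_int f -> mu.-integrable `[a, b[ (EFin \o f).
Proof. by move=> fi; apply: integrableS (fi a b) => //; exact: itvco_cc. Qed.

(** Taking [F] at the right end and [w] at the left end of each cell makes the product rule exact:
    F(b) (w(b) - w(a)) + w(a) (F(b) - F(a)) = F(b) w(b) - F(a) w(a). *)
Lemma ibp_cell (F f w g : R -> R) n (k : int) (j : nat) : AC_loc F f -> AC_loc w g ->
  let G x := F (cell_left n x + h n) * g x + w (cell_left n x) * f x in
  locally_int G ->
  \int[mu]_(x in cells n k j) G x =
  F ((k + j%:Z)%:~R * h n) * w ((k + j%:Z)%:~R * h n) - F (k%:~R * h n) * w (k%:~R * h n).
Proof.
move=> HF Hw G Gi; elim: j => [|j IH].
  by rewrite /cells addr0 set_itvco0 ?lexx// Rintegral_set0 subrr.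
rewrite cell_recr Rintegral_setU//; last 3 first.
- exact: measurable_cell.
- by rewrite -cell_recr; exact: locally_int_co.
- exact: cell_recr_disj.
  rewrite IH cell_endS.
  set a := (k + j%:Z)%:~R * h n.
  have ab : a <= a + h n by rewrite lerDl dyadic_step_ge0.
  have i1 := locally_intZ (F (a + h n)) (AC_locally_int Hw).
  have i2 := locally_intZ (w a) (AC_locally_int HF).
  have -> : \int[mu]_(x in cell n (k + j%:Z)) G x =
    \int[mu]_(x in `[a, a + h n]) (F (a + h n) * g x + w a * f x).
    transitivity (\int[mu]_(x in `[a, a + h n[) (F (a + h n) * g x + w a * f x)).
      by apply: eq_Rintegral => x /set_mem xc; rewrite /G (cell_leftE xc).
    by apply: Rintegral_itv_bndo_bndc; apply: locally_int_co; exact: locally_intD.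
  rewrite (RintegralD _ (i1 _ _) (i2 _ _))// (RintegralZl _ _ (Hw _ _ ab).1)//.
  rewrite (RintegralZl _ _ (HF _ _ ab).1)//.
  by rewrite -(Hw _ _ ab).2 -(HF _ _ ab).2; ring.
exact: measurable_itv.
Qed.

(** The exact summation by parts on cells of level [n] has the same boundary terms for every [n];
    dominated convergence and the continuity of [F] and [w] give the limit. *)
Lemma ibp_01 (F f w g : R -> R) : AC_loc F f -> AC_loc w g ->
  measurable_fun setT f -> measurable_fun setT g ->
  \int[mu]_(x in `[0, 1]) (F x * g x + w x * f x) = F 1 * w 1 - F 0 * w 0.
Proof.
move=> HF Hw mf mg.
have cF := AC_continuous HF; have cw := AC_continuous Hw.
have fi := AC_locally_int HF; have gi := AC_locally_int Hw.
(* The interval is widened by 1 on each side because cell endpoints may leave [0, 1]. *)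
have [M1 M10 HM1] := continuous_bounded_itv (-1) 2 cF.
have [M2 M20 HM2] := continuous_bounded_itv (-1) 2 cw.
have h1 n : 0 < h n <= 1.
  rewrite dyadic_step_gt0 /dyadic_step exprn_ile1//; lra.
pose G n x := F (cell_left n x + h n) * g x + w (cell_left n x) * f x.
have Gi n : locally_int (G n).
  have /andP[hn0 hn1] := h1 n.
  apply: locally_intD; apply: locally_int_mul => //.
  - by apply: measurable_funD => //; exact: measurable_cell_left.
  - by move=> x; have := cell_left_itv n x; rewrite ler_norml; lra.
  - exact: measurable_cell_left.
  - by move=> x; have := cell_left_itv n x; rewrite ler_norml; lra.
pose D x := M1 * `|g x| + M2 * `|f x|.
have Di : mu.-integrable `[0, 1] (EFin \o D).
  have i1 := integrable_norm (gi 0 1); have i2 := integrable_norm (fi 0 1).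
  by apply: eq_integrable (integrableD _ (integrableZl _ M1 i1) (integrableZl _ M2 i2)).
have GD n x : 0 <= x <= 1 -> `|G n x| <= D x.
  move=> x01; have /andP[l1 l2] := cell_left_itv n x; have /andP[hn0 hn1] := h1 n.
  apply: (le_trans (ler_normD _ _)); rewrite !normrM /D.
  by apply: lerD; apply: ler_wpM2r => //; [apply: HM1|apply: HM2]; lra.
have GE n : \int[mu]_(x in `[0, 1]) G n x = F 1 * w 1 - F 0 * w 0.
  rewrite -Rintegral_itv_bndo_bndc; last exact: locally_int_co.
  have e : (2 ^ n)%:R * h n = 1 :> R by rewrite natrX mulrC dyadic_stepV.
  have -> : `[0, 1[%classic = cells n 0 (2 ^ n) :> set R.
    by rewrite /cells add0r mul0r -[_%:~R]/((2 ^ n)%:R) e.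
  rewrite (@ibp_cell F f w g n 0 (2 ^ n)%N HF Hw (Gi n)).
  by rewrite add0r mul0r -[(2 ^ n)%:Z%:~R]/((2 ^ n)%:R) e.
have mG : measurable_fun setT (fun x => F x * g x + w x * f x).
  by apply: measurable_funD; apply: measurable_funM => //; exact: continuous_measurable_fun.
have cG : {ae mu, forall x, [set` `[0, 1]] x ->
    (EFin \o G n) x @[n --> \oo] --> (F x * g x + w x * f x)%:E}.
  apply: aeW => x _; apply/cvg_EFin; first exact: nearW.
  apply: cvgD; apply: cvgM; try exact: cvg_cst.
    by apply: continuous_cvg; [exact: cF|exact: cvg_cell_right].
  by apply: continuous_cvg; [exact: cw|exact: cvg_cell_left].
have dG : {ae mu, forall x, forall n, [set` `[0, 1]] x -> (`|(EFin \o G n) x| <= (D x)%:E)%E}.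
  by apply: aeW => x n /=; rewrite in_itv /= => x01; rewrite lee_fin GD.
have mGn n : measurable_fun (`[0, 1]%classic : set (measurableTypeR R)) (EFin \o G n) by apply: measurable_int (Gi n 0 1).
have mG' : measurable_fun (`[0, 1]%classic : set (measurableTypeR R)) (EFin \o (fun x => F x * g x + w x * f x)).
  by apply: measurable_funTS; apply/measurable_EFinP.
have [Li _ Lc] := @dominated_convergence _ _ _ mu `[0, 1]%classic (measurable_itv _)
  (fun n => EFin \o G n) (EFin \o (fun x => F x * g x + w x * f x)) (EFin \o D)
  mGn mG' cG Di dG.
apply: EFin_inj; rewrite EFin_Rintegral//.
apply: (cvg_unique _ Lc) => //.
rewrite (_ : (fun n => _) = fun=> (F 1 * w 1 - F 0 * w 0)%:E); first exact: cvg_cst.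
by apply/funext => n; rewrite -(GE n) EFin_Rintegral//; exact: Gi.
Qed.

End LocalAC.

(** * The normal cone at a fixed time *)

Section EuclideanNorm.
Variables (R : realType) (d : nat).
Implicit Types v w : 'I_d -> R.

Definition vnorm v : R := Num.sqrt (sqnorm v).

Lemma vnorm_ge0 v : 0 <= vnorm v. Proof. exact: sqrtr_ge0. Qed.
Lemma vnorm_sqr v : vnorm v ^+ 2 = sqnorm v.
Proof. by rewrite sqr_sqrtr ?sqnorm_ge0. Qed.

Local Notation V := ('I_d -> R^o).

Lemma dotp_le v w : dotp v w <= vnorm v * vnorm w.
Proof.
have C (x y : V) : dotp x y = dotp y x.
  by apply: eq_bigr => i _; rewrite mulrC.
have D (x y z : V) : dotp (x + y) z = dotp x z + dotp y z.
  by rewrite /dotp -big_split; apply: eq_bigr => i _; exact: mulrDl.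
have Z a (x z : V) : dotp (a *: x) z = a * dotp x z.
  by rewrite /dotp mulr_sumr; apply: eq_bigr => i _; rewrite mulrA.
have P (x : V) : 0 <= dotp x x by rewrite dotpp sqnorm_ge0.
have := @ip_le R V (@dotp R d) C D Z P v w.
by rewrite /seminorm !dotpp.
Qed.

(* The norm of [(e, v)] in [R^(1+d)], a smooth perturbation of [vnorm]. *)
Definition rnorm (e : R) v : R := Num.sqrt (e ^+ 2 + sqnorm v).

Lemma rnorm_ge0 e v : 0 <= rnorm e v. Proof. exact: sqrtr_ge0. Qed.
Lemma rnorm_sqr e v : rnorm e v ^+ 2 = e ^+ 2 + sqnorm v.
Proof. by rewrite sqr_sqrtr// addr_ge0 ?sqr_ge0 ?sqnorm_ge0. Qed.
Lemma rnorm0 v : rnorm 0 v = vnorm v.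
Proof. by rewrite /rnorm expr0n add0r. Qed.

Lemma rnormD e v w : rnorm e (fun i => v i + w i) <= rnorm e v + vnorm w.
Proof.
rewrite -ler_sqr ?nnegrE ?addr_ge0 ?rnorm_ge0 ?vnorm_ge0//.
have -> : rnorm e (fun i => v i + w i) ^+ 2 = rnorm e v ^+ 2 + 2 * dotp v w + sqnorm w.
  rewrite !rnorm_sqr /sqnorm /dotp -!addrA; congr (_ + _).
  rewrite mulr_sumr -!big_split /=; apply: eq_bigr => i _; ring.
have h1 := dotp_le v w.
have h2 : vnorm v <= rnorm e v.
  by rewrite ler_sqrt ?addr_ge0 ?sqr_ge0 ?sqnorm_ge0// lerDr sqr_ge0.
have h3 := ler_wpM2r (vnorm_ge0 w) h2.
by rewrite sqrrD -(vnorm_sqr w); lra.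
Qed.

Lemma le_rnorm e e' v : 0 <= e <= e' -> rnorm e v <= rnorm e' v.
Proof.
move=> /andP[e0 ee]; rewrite ler_sqrt ?addr_ge0 ?sqr_ge0 ?sqnorm_ge0// lerD2r.
by rewrite ler_sqr ?nnegrE// (le_trans e0).
Qed.

Lemma rnorm_ge e v : 0 <= e -> e <= rnorm e v.
Proof.
move=> e0; rewrite -ler_sqr ?nnegrE ?rnorm_ge0// rnorm_sqr.
by rewrite lerDl sqnorm_ge0.
Qed.

Lemma vnormN v : vnorm (fun i => - v i) = vnorm v.
Proof. by congr Num.sqrt; apply: eq_bigr => i _; rewrite sqrrN. Qed.

Lemma coord_le_vnorm v i : `|v i| <= vnorm v.
Proof.
rewrite -ler_sqr ?nnegrE ?vnorm_ge0// vnorm_sqr real_normK ?num_real//.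
exact: sqnorm_le_comp.
Qed.

Lemma vnorm_le_sum v : vnorm v <= \sum_i `|v i|.
Proof.
rewrite -ler_sqr ?nnegrE ?vnorm_ge0 ?sumr_ge0// vnorm_sqr expr2 mulr_suml /sqnorm.
apply: ler_sum => i _; rewrite -real_normK ?num_real// expr2 ler_wpM2l//.
by rewrite (bigD1 i)//= lerDl sumr_ge0.
Qed.

Lemma normrV_le (q : 'rV[R]_d) (B : R) : 0 <= B -> (forall i, `|q 0 i| <= B) -> `|q| <= B.
Proof.
move=> B0 h; rewrite [`|q|]mx_normrE; apply: bigmax_le => // -[j i] _ /=.
by rewrite ord1.
Qed.

Lemma coord_le_norm (q : 'rV[R]_d) i : `|q 0 i| <= `|q|.
Proof.
rewrite [`|q|]mx_normrE.
exact: (le_bigmax 0 (fun ij : 'I_1 * 'I_d => `|q ij.1 ij.2|) (0, i)).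
Qed.

Lemma coercive_min (P : 'rV[R]_d -> R) (A : set 'rV[R]_d) (M : R) a :
  continuous P -> (forall q, `|q| <= P q + M) -> closed A -> A a ->
  exists2 c, A c & forall q, A q -> P c <= P q.
Proof.
move=> cP co clA Aa.
pose B := P a + M; pose A' := A `&` [set q | `|q| <= B].
have cA' : compact A'.
  apply: bounded_closed_compact.
    exists B; split; first by rewrite num_real.
    by move=> B' BB' q [_ /= qB]; apply: le_trans (ltW BB').
  apply: closedI => //; rewrite (_ : [set q | _] = (fun q : 'rV[R]_d => `|q|) @^-1` [set r : R | r <= B])//.
  by apply: closed_comp (@closed_le _ B) => q _; exact: norm_continuous.
have A'a : A' a by split => //=; exact: co.
have [c /set_mem[Ac _] hc] := compact_EVT_min (ex_intro _ a A'a) cA' (continuous_subspaceT cP).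
exists c => // q Aq; have [qB|qB] := leP `|q| B; first exact: hc (mem_set _).
apply: le_trans (hc a (mem_set A'a)) _.
by have := co q; move: qB; rewrite /B; lra.
Qed.

End EuclideanNorm.

(** * Geometric median of a continuous curve and its smoothing *)

Section Median.
Variables (R : realType) (d : nat).
Local Notation mu := (@lebesgue_measure R).
Variable F : 'I_d -> R -> R.
Hypothesis cF : forall i, continuous (F i).

Definition shifted (q : 'rV[R]_d) (s : R) : 'I_d -> R := fun i => F i s - q 0 i.

Lemma shifted_continuous e q : continuous (fun s => rnorm e (shifted q s)).
Proof.
move=> s; apply: continuous_cvg; first exact: sqrt_continuous.
apply: cvgD; first exact: cvg_cst.
by apply: cvg_bigsum => i; apply: cvg_sqr; apply: cvgB; [exact: cF|exact: cvg_cst].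
Qed.

(** For [e = 0] the minimizers are the geometric medians of [F] over one period. For [e > 0] the
    integrand is smooth in [q], which gives an Euler-Lagrange equation even where [F] meets [q]. *)
Definition mdist (e : R) (q : 'rV[R]_d) : R :=
  \int[mu]_(s in `[0, 1]) rnorm e (shifted q s).

Lemma mdist_integrable e q : mu.-integrable `[0, 1] (EFin \o (fun s => rnorm e (shifted q s))).
Proof. by apply: continuous_itv_integrable; exact: shifted_continuous. Qed.

Lemma Rintegral01_cst (r : R) : \int[mu]_(s in `[0, 1]) r = r.
Proof.
by rewrite Rintegral_cst//= lebesgue_measure_itv /= lte_fin ltr01 -EFinB /=; lra.
Qed.

Lemma integrable01_cst (r : R) : mu.-integrable `[0, 1] (EFin \o cst r).
Proof. by apply: continuous_itv_integrable => ?; exact: cvg_cst. Qed.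

Lemma mdist_lipschitz e q q' : mdist e q <= mdist e q' + \sum_i `|q 0 i - q' 0 i|.
Proof.
rewrite -(Rintegral01_cst (\sum_i _)) /mdist -RintegralD//; last 2 first.
- exact: mdist_integrable.
- exact: integrable01_cst.
apply: le_Rintegral => //.
- exact: mdist_integrable.
- by apply: eq_integrable (integrableD _ (mdist_integrable e q') (integrable01_cst (\sum_i `|q 0 i - q' 0 i|))).
move=> s _; have -> : shifted q s = fun i => shifted q' s i + (q' 0 i - q 0 i).
  by apply/funext => i; rewrite /shifted; ring.
apply: (le_trans (rnormD _ _ _)); rewrite lerD2l; apply: (le_trans (vnorm_le_sum _)).
by apply: ler_sum => i _; rewrite distrC.
Qed.

Lemma mdist_continuous e : continuous (mdist e).
Proof.
move=> q; apply/(cvgrPdist_le (FF := nbhs_filter q)) => r r0.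
have : (fun q' : 'rV[R]_d => \sum_i `|q 0 i - q' 0 i|) @ q --> \sum_(i < d) (0 : R).
  apply: (@cvg_bigsum R _ (nbhs q) _ _ _ (nbhs_filter q)) => i.
  apply/(cvgrPdist_le (FF := nbhs_filter q)) => t t0.
  have := @coord_continuous R 1 d 0 i q => /(cvgrPdist_le (FF := nbhs_filter q)) /(_ t t0).
  apply: (@filterS _ _ (nbhs_filter q)) => q'.
  by rewrite sub0r normrN normr_id.
rewrite big1// => /(cvgrPdist_le (FF := nbhs_filter q)) /(_ r r0).
apply: (@filterS _ _ (nbhs_filter q)) => q'.
rewrite sub0r normrN ger0_norm ?sumr_ge0// => hq.
rewrite ler_distl; have := mdist_lipschitz e q q'; have := mdist_lipschitz e q' q.
have -> : \sum_i `|q' 0 i - q 0 i| = \sum_i `|q 0 i - q' 0 i|.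
  by apply: eq_bigr => i _; rewrite distrC.
by lra.
Qed.

Lemma mdist_coercive e q : `|q| <= mdist e q + \int[mu]_(s in `[0, 1]) vnorm (F ^~ s).
Proof.
have cv : continuous (fun s => vnorm (F ^~ s)).
  move=> s; apply: continuous_cvg; first exact: sqrt_continuous.
  by apply: cvg_bigsum => i; apply: cvg_sqr; exact: cF.
have iv : mu.-integrable `[0, 1] (EFin \o (fun s => vnorm (F ^~ s))).
  exact: continuous_itv_integrable.
rewrite -{1}(Rintegral01_cst `|q|) /mdist -RintegralD//; last exact: mdist_integrable.
apply: le_Rintegral => //.
- exact: integrable01_cst.
- by apply: eq_integrable (integrableD _ (mdist_integrable e q) iv).
move=> s _; apply: normrV_le; first by rewrite addr_ge0 ?rnorm_ge0 ?vnorm_ge0.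
move=> i; have -> : q 0 i = F i s - shifted q s i by rewrite /shifted; ring.
apply: (le_trans (ler_normB _ _)); rewrite addrC lerD//.
  apply: (le_trans (coord_le_vnorm (shifted q s) i)).
  by rewrite ler_sqrt ?addr_ge0 ?sqr_ge0 ?sqnorm_ge0// lerDr sqr_ge0.
exact: (coord_le_vnorm (F ^~ s)).
Qed.

Lemma mdist_min e : exists c, forall q, mdist e c <= mdist e q.
Proof.
have [c _ hc] := @coercive_min R d (mdist e) setT _ 0 (@mdist_continuous e)
  (mdist_coercive e) closedT I.
by exists c => q; exact: hc.
Qed.

Definition unit_dir e (c : 'rV[R]_d) (i : 'I_d) (s : R) : R :=
  shifted c s i / rnorm e (shifted c s).

Lemma unit_dir_continuous e c i : 0 < e -> continuous (unit_dir e c i).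
Proof.
move=> e0 s; apply: cvgM; first by apply: cvgB; [exact: cF|exact: cvg_cst].
apply: cvgV; last exact: shifted_continuous.
by rewrite gt_eqF//; apply: lt_le_trans e0 (rnorm_ge _ (ltW e0)).
Qed.

(* Euler-Lagrange equation of the smoothed distance, from [sqrt A' <= (A + A') / (2 sqrt A)]. *)
Lemma unit_dir_mean0 e c i : 0 < e -> (forall q, mdist e c <= mdist e q) ->
  \int[mu]_(s in `[0, 1]) unit_dir e c i s = 0.
Proof.
move=> e0 hc; set n := \int[mu]_(s in _) _.
have iu : mu.-integrable `[0, 1] (EFin \o unit_dir e c i).
  by apply: continuous_itv_integrable; exact: unit_dir_continuous.
have key D : D * n <= D ^+ 2 / (2 * e).
  have := hc (c + D *: delta_mx 0 i).
  have i1 : mu.-integrable `[0, 1] (EFin \o (fun s => (- D) * unit_dir e c i s)).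
    by apply: eq_integrable (integrableZl _ (- D) iu).
  have i2 : mu.-integrable `[0, 1] (EFin \o (fun s => (- D) * unit_dir e c i s + D ^+ 2 / (2 * e))).
    by apply: eq_integrable (integrableD _ i1 (integrable01_cst (D ^+ 2 / (2 * e)))).
  have : mdist e (c + D *: delta_mx 0 i) <= \int[mu]_(s in `[0, 1])
     (rnorm e (shifted c s) + (- D * unit_dir e c i s + D ^+ 2 / (2 * e))).
    apply: le_Rintegral => //.
    - exact: mdist_integrable.
    - by apply: eq_integrable (integrableD _ (mdist_integrable e c) i2).
    move=> s _; set r := rnorm e (shifted c s).
    have re : e <= r by apply: rnorm_ge; exact: ltW.
    have r0 : 0 < r by apply: lt_le_trans re.
    have hr : rnorm e (shifted (c + D *: delta_mx 0 i) s) ^+ 2 =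
        r ^+ 2 - 2 * D * shifted c s i + D ^+ 2.
      rewrite !rnorm_sqr -!addrA; congr (_ + _); rewrite /sqnorm !(bigD1 i (P := predT))//=.
      have -> : \sum_(j < d | j != i) shifted (c + D *: delta_mx 0 i) s j ^+ 2 =
          \sum_(j < d | j != i) shifted c s j ^+ 2.
        apply: eq_bigr => j ji; rewrite /shifted !mxE (negbTE ji) andbF /=; ring.
      by rewrite /shifted !mxE !eqxx /=; ring.
    have := sqr_ge0 (rnorm e (shifted (c + D *: delta_mx 0 i) s) - r).
    rewrite sqrrB hr /unit_dir -/r => h.
    have e1 : D ^+ 2 / (2 * r) <= D ^+ 2 / (2 * e).
      by rewrite ler_wpM2l ?sqr_ge0// lef_pV2 ?posrE//; lra.
    apply: (@le_trans _ _ (r + (- D * (shifted c s i / r) + D ^+ 2 / (2 * r)))); last first.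
      by rewrite !lerD2l.
    rewrite -(ler_pM2r (_ : 0 < 2 * r)); last by lra.
    have -> : (r + (- D * (shifted c s i / r) + D ^+ 2 / (2 * r))) * (2 * r) =
      2 * r ^+ 2 - 2 * D * shifted c s i + D ^+ 2 by field; rewrite gt_eqF.
    by lra.
  rewrite RintegralD//; last exact: mdist_integrable.
  rewrite RintegralD//; last exact: integrable01_cst.
  rewrite RintegralZl// Rintegral01_cst -/n -/(mdist e c); lra.
(* D = e n turns the inequality valid for all D into e n^2 <= e n^2 / 2, so n = 0. *)
have := key (e * n).
have -> : (e * n) ^+ 2 / (2 * e) = e * n ^+ 2 / 2 by field; rewrite gt_eqF.
move=> h; apply/eqP; rewrite -sqrf_eq0 eq_le sqr_ge0 andbT.
by rewrite -(ler_pM2l e0); lra.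
Qed.

End Median.

(** * Almost-everywhere inequalities under the integral *)

Section AEIntegrals.
Variable R : realType.
Local Notation mu := (@lebesgue_measure R).

Lemma ae_imp (P Q : R -> Prop) : (forall x, P x -> Q x) ->
  {ae mu, forall x, P x} -> {ae mu, forall x, Q x}.
Proof.
move=> PQ [N [mN N0 sN]]; exists N; split => // x /= Qx; apply: sN => /= Px.
exact/Qx/PQ.
Qed.

Lemma ae_imp2 (P Q S : R -> Prop) : (forall x, P x -> Q x -> S x) ->
  {ae mu, forall x, P x} -> {ae mu, forall x, Q x} -> {ae mu, forall x, S x}.
Proof.
move=> PQS [N [mN N0 sN]] [N' [mN' N'0 sN']].
exists (N `|` N'); split.
- exact: measurableU.
- exact: null_set_setU.
- move=> x /= Sx; have [Px|nPx] := pselect (P x); last by left; exact: sN.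
  by right; apply: sN' => /= Qx; exact/Sx/PQS.
Qed.

Lemma integrable_bigsum (I : finType) (f : I -> R -> R) a b :
  (forall i, mu.-integrable `[a, b] (EFin \o f i)) ->
  mu.-integrable `[a, b] (EFin \o (fun x => \sum_i f i x)).
Proof.
move=> fi; have := @integrable_sum _ _ _ mu `[a, b]%classic (measurable_itv _) _
  (index_enum I) xpredT (fun i => EFin \o f i) (fun i _ => fi i).
by apply: eq_integrable => // x _ /=; rewrite sumEFin.
Qed.

Lemma Rintegral_bigsum (I : finType) (f : I -> R -> R) a b :
  (forall i, mu.-integrable `[a, b] (EFin \o f i)) ->
  \int[mu]_(x in `[a, b]) (\sum_i f i x) = \sum_i \int[mu]_(x in `[a, b]) f i x.
Proof.
move=> fi; apply: EFin_inj; rewrite EFin_Rintegral//; last exact: integrable_bigsum.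
rewrite -sumEFin; under [RHS]eq_bigr do rewrite EFin_Rintegral//.
rewrite -(@integral_sum _ _ _ mu `[a, b]%classic (measurable_itv _) _ (fun i => EFin \o f i) fi).
by apply: eq_integral => x _; rewrite sumEFin.
Qed.

Lemma ae_Rintegral_ge0 (f : R -> R) a b : mu.-integrable `[a, b] (EFin \o f) ->
  {ae mu, forall x, [set` `[a, b]] x -> 0 <= f x} -> 0 <= \int[mu]_(x in `[a, b]) f x.
Proof.
move=> fi f0; rewrite -lee_fin EFin_Rintegral//.
have mf : @measurable_fun _ _ (measurableTypeR R) _ `[a, b]%classic (EFin \o f).
  exact: measurable_int fi.
have mn : @measurable_fun _ _ (measurableTypeR R) _ `[a, b]%classic (EFin \o (fun x => `|f x|)).
  have := measurable_int _ (integrable_norm fi); exact.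
have -> : (\int[mu]_(x in `[a, b]) (f x)%:E = \int[mu]_(x in `[a, b]) `|f x|%:E)%E.
  apply: (@ae_eq_integral _ (measurableTypeR R) R mu `[a, b]%classic
    (EFin \o (fun x => `|f x|)) (EFin \o f)) => //.
  by apply: (ae_imp _ f0) => x h xab /=; rewrite ger0_norm// h.
by apply: integral_ge0 => x _; rewrite lee_fin.
Qed.

Lemma ae_itv_exists (a b : R) (P : R -> Prop) : a < b -> {ae mu, forall x, P x} ->
  exists2 x, a <= x <= b & P x.
Proof.
move=> ab [N [mN N0 sN]]; apply/not_exists2P => h.
have sub : `[a, b] `<=` N.
  move=> x /=; rewrite in_itv /= => xab; apply: sN => /= Px.
  by case: (h x).
have : (mu `[a, b]%classic <= mu N)%E by apply: le_measure => //; rewrite inE//.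
rewrite [X in (_ <= X)%E]N0 lebesgue_measure_itv /= lte_fin ab -EFinB lee_fin; lra.
Qed.

Lemma continuous_ae_ge0 (f : R -> R) a b : a < b -> continuous f ->
  {ae mu, forall x, [set` `[a, b]] x -> 0 <= f x} -> forall x, a <= x <= b -> 0 <= f x.
Proof.
move=> ab cf f0 x xab; rewrite leNgt; apply/negP => fx.
have : \forall y \near x, f y < 0 by have := cvgr_lt (f x) (cf x); apply.
move=> /nbhs_ballP [r /= r0 hr].
pose a' := Num.max a (x - r / 2); pose b' := Num.min b (x + r / 2).
have a'b' : a' < b'.
  by rewrite /a' /b' lt_min !gt_max; move: xab => /andP[xa xb]; rewrite ab /=; lra.
have [y /andP[ay yb] hy] := ae_itv_exists a'b' f0.
move: ay yb; rewrite /a' /b' ge_max le_min => /andP[ay xy] /andP[yb yx].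
have : f y < 0 by apply: hr; rewrite /ball /= ltr_distl; lra.
by rewrite ltNge hy//= in_itv /= ay.
Qed.

Variable d : nat.

(* [2 D.n <= |D|^2 / L + L |n|^2] with [D] the increment and [L] the length of the interval. *)
Lemma AC_vector_lipschitz (w n : 'I_d -> R -> R) : (forall i, AC_loc (w i) (n i)) ->
  {ae mu, forall s, sqnorm (n ^~ s) <= 1} ->
  forall s t, sqnorm (fun i => w i s - w i t) <= (s - t) ^+ 2.
Proof.
move=> Hw n1.
have H s t : t < s -> sqnorm (fun i => w i s - w i t) <= (s - t) ^+ 2.
  move=> ts; set D := fun i => _; pose L := s - t.
  have L0 : 0 < L by rewrite subr_gt0.
  have ni i := (Hw i _ _ (ltW ts)).1.
  have DE i : D i = \int[mu]_(x in `[t, s]) n i x by have := (Hw i _ _ (ltW ts)).2.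
  pose c := (sqnorm D / L + L) / 2.
  have ci : mu.-integrable `[t, s] (EFin \o cst c).
    by apply: continuous_itv_integrable => ?; exact: cvg_cst.
  have Dni i : mu.-integrable `[t, s] (EFin \o (fun x => D i * n i x)).
    by apply: eq_integrable (integrableZl _ (D i) (ni i)).
  have Di := integrable_bigsum Dni.
  have ID : \int[mu]_(x in `[t, s]) (\sum_i D i * n i x) = sqnorm D.
    rewrite Rintegral_bigsum//; apply: eq_bigr => i _.
    by rewrite RintegralZl// -DE expr2.
  have Ic : \int[mu]_(x in `[t, s]) c = (sqnorm D + L ^+ 2) / 2.
    rewrite Rintegral_cst//= lebesgue_measure_itv /= lte_fin ts -EFinB /= -/L /c.
    by field; rewrite gt_eqF.
  have : 0 <= \int[mu]_(x in `[t, s]) (c - \sum_i D i * n i x).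
    apply: ae_Rintegral_ge0; first by apply: eq_integrable (integrableB _ ci Di).
    apply: (ae_imp _ n1) => x nx _; rewrite subr_ge0 /c.
    apply: (@le_trans _ _ ((sqnorm D / L + L * sqnorm (n ^~ x)) / 2)); last first.
      by rewrite ler_pM2r ?invr_gt0// lerD2l ler_piMr// ltW.
    rewrite /sqnorm mulr_suml mulr_sumr -big_split /= mulr_suml.
    apply: ler_sum => i _.
    have := sqr_ge0 (D i / L - n i x) => h.
    have h2 : 0 <= L * (D i / L - n i x) ^+ 2 by rewrite mulr_ge0// ltW.
    have e : L * (D i / L - n i x) ^+ 2 = D i ^+ 2 / L - 2 * (D i * n i x) + L * n i x ^+ 2.
      by field; rewrite gt_eqF.
    by rewrite e in h2; lra.
  rewrite RintegralB// ID Ic -/L; lra.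
move=> s t; have [st|ts|->] := ltgtP s t; last first.
- by rewrite subrr expr0n /sqnorm big1// => i _; rewrite subrr expr0n.
- exact: H.
have := H _ _ st; rewrite -[in leRHS]opprB sqrrN.
suff -> : sqnorm (fun i => w i t - w i s) = sqnorm (fun i => w i s - w i t) by [].
by apply: eq_bigr => i _; rewrite -sqrrN opprB.
Qed.
End AEIntegrals.

(** * Duality between the normal cone and the median *)

Section MedianOfForce.
Variables (R : realType) (d : nat).
Local Notation mu := (@lebesgue_measure R).
Variables (F f : 'I_d -> R -> R) (x : curve R d) (xs : 'I_d -> R -> R).
Hypothesis HF : forall i, AC_loc (F i) (fun s => - f i s).
Hypothesis pF : forall i, periodic1 (F i).
Hypothesis mf : forall i, measurable_fun setT (f i).
Hypothesis Kx : Lip1 x.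
Hypothesis Hx : forall i, AC_loc (cv x i) (xs i).
Hypothesis mxs : forall i, measurable_fun setT (xs i).
Hypothesis xs1 : forall s, sqnorm (xs ^~ s) <= 1.
Hypothesis normal_cone : forall w, Lip1 w ->
  \sum_i \int[mu]_(s in `[0, 1]) (f i s * (cv w i s - cv x i s)) <= 0.

Let cF i : continuous (F i). Proof. exact: AC_continuous (HF i). Qed.

Lemma periodic01 (g : R -> R) : periodic1 g -> g 1 = g 0.
Proof. by move=> pg; rewrite -[in LHS](add0r 1) pg. Qed.

Lemma xs_mean0 i : \int[mu]_(s in `[0, 1]) xs i s = 0.
Proof.
have [_ <-] := Hx i (ler01 : (0 : R) <= 1).
by rewrite (periodic01 (Kx.1 i)) subrr.
Qed.

Lemma Fxs_integrable i : mu.-integrable `[0, 1] (EFin \o (fun s => F i s * xs i s)).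
Proof.
apply: (@locally_int_mul R (xs i) (F i) id) => //.
  exact: AC_locally_int (Hx i).
by move=> s; rewrite subrr normr0.
Qed.

(** A primitive of [n] is periodic because [n] has mean zero, and 1-Lipschitz because |n| <= 1, so
    it may be tested in the normal cone. Integration by parts with F' = - f moves the derivative
    onto the test curve; the boundary terms cancel by periodicity. *)
Lemma normal_cone_primitive (n : 'I_d -> R -> R) : (forall i, continuous (n i)) ->
  (forall i, periodic1 (n i)) -> (forall i, \int[mu]_(s in `[0, 1]) n i s = 0) ->
  (forall s, sqnorm (n ^~ s) <= 1) ->
  \sum_i \int[mu]_(s in `[0, 1]) (F i s * n i s) <=
  \sum_i \int[mu]_(s in `[0, 1]) (F i s * xs i s).
Proof.
move=> cn pn n0 n1.
have ln i : locally_int (n i) by move=> a b; exact: continuous_itv_integrable.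
have mn i : measurable_fun setT (n i) by exact: continuous_measurable_fun.
have Hw i := primitive_AC (ln i).
pose w := mkcurve (fun i => AC_continuous (Hw i)).
have wE i s : cv w i s = primitive (n i) s by exact: mkcurveE.
have pw i : periodic1 (primitive (n i)).
  move=> s; have s1 : s <= s + 1 by lra.
  apply/eqP; rewrite -subr_eq0; apply/eqP.
  by have [_ ->] := Hw i _ _ s1; rewrite Rintegral_periodic.
have Kw : Lip1 w.
  split=> [i s|s t]; first by rewrite !wE; exact: pw.
  have := AC_vector_lipschitz Hw (aeW mu n1) s t.
  by rewrite /sqnorm; under [X in X <= _ -> _]eq_bigr do rewrite -!wE.
have := normal_cone Kw.
suff -> : \sum_i \int[mu]_(s in `[0, 1]) (f i s * (cv w i s - cv x i s)) =
    \sum_i \int[mu]_(s in `[0, 1]) (F i s * n i s) - \sum_i \int[mu]_(s in `[0, 1]) (F i s * xs i s).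
  by rewrite subr_le0.
rewrite -sumrB; apply: eq_bigr => i _.
have lxs : locally_int (xs i) := AC_locally_int (Hx i).
have iFn : mu.-integrable `[0, 1] (EFin \o (fun s => F i s * n i s)).
  by apply: continuous_itv_integrable => s; apply: cvgM; [exact: cF|exact: cn].
have Hu : AC_loc (fun s => cv w i s - cv x i s) (fun s => n i s - xs i s).
  move=> a b ab; have [in_ en] := Hw i a b ab; have [ix ex] := Hx i ab.
  split; first by apply: eq_integrable (integrableB _ in_ ix).
  by rewrite RintegralB// -en -ex !wE; ring.
have mu_ : measurable_fun setT (fun s => n i s - xs i s) by exact: measurable_funB.
have mf' : measurable_fun setT (fun s => - f i s) by exact: measurableT_comp.
have := ibp_01 (HF i) Hu mf' mu_.
rewrite (periodic01 (pF i)) (periodic01 (Kx.1 i)) (periodic01 (Kw.1 i)) subrr.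
have lf : locally_int (fun s => (cv w i s - cv x i s) * - f i s).
  apply: (@locally_int_mul R (fun s => - f i s) (fun s => cv w i s - cv x i s) id) => //.
  - exact: AC_locally_int (HF i).
  - exact: AC_continuous Hu.
  - by move=> s; rewrite subrr normr0.
have e1 : \int[mu]_(s in `[0, 1]) (F i s * (n i s - xs i s)) =
    \int[mu]_(s in `[0, 1]) (F i s * n i s) - \int[mu]_(s in `[0, 1]) (F i s * xs i s).
  rewrite -RintegralB//; last exact: Fxs_integrable.
  by apply: eq_Rintegral => s _; ring.
have i1 : mu.-integrable `[0, 1] (EFin \o (fun s => F i s * (n i s - xs i s))).
  apply: eq_integrable (integrableB _ iFn (Fxs_integrable i)) => // s _ /=.
  by rewrite -EFinB; congr EFin; ring.
rewrite (RintegralD _ i1 (lf 0 1))// e1 => h.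
suff -> : \int[mu]_(s in `[0, 1]) (f i s * (cv w i s - cv x i s)) =
  - \int[mu]_(s in `[0, 1]) ((cv w i s - cv x i s) * - f i s).
  by move/eqP: h; rewrite addr_eq0 => /eqP ->.
rewrite -[RHS]mulN1r -(RintegralZl _ _ (lf 0 1))//.
by apply: eq_Rintegral => s _; ring.
Qed.

(** Once the median c is found this equals the integral of |F - c|, that is, of the tension. It does
    not change when a constant is added to [F], since [xs] has mean zero. *)
Definition tension_mass : R := \sum_i \int[mu]_(s in `[0, 1]) (F i s * xs i s).

Lemma gap_integrable q : mu.-integrable `[0, 1]
  (EFin \o (fun s => vnorm (shifted F q s) - dotp (shifted F q s) (xs ^~ s))).
Proof.
have i1 := mdist_integrable cF 0 q.
have i2 : mu.-integrable `[0, 1] (EFin \o (fun s => dotp (shifted F q s) (xs ^~ s))).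
  apply: integrable_bigsum => i; apply: (@locally_int_mul R (xs i) (fun s => shifted F q s i) id) => //.
  - exact: AC_locally_int (Hx i).
  - by move=> s; apply: cvgB; [exact: cF|exact: cvg_cst].
  - by move=> s; rewrite subrr normr0.
apply: eq_integrable (integrableB _ i1 i2) => // s _ /=.
by rewrite rnorm0 -EFinB.
Qed.

Lemma gap_integral q :
  \int[mu]_(s in `[0, 1]) (vnorm (shifted F q s) - dotp (shifted F q s) (xs ^~ s)) =
  mdist F 0 q - tension_mass.
Proof.
have i1 := mdist_integrable cF 0 q.
have i2 i : mu.-integrable `[0, 1] (EFin \o (fun s => shifted F q s i * xs i s)).
  apply: (@locally_int_mul R (xs i) (fun s => shifted F q s i) id) => //.
  - exact: AC_locally_int (Hx i).
  - by move=> s; apply: cvgB; [exact: cF|exact: cvg_cst].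
  - by move=> s; rewrite subrr normr0.
have i1' : mu.-integrable `[0, 1] (EFin \o (fun s => vnorm (shifted F q s))).
  by apply: eq_integrable i1 => // s _ /=; rewrite rnorm0.
rewrite (RintegralB _ i1' (integrable_bigsum i2))// Rintegral_bigsum//.
congr (_ - _); first by apply: eq_Rintegral => s _; rewrite rnorm0.
apply: eq_bigr => i _.
have ix := (Hx i (ler01 : (0 : R) <= 1)).1.
have iz : mu.-integrable `[0, 1] (EFin \o (fun s => q 0 i * xs i s)).
  by apply: eq_integrable (integrableZl _ (q 0 i) ix).
transitivity (\int[mu]_(s in `[0, 1]) (F i s * xs i s - q 0 i * xs i s)).
  by apply: eq_Rintegral => s _; rewrite /shifted; ring.
rewrite RintegralB//; last exact: Fxs_integrable.
by rewrite RintegralZl// xs_mean0 mulr0 subr0.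
Qed.

Lemma gap_ge0 q s : 0 <= vnorm (shifted F q s) - dotp (shifted F q s) (xs ^~ s).
Proof.
rewrite subr_ge0; apply: (le_trans (dotp_le _ _)).
rewrite ler_piMr ?vnorm_ge0// -(ler_sqr (x := vnorm _)) ?nnegrE ?vnorm_ge0//.
by rewrite vnorm_sqr expr1n.
Qed.

Lemma tension_mass_le q : tension_mass <= mdist F 0 q.
Proof.
by rewrite -subr_ge0 -gap_integral; apply: Rintegral_ge0 => s _; exact: gap_ge0.
Qed.

(** There is no duality gap: the unit directions at a minimizer of the smoothed distance are
    continuous and of mean zero, hence admissible in [normal_cone_primitive]. With r the smoothed
    norm of F - c, their pairing with F - c is r - e^2 / r >= r - e pointwise. *)
Lemma mdist_le_mass (e : R) : 0 < e -> exists c, mdist F 0 c <= tension_mass + e.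
Proof.
move=> e0; have [c hc] := mdist_min cF e; exists c.
pose n := unit_dir F e c.
have cn i : continuous (n i) by exact: unit_dir_continuous.
have n0 i : \int[mu]_(s in `[0, 1]) n i s = 0 by exact: unit_dir_mean0.
have r0 s : 0 < rnorm e (shifted F c s).
  by apply: lt_le_trans e0 (rnorm_ge _ (ltW e0)).
have nn s : sqnorm (n ^~ s) = sqnorm (shifted F c s) / rnorm e (shifted F c s) ^+ 2.
  by rewrite /sqnorm mulr_suml; apply: eq_bigr => i _; rewrite /n /unit_dir expr_div_n.
have n1 s : sqnorm (n ^~ s) <= 1.
  rewrite nn ler_pdivrMr ?exprn_gt0// mul1r rnorm_sqr lerDr sqr_ge0//.
have pn i : periodic1 (n i).
  move=> s; rewrite /n /unit_dir.
  have -> : shifted F c (s + 1) = shifted F c s by apply/funext => j; rewrite /shifted pF.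
  by [].
have := normal_cone_primitive cn pn n0 n1; rewrite -/tension_mass.
have i1 : mu.-integrable `[0, 1] (EFin \o (fun s => rnorm e (shifted F c s) - e)).
  by apply: eq_integrable (integrableB _ (mdist_integrable cF e c) (integrable01_cst e)).
have i2 i : mu.-integrable `[0, 1] (EFin \o (fun s => shifted F c s i * n i s)).
  apply: continuous_itv_integrable => s; apply: cvgM; last exact: cn.
  by apply: cvgB; [exact: cF|exact: cvg_cst].
have : mdist F e c - e <= \sum_i \int[mu]_(s in `[0, 1]) (shifted F c s i * n i s).
  rewrite -{2}(Rintegral01_cst e) /mdist -RintegralB//; last 2 first.
  - exact: mdist_integrable.
  - exact: integrable01_cst.
  rewrite -Rintegral_bigsum//; apply: le_Rintegral => //; first exact: integrable_bigsum.
  move=> s _; rewrite lerBlDr.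
  have -> : \sum_i shifted F c s i * n i s = sqnorm (shifted F c s) / rnorm e (shifted F c s).
    rewrite /sqnorm mulr_suml; apply: eq_bigr => i _.
    by rewrite /n /unit_dir expr2 mulrA.
  have r0s := r0 s; rewrite -(ler_pM2r r0s) mulrDl mulfVK ?gt_eqF// -expr2 rnorm_sqr.
  rewrite addrC lerD2l expr2 ler_wpM2l ?(ltW e0)//.
  exact: rnorm_ge (ltW e0).
have -> : \sum_i \int[mu]_(s in `[0, 1]) (shifted F c s i * n i s) =
    \sum_i \int[mu]_(s in `[0, 1]) (F i s * n i s).
  apply: eq_bigr => i _.
  have in_ : mu.-integrable `[0, 1] (EFin \o n i) by exact: continuous_itv_integrable.
  have iz : mu.-integrable `[0, 1] (EFin \o (fun s => c 0 i * n i s)).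
    by apply: eq_integrable (integrableZl _ (c 0 i) in_).
  have iF : mu.-integrable `[0, 1] (EFin \o (fun s => F i s * n i s)).
    by apply: continuous_itv_integrable => s; apply: cvgM; [exact: cF|exact: cn].
  transitivity (\int[mu]_(s in `[0, 1]) (F i s * n i s - c 0 i * n i s)).
    by apply: eq_Rintegral => s _; rewrite /shifted; ring.
  by rewrite (RintegralB _ iF iz)// RintegralZl// n0 mulr0 subr0.
have : mdist F 0 c <= mdist F e c.
  apply: le_Rintegral => //; [exact: mdist_integrable..|].
  by move=> s _; apply: le_rnorm; rewrite lexx ltW.
by lra.
Qed.

Lemma median_exists : exists c, mdist F 0 c = tension_mass.
Proof.
have [c hc] := mdist_min cF 0; exists c; apply/eqP.
rewrite eq_le tension_mass_le andbT; apply/ler_addgt0Pr => e e0.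
by have [c' hc'] := mdist_le_mass e0; apply: le_trans (hc c') _.
Qed.

Lemma vnorm_shifted_continuous q : continuous (fun s => vnorm (shifted F q s)).
Proof.
have -> : (fun s => vnorm (shifted F q s)) = fun s => rnorm 0 (shifted F q s).
  by apply/funext => s; rewrite rnorm0.
exact: shifted_continuous.
Qed.

(** The equality case of Cauchy-Schwarz: the squared length of v - |v| u is |v|^2 (|u|^2 - 1) <=
    0. *)
Lemma vnorm_eq_dotp (v u : 'I_d -> R) : sqnorm u <= 1 -> vnorm v = dotp v u ->
  forall i, v i = vnorm v * u i.
Proof.
move=> u1 e.
have : sqnorm (fun i => v i - vnorm v * u i) <= 0.
  have -> : sqnorm (fun i => v i - vnorm v * u i) =
      sqnorm v - 2 * vnorm v * dotp v u + vnorm v ^+ 2 * sqnorm u.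
    rewrite /sqnorm /dotp !mulr_sumr -sumrB -big_split /=.
    by apply: eq_bigr => i _; ring.
  rewrite -e -vnorm_sqr; have := ler_wpM2l (sqr_ge0 (vnorm v)) u1.
  by rewrite mulr1 expr2; lra.
move=> h i; apply/eqP; rewrite -subr_eq0 -sqrf_eq0 eq_le sqr_ge0 andbT.
by apply: le_trans h; exact: (sqnorm_le_comp (fun i => v i - vnorm v * u i)).
Qed.

(** The duality gap is the integral of a nonnegative pointwise gap, so its vanishing forces equality
    in Cauchy-Schwarz at almost every [s]. *)
Lemma median_direction c : mdist F 0 c = tension_mass ->
  {ae mu, forall s, [set` `[0, 1]] s ->
    forall i, F i s - c 0 i = vnorm (shifted F c s) * xs i s}.
Proof.
move=> hc; pose G s := vnorm (shifted F c s) - dotp (shifted F c s) (xs ^~ s).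
have iG : mu.-integrable `[0, 1] (EFin \o G) := gap_integrable c.
have : (\int[mu]_(x in `[0%R, 1%R]) `|(EFin \o G) x| = 0)%E.
  transitivity (\int[mu]_(x in `[0%R, 1%R]) (G x)%:E)%E.
    by apply: eq_integral => s _; rewrite gee0_abs// lee_fin; exact: gap_ge0.
  by rewrite -EFin_Rintegral// gap_integral hc subrr.
have mG : @measurable_fun _ _ (measurableTypeR R) _ `[0, 1]%classic (EFin \o G).
  exact: measurable_int iG.
have mI : @measurable _ (measurableTypeR R) `[0, 1]%classic by exact: measurable_itv.
move=> /(proj1 (@ae_eq_integral_abs _ (measurableTypeR R) R mu _ mI _ mG)).
apply: ae_imp => s h s01.
have e : vnorm (shifted F c s) = dotp (shifted F c s) (xs ^~ s).
  by have [/subr0_eq] := h s01.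
by apply: vnorm_eq_dotp e; exact: xs1.
Qed.

(** Subtracting the two direction identities gives k = D xs_i a.e., with k = c'_i - c_i and D = |F -
    c| - |F - c'|. As |xs_i| <= 1, the continuous D satisfies D^2 >= k^2 > 0 and keeps one sign,
    positive after exchanging c and c'. Then k xs_i = k^2 / D is bounded below by a positive
    constant, which contradicts the mean zero of xs_i. *)
Lemma median_unique c c' : mdist F 0 c = tension_mass -> mdist F 0 c' = tension_mass -> c = c'.
Proof.
move=> hc hc'; apply/rowP => i; apply/eqP/negPn/negP => ne.
wlog D0 : c c' hc hc' ne / vnorm (shifted F c' 0) <= vnorm (shifted F c 0).
  move=> W; have [/W|/ltW /W] := leP (vnorm (shifted F c' 0)) (vnorm (shifted F c 0)).
    by apply.
  by rewrite eq_sym; apply.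
pose D s := vnorm (shifted F c s) - vnorm (shifted F c' s).
have cD : continuous D by move=> s; apply: cvgB; exact: vnorm_shifted_continuous.
pose k := c' 0 i - c 0 i.
have k0 : 0 < k ^+ 2 by rewrite exprn_even_gt0//= subr_eq0 eq_sym.
have hD : {ae mu, forall s, [set` `[0, 1]] s -> k = D s * xs i s}.
  apply: (ae_imp2 _ (median_direction hc) (median_direction hc')) => s h h' s01.
  by rewrite /D mulrBl -(h s01 i) -(h' s01 i) /k; ring.
have D2 s : 0 <= s <= 1 -> k ^+ 2 <= D s ^+ 2.
  move=> s01; rewrite -subr_ge0.
  apply: (@continuous_ae_ge0 R (fun s => D s ^+ 2 - k ^+ 2) 0 1) => //.
    by move=> u; apply: cvgB; [apply: cvg_sqr; exact: cD|exact: cvg_cst].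
  apply: (ae_imp _ hD) => u h u01; rewrite subr_ge0 (h u01) exprMn.
  rewrite ler_piMr ?sqr_ge0//; apply: le_trans (xs1 u).
  exact: (sqnorm_le_comp (xs ^~ u)).
have Dp s : 0 <= s <= 1 -> 0 < D s.
  move=> /andP[s0 s1]; rewrite ltNge; apply/negP => Ds.
  have [] := @IVT R D 0 s 0 s0 (continuous_subspaceT cD).
    by rewrite ge_min le_max Ds /D subr_ge0 D0 orbT.
  move=> u; rewrite in_itv /= => /andP[u0 us] Du.
  have := D2 u; rewrite u0 (le_trans us s1) Du expr0n /= => /(_ isT).
  by rewrite leNgt k0.
have [B B0 hB] := continuous_bounded_itv 0 1 cD.
have kxs : {ae mu, forall s, [set` `[0, 1]] s -> 0 <= k * xs i s - k ^+ 2 / (B + 1)}.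
  apply: (ae_imp _ hD) => s h s01.
  have Ds : 0 < D s by apply: Dp; move: s01; rewrite /= in_itv.
  have DB : D s <= B + 1.
    have := hB s; move: s01; rewrite /= in_itv /= => s01 /(_ s01).
    by rewrite gtr0_norm//; lra.
  rewrite subr_ge0 ler_pdivrMr; last by lra.
  have kD : k * xs i s * D s = k ^+ 2 by rewrite -mulrA (mulrC (xs i s)) -(h s01).
  have -> : k * xs i s * (B + 1) = k ^+ 2 + k * xs i s * (B + 1 - D s).
    by rewrite mulrBr kD; ring.
  rewrite lerDl mulr_ge0 ?subr_ge0// -(pmulr_lge0 _ Ds).
  by rewrite kD ltW.
have ix := (Hx i (ler01 : (0 : R) <= 1)).1.
have ik : mu.-integrable `[0, 1] (EFin \o (fun s => k * xs i s)).
  by apply: eq_integrable (integrableZl _ k ix).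
have ic := integrable01_cst (k ^+ 2 / (B + 1)).
have := ae_Rintegral_ge0 _ kxs; rewrite (RintegralB _ ik ic)// RintegralZl//.
rewrite xs_mean0 Rintegral01_cst mulr0 sub0r oppr_ge0 => /(_ _)/wrap[].
  by apply: eq_integrable (integrableB _ ik ic).
by rewrite leNgt divr_gt0//; lra.
Qed.

(** By coercivity the mean distance attains a minimum over the points at distance at least [e] from
    [c]; by uniqueness this minimum exceeds [tension_mass], and half the excess serves as [r]. *)
Lemma median_well_posed c (e : R) : mdist F 0 c = tension_mass -> 0 < e ->
  exists2 r, 0 < r & forall q, mdist F 0 q <= tension_mass + r -> `|q - c| <= e.
Proof.
move=> hc e0; pose A : set 'rV[R]_d := [set q | e <= `|q - c|].
have [[a Aa]|A0] := pselect (A !=set0); last first.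
  exists 1 => // q _; rewrite leNgt; apply/negP => h; apply: A0; exists q.
  exact: ltW.
have clA : closed A.
  rewrite (_ : A = (fun q : 'rV[R]_d => `|q - c|) @^-1` [set r : R | e <= r])//.
  apply: closed_comp (@closed_ge _ e) => q _.
  apply: continuous_comp; last exact: norm_continuous.
  exact: (@cvgB _ _ _ (nbhs q) (nbhs_filter q) id (cst c) q c (@cvg_id _ (nbhs q)) (cvg_cst c)).
have [q0 Aq0 hq0] := coercive_min (@mdist_continuous R d F cF 0) (mdist_coercive cF 0) clA Aa.
have lt0 : tension_mass < mdist F 0 q0.
  rewrite lt_neqAle tension_mass_le andbT; apply/eqP => /esym /(median_unique hc) E.
  by move: Aq0; rewrite /A /= -E subrr normr0 leNgt e0.
exists ((mdist F 0 q0 - tension_mass) / 2); first by rewrite divr_gt0// subr_gt0.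
move=> q hq; rewrite leNgt; apply/negP => h.
by have := hq0 q (ltW h); lra.
Qed.

End MedianOfForce.

(** * Measurable dependence on time *)

Section SobolevPartial.
Variables (R : realType) (d : nat) (v : 'I_d -> R -> R -> R).
Local Notation mu := (@lebesgue_measure R).
Local Notation mu2 := ((@lebesgue_measure R) \x (@lebesgue_measure R))%E.
Local Notation W := (@window R).
Hypothesis mv : forall i, measurable_fun setT (uncurry2 (v i)).
Hypothesis cv : forall i p, continuous (v i p).
Hypothesis dq_bound : forall N, exists C : R, forall n, (dq_energy v N n <= C%:E)%E.

(** The dominating function [H] is sliced both ways. Fixing [p] gives absolute continuity in [x];
    fixing [x] gives L^2 convergence in [p] of the quotients at that point. With time as [x], the
    second slice provides the velocity as a strong limit at almost every time. *)
Lemma sobolev_partial : exists (g : 'I_d -> R -> R -> R) (nk : nat -> nat),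
  [/\ forall i, measurable_fun setT (uncurry2 (g i)),
      forall i N, (\int[mu]_(p in W N) \int[mu]_(x in W N) ((g i p x) ^+ 2)%:E < +oo)%E,
      {ae mu, forall p, forall i, AC_loc (v i p) (g i p)} &
      {ae mu, forall x, forall N, exists C : R, forall i k,
        (\int[mu]_(p in W N) ((diff_quot (v i p) (nk k) x - g i p x) ^+ 2)%:E <=
         (C * (9 / 16) ^+ k)%:E)%E}] /\
  [/\ forall k, (k <= nk k)%N,
      forall p x, (forall i, g i p x = 0) \/
        (forall i, diff_quot (v i p) (nk k) x @[k --> \oo] --> g i p x) &
      forall p p', (forall i, v i p = v i p') -> forall i, g i p = g i p'].
Proof.
have [g [nk [H [[mg mH H0 finH] [nk_ge apx cases per]]]]] := sobolev_derivative mv cv dq_bound.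
have mW N := @measurable_window R N.
have mdq i n : measurable_fun setT (fun z : R * R => diff_quot (v i z.1) n z.2).
  exact: measurable_diff_quot (mv i).
exists g, nk; split; split => //.
- move=> i N.
  have mg2 : measurable_fun setT (fun z : R * R => ((g i z.1 z.2) ^+ 2)%:E).
    by apply/measurable_EFinP; apply: measurable_funX; exact: mg.
  have md2 : measurable_fun setT (fun z : R * R => ((diff_quot (v i z.1) (nk 0%N) z.2) ^+ 2)%:E).
    by apply/measurable_EFinP; apply: measurable_funX; exact: mdq.
  have mWW : measurable (W N `*` W N) by apply: measurableX; exact: mW.
  rewrite -(@integral_prod R (fun z : R * R => ((g i z.1 z.2) ^+ 2)%:E))//; last first.
    by move=> z; rewrite lee_fin sqr_ge0.
  (* From b^2 <= 2 a^2 + 2 (a - b)^2, where (a - b)^2 is at most 16 [H] at k = 0. *)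
  apply: (@le_lt_trans _ _ (\int[mu2]_(z in W N `*` W N)
      (2%:E * ((diff_quot (v i z.1) (nk 0%N) z.2) ^+ 2)%:E + 32%:E * H z)))%E.
    apply: ge0_le_integral => //.
    - by move=> z _; rewrite lee_fin sqr_ge0.
    - exact: measurable_funTS.
    - by apply: measurable_funTS; apply: emeasurable_funD; apply: emeasurable_funM.
    - move=> z _; have := apx i 0%N z.1 z.2; rewrite expr0 mulr1.
      rewrite -surjective_pairing; have := H0 z.
      case: (H z) => [r| |]//; last first.
        by move=> _ _; rewrite gt0_muley// addey// leey.
      rewrite -!EFinM -EFinD !lee_fin; set a := diff_quot _ _ _; set b := g i _ _ => r0 h.
      have := sqr_ge0 (2 * a - b); have -> : (2 * a - b) ^+ 2 = 4 * a ^+ 2 - 4 * a * b + b ^+ 2 by ring.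
      have e : (a - b) ^+ 2 = a ^+ 2 - 2 * a * b + b ^+ 2 by ring.
      by rewrite e in h; lra.
  rewrite ge0_integralD//; last 4 first.
  - by move=> z _; rewrite mule_ge0// lee_fin sqr_ge0.
  - by apply: measurable_funTS; apply: emeasurable_funM.
  - by move=> z _; rewrite mule_ge0.
  - by apply: measurable_funTS; apply: emeasurable_funM.
  rewrite ge0_integralZl//; last 2 first.
  - exact: measurable_funTS.
  - by move=> z _; rewrite lee_fin sqr_ge0.
  rewrite ge0_integralZl//; last exact: measurable_funTS.
  rewrite integral_prod//; last by move=> z; rewrite lee_fin sqr_ge0.
  rewrite integral_prod//.
  apply: lte_add_pinfty; last by rewrite lte_mul_pinfty.
  rewrite lte_mul_pinfty//; have [C /(_ (nk 0%N)) HC] := dq_bound N.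
  apply: le_lt_trans (ltry C); apply: le_trans HC.
  rewrite /dq_energy (bigD1 i)//= leeDl// sume_ge0// => j _.
  by apply: integral_ge0 => p _; apply: integral_ge0 => x _; rewrite lee_fin sqr_ge0.
- apply: (ae_imp _ (ae_inner_finite mH H0 finH)) => p hp i.
  apply: (@sobolev_AC R (v i p) (g i p) (fun x => H (p, x)) nk) => //.
  + exact: (measurableT_comp (mg i) (pair1_measurable p)).
  + exact: (measurableT_comp mH (pair1_measurable p)).
- have mHs : measurable_fun setT (fun z : R * R => H (z.2, z.1)).
    by apply: (measurableT_comp mH); apply/measurable_fun_pairP; split => /=;
      [exact: measurable_snd|exact: measurable_fst].
  have finHs N : (\int[mu]_(p in W N) \int[mu]_(x in W N) H (x, p) < +oo)%E.
    by rewrite -integral_swap.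
  apply: (ae_imp _ (ae_inner_finite mHs (fun z => H0 (z.2, z.1)) finHs)) => x /= hx N.
  have I0 : (0 <= \int[mu]_(p in W N) H (p, x))%E by exact: integral_ge0.
  exists (16 * fine (\int[mu]_(p in W N) H (p, x))) => i k.
  have mHx : measurable_fun setT (fun p => H (p, x)).
    exact: (measurableT_comp mH (pair2_measurable x)).
  apply: (@le_trans _ _ (\int[mu]_(p in W N) ((16 * (9 / 16) ^+ k)%:E * H (p, x)))%E).
    have mS : measurable_fun setT (fun p => ((diff_quot (v i p) (nk k) x - g i p x) ^+ 2)%:E).
      apply/measurable_EFinP; apply: measurable_funX; apply: measurable_funB.
      - exact: (measurableT_comp (mdq i (nk k)) (pair2_measurable x)).
      - exact: (measurableT_comp (mg i) (pair2_measurable x)).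
    apply: ge0_le_integral => //.
    - by move=> p _; rewrite lee_fin sqr_ge0.
    - exact: measurable_funTS.
    - by apply: measurable_funTS; apply: emeasurable_funM.
  rewrite ge0_integralZl//; last first.
    exact: measurable_funTS.
  rewrite -{1}(fineK (x := (\int[mu]_(p in W N) H (p, x))%E)); last by rewrite ge0_fin_numE.
  by rewrite -EFinM lee_fin mulrAC.
Qed.

End SobolevPartial.

(** * From slices to the product measure *)

Section Measurability.
Variable R : realType.
Local Notation mu := (@lebesgue_measure R).
Local Notation mu2 := ((@lebesgue_measure R) \x (@lebesgue_measure R))%E.
Local Notation W := (@window R).

Lemma measurable_inner_Rintegral (f : R -> R -> R) (D : set (measurableTypeR R)) :
  measurable_fun setT (uncurry2 f) -> measurable D ->
  measurable_fun setT (fun p => \int[mu]_(x in D) f p x).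
Proof.
move=> mf mD; rewrite /Rintegral.
have -> : (fun p => fine (\int[mu]_(x in D) (f p x)%:E)) =
   fun p => fine (\int[mu]_(x in D) (EFin \o uncurry2 f)^\+ (p, x) -
      \int[mu]_(x in D) (EFin \o uncurry2 f)^\- (p, x))%E.
  apply/funext => p; congr fine; rewrite [LHS]integralE; congr (_ - _)%E;
    by apply: eq_integral => x _; rewrite ?funeposE ?funenegE.
have mf' : measurable_fun setT (EFin \o uncurry2 f) by exact/measurable_EFinP.
apply: measurableT_comp; first exact: fine_measurable.
apply: emeasurable_funB; apply: measurable_inner_integral => //.
- exact: measurable_funepos.
- exact: measurable_funeneg.
Qed.

Lemma mu_window N : mu (W N) = (2 * N%:R)%:E.
Proof.
rewrite lebesgue_measure_itv /= lte_fin.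
have [->|N0] := posnP N; first by rewrite oppr0 ltxx mulr0.
have N1 : 0 < N%:R :> R by rewrite ltr0n.
by rewrite ifT -?EFinB; [congr EFin; ring|lra].
Qed.

Lemma ge0_periodic_window (f : R -> \bar R) N : measurable_fun setT f ->
  (forall x, 0 <= f x)%E -> (forall x, f (x + 1) = f x) ->
  (\int[mu]_(x in W N) f x <= \int[mu]_(x in `[0%R, 1%R]) f x * (2 * N%:R)%:E)%E.
Proof.
move=> mf f0 pf; set I := (\int[mu]_(x in `[_, _]) f x)%E.
have sh (a : R) : (\int[mu]_(x in `[(a + 1)%R, (a + 1 + 1)%R]) f x =
    \int[mu]_(x in `[a, (a + 1)%R]) f x)%E.
  by rewrite integral_itv_shift//; apply: eq_integral => x _; rewrite pf.
have unit (k : int) : (\int[mu]_(x in `[k%:~R, (k%:~R + 1)%R]) f x = I)%E.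
  have step (a : R) (m : nat) : (\int[mu]_(x in `[(a + m%:R)%R, (a + m%:R + 1)%R]) f x =
      \int[mu]_(x in `[a, (a + 1)%R]) f x)%E.
    by elim: m => [|m IH]; rewrite ?addr0// -natr1 addrA sh.
  case: k => n; first by rewrite -[n%:~R]add0r step add0r.
  by rewrite -(step _ n.+1) NegzE mulrNz addNr add0r.
have I0 : (0 <= I)%E by exact: integral_ge0.
have -> : (I * (2 * N%:R)%:E = \int[mu]_(x in W N) cst I x)%E.
  by rewrite integral_cst; [congr (_ * _)%E; exact/esym/mu_window|exact: measurable_window].
(* The cells of level 0 are the unit intervals, that is, single periods. *)
have [k [j ->]] := @window_cells R 0 N.
apply: cells_integral_le => // {j}k.
rewrite integral_cst; last exact: measurable_cell.
rewrite [X in (_ <= _ * X)%E]mu_cell /cell /dyadic_step expr0 mulr1 mule1 -(unit k).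
apply: ge0_subset_integral => //; first exact: measurable_funTS.
by move=> x /=; rewrite !in_itv /= => /andP[-> /ltW ->].
Qed.

(** Joint measurability of the two functions lets Tonelli compute the integral of |f - g| by slices;
    it is 0, which gives equality almost everywhere for the product measure. *)
Lemma ae_prod_eq (D : set R) (E : set R) (f g : R * R -> R) :
  measurable_fun setT f -> measurable_fun setT g ->
  @measurable _ (measurableTypeR R) D -> @measurable _ (measurableTypeR R) E ->
  {ae mu, forall t, D t -> {ae mu, forall s, E s -> f (t, s) = g (t, s)}} ->
  {ae mu2, forall p, (D `*` E) p -> f p = g p}.
Proof.
move=> mf mg mD mE h.
pose F (p : R * R) : \bar R := (`|f p - g p|)%:E.
have mF : measurable_fun setT F.
  apply/measurable_EFinP; apply: measurableT_comp; first exact: normr_measurable.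
  exact: measurable_funB.
have F0 p : (0 <= F p)%E by rewrite lee_fin.
have mDE : measurable (D `*` E) by exact: measurableX.
have : (\int[mu2]_(p in D `*` E) F p = 0)%E.
  rewrite integral_prod//.
  transitivity (\int[mu]_(p in D) (cst 0 p))%E; last by rewrite integral0.
  apply: (@ae_eq_integral _ (measurableTypeR R) R mu D (cst 0%E)
     (fun t => \int[mu]_(s in E) F (t, s))%E) => //.
  - by apply: measurable_funTS; exact: measurable_inner_integral.
  - apply: (ae_imp _ h) => t ht Dt /=.
    transitivity (\int[mu]_(s in E) (cst 0 s))%E; last by rewrite integral0.
    apply: (@ae_eq_integral _ (measurableTypeR R) R mu E (cst 0%E) (fun s => F (t, s))) => //.
      by apply: measurable_funTS; exact: (measurableT_comp mF (pair1_measurable t)).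
    by apply: (ae_imp _ (ht Dt)) => s hs Es /=; rewrite /F hs// subrr normr0.
move=> I0; have : (\int[mu2]_(p in D `*` E) `|F p| = 0)%E.
  by rewrite -I0; apply: eq_integral => p _; rewrite gee0_abs.
move=> /(proj1 (@ae_eq_integral_abs _ _ R mu2 _ mDE _ (measurable_funTS mF))).
move=> [N [mN N0 sN]]; exists N; split => // p /= hp; apply: sN => /= hF; apply: hp => DEp.
by have [/normr0_eq0/subr0_eq] := hF DEp.
Qed.

Lemma L2loc_bounded (f : R -> R -> R) : measurable_fun setT (uncurry2 f) ->
  (forall T : R, 0 < T -> exists C : R, forall t, 0 < t < T ->
     (\int[mu]_(s in `[0%R, 1%R]) ((f t s) ^+ 2)%:E <= C%:E)%E) -> L2loc f.
Proof.
move=> mf hf; split => // T T0; have [C HC] := hf T T0.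
have mf2 : measurable_fun setT (fun p => ((uncurry2 f p) ^+ 2)%:E).
  by apply/measurable_EFinP; exact: measurable_funX.
rewrite integral_prod//; last by move=> z; rewrite lee_fin sqr_ge0.
apply: (@le_lt_trans _ _ (\int[mu]_(p in `]0%R, T[) (C%:E))%E).
  apply: ge0_le_integral => //.
  - by move=> p _; apply: integral_ge0 => s _; rewrite lee_fin sqr_ge0.
  - by apply: measurable_funTS; apply: (measurable_inner_integral mf2) => // z;
      rewrite lee_fin sqr_ge0.
by rewrite integral_cst//= lebesgue_measure_itv /= lte_fin T0 -EFinB -EFinM ltry.
Qed.

Lemma L2loc_window (f : R -> R -> R) : measurable_fun setT (uncurry2 f) ->
  (forall N, (\int[mu]_(t in W N) \int[mu]_(s in W N) ((f t s) ^+ 2)%:E < +oo)%E) -> L2loc f.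
Proof.
move=> mf hf; split => // T T0.
have mf2 : measurable_fun setT (fun p => ((uncurry2 f p) ^+ 2)%:E).
  by apply/measurable_EFinP; exact: measurable_funX.
have f0 z : (0 <= ((uncurry2 f z) ^+ 2)%:E)%E by rewrite lee_fin sqr_ge0.
(* The second successor ensures N > 1, so that the closed interval [0, 1] fits in the half-open
   window. *)
pose N := (Num.truncn `|T|).+2.
have TN : T < N%:R by apply: (le_lt_trans (ler_norm T)); apply: lt_trans (truncnS_gt _) _; rewrite ltr_nat.
have N1 : 1 < N%:R :> R by rewrite ltr1n.
have mW := @measurable_window R N.
apply: le_lt_trans (hf N); rewrite -(integral_prod mf2)//.
apply: ge0_subset_integral => //.
- by apply: measurableX; exact: measurable_itv.
- exact: measurableX.
- exact: measurable_funTS.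
- move=> p []; rewrite /= !in_itv /= => /andP[a b] /andP[c e].
  by split; rewrite /window /= in_itv /=; apply/andP; split; lra.
Qed.

End Measurability.

(** * Median and tension as functions of time *)

Section StaticFamily.
Variables (R : realType) (d : nat).
Local Notation mu := (@lebesgue_measure R).
Variables (f : 'I_d -> R -> R -> R) (x : R -> curve R d) (xs : 'I_d -> R -> R -> R).
Hypothesis mf : forall i, measurable_fun setT (uncurry2 (f i)).
Hypothesis lf : forall i t, locally_int (f i t).
Hypothesis pf : forall i t, periodic1 (f i t).
Hypothesis Kx : forall t, Lip1 (x t).
Hypothesis Hx : forall i t, AC_loc (cv (x t) i) (xs i t).
Hypothesis mxs : forall i t, measurable_fun setT (xs i t).
Hypothesis xs1 : forall t s, sqnorm (fun i => xs i t s) <= 1.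
Hypothesis normal_cone : forall t w, Lip1 w ->
  \sum_i \int[mu]_(s in `[0, 1]) (f i t s * (cv w i s - cv (x t) i s)) <= 0.

Definition load i t s : R := - primitive (f i t) s.

Lemma mft i t : measurable_fun setT (f i t).
Proof. exact: (measurableT_comp (mf i) (pair1_measurable t)). Qed.

Lemma load_AC i t : AC_loc (load i t) (fun s => - f i t s).
Proof.
move=> a b ab; have [fi e] := primitive_AC (lf i t) ab.
split; first by apply: eq_integrable (integrableZl _ (-1) fi) => // s _ /=; rewrite mulN1e.
transitivity (-1 * \int[mu]_(s in `[a, b]) f i t s); first by rewrite -e /load; ring.
by rewrite -RintegralZl//; apply: eq_Rintegral => s _; rewrite mulN1r.
Qed.

(** Translates of [x t] remain in [Lip1]; testing the cone with a shift by [c] in one coordinate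
    bounds c times the mean by 0 for both signs of c. This makes the primitive of the force
    periodic. *)
Lemma force_mean0 i t : \int[mu]_(s in `[0, 1]) f i t s = 0.
Proof.
have key (c : R) : c * \int[mu]_(s in `[0, 1]) f i t s <= 0.
  have cw j : continuous (fun s => cv (x t) j s + c * (j == i)%:R).
    by move=> s; apply: cvgD; [exact: curve_continuous|exact: cvg_cst].
  have Kw : Lip1 (mkcurve cw).
    split=> [j s|s s']; first by rewrite !mkcurveE (Kx t).1.
    apply: le_trans ((Kx t).2 s s'); rewrite le_eqVlt; apply/orP; left; apply/eqP.
    by apply: eq_bigr => j _; rewrite !mkcurveE; congr (_ ^+ 2); ring.
  have := normal_cone t Kw; rewrite (bigD1 i)//= big1 ?addr0 => [|j /negbTE ji].
    rewrite -RintegralZl//; last exact: lf.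
    suff -> : \int[mu]_(s in `[0, 1]) (f i t s * (cv (mkcurve cw) i s - cv (x t) i s)) =
      \int[mu]_(s in `[0, 1]) (c * f i t s) by [].
    by apply: eq_Rintegral => s _; rewrite mkcurveE eqxx /=; ring.
  transitivity (\int[mu]_(s in `[0, 1]) (0 : R)); last exact: Rintegral01_cst.
  apply: eq_Rintegral => s _.
  by rewrite mkcurveE ji /=; ring.
have := key 1; have := key (-1); move: (\int[mu]_(s in _) _) => I; lra.
Qed.

Lemma load_periodic i t : periodic1 (load i t).
Proof.
move=> s; have s1 : s <= s + 1 by lra.
have [_ e] := primitive_AC (lf i t) s1.
rewrite Rintegral_periodic// ?force_mean0 in e; last exact: mft.
by rewrite /load (subr0_eq e).
Qed.

Lemma load_continuous i t : continuous (load i t).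
Proof. exact: AC_continuous (load_AC i t). Qed.

Lemma measurable_load i : measurable_fun setT (uncurry2 (load i)).
Proof.
apply: measurable_caratheodory => [s|t]; last exact: load_continuous.
apply: measurableT_comp => //; apply: measurable_funB;
  apply: measurable_inner_Rintegral => //; exact: measurable_itv.
Qed.

Let md t q := mdist (fun i => load i t) 0 q.

Lemma measurable_mdist q : measurable_fun setT (md ^~ q).
Proof.
pose G t s := rnorm 0 (shifted (fun i => load i t) q s).
have mG : measurable_fun setT (uncurry2 G).
  apply: (measurableT_comp (continuous_measurable_fun (@sqrt_continuous R))).
  apply: measurable_funD => //; apply: measurable_sum => i.
  by apply: measurable_funX; apply: measurable_funB => //; exact: measurable_load.
by apply: (measurable_inner_Rintegral mG); exact: measurable_itv.
Qed.

(** An enumeration of a countable dense set; codes that decode to nothing give 0. *)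
Definition ratvec (j : nat) : 'rV[R]_d :=
  map_mx ratr (odflt 0 (unpickle j : option 'rV[rat]_d)).

Lemma ratvec_dense (q : 'rV[R]_d) (e : R) : 0 < e -> exists j, forall i, `|ratvec j 0 i - q 0 i| <= e.
Proof.
move=> e0; have h i : exists r : rat, `|ratr r - q 0 i| <= e.
  have lt : q 0 i - e < q 0 i + e by lra.
  have [r] := rat_in_itvoo lt; rewrite in_itv /= => rE.
  by exists r; rewrite ler_distl; lra.
have [g hg] := choice h.
exists (pickle (\row_i g i : 'rV[rat]_d)) => i.
by rewrite /ratvec pickleK /= !mxE.
Qed.

(* [best m t] minimizes the mean distance over the first [m] rational vectors and 0. *)
Fixpoint best (m : nat) (t : R) : 'rV[R]_d :=
  if m is k.+1 then if md t (ratvec k) < md t (best k t) then ratvec k else best k t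
  else 0.

Lemma measurable_best m : measurable_fun setT (fun t => md t (best m t)) /\
  forall i, measurable_fun setT (fun t => best m t 0 i).
Proof.
elim: m => [|m [mV mb]] /=; first by split => //; exact: measurable_mdist.
have mlt : measurable_fun setT (fun t => md t (ratvec m) < md t (best m t)).
  by apply: measurable_fun_ltr => //; exact: measurable_mdist.
split.
  rewrite (_ : (fun t => _) = fun t => if md t (ratvec m) < md t (best m t)
    then md t (ratvec m) else md t (best m t)).
    by apply: measurable_fun_ifT => //; exact: measurable_mdist.
  by apply/funext => t; case: ifP.
move=> i; rewrite (_ : (fun t => _) = fun t => if md t (ratvec m) < md t (best m t)
    then ratvec m 0 i else best m t 0 i).
  by apply: measurable_fun_ifT.
by apply/funext => t; case: ifP.
Qed.

Lemma best_le m j t : (j < m)%N -> md t (best m t) <= md t (ratvec j).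
Proof.
elim: m => // m IH; rewrite ltnS leq_eqVlt /= => /orP[/eqP ->|jm].
  by case: ltP => // /ltW.
by case: ltP => [h|_]; [apply: le_trans (ltW h) (IH jm)|exact: IH].
Qed.

Definition median t : 'rV[R]_d :=
  projT1 (cid (median_exists (load_AC^~ t) (load_periodic^~ t) (mft^~ t) (Kx t) (Hx^~ t) (mxs^~ t) (xs1 t) (normal_cone t))).

Lemma medianP t : md t (median t) = tension_mass (fun i => load i t) (fun i => xs i t).
Proof. by rewrite /median; case: cid. Qed.

(** Density of the rational vectors makes [best] a minimizing sequence, and [median_well_posed]
    turns almost minimal values into closeness to the median, which so inherits the measurability of
    [best]. *)
Lemma best_cvg i t : best m t 0 i @[m --> \oo] --> median t 0 i.
Proof.
apply/cvgrPdist_le => e e0.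
have [r r0 hr] := median_well_posed (load_AC^~ t) (Kx t) (Hx^~ t) (mxs^~ t) (xs1 t) (medianP t) e0.
have r'0 : 0 < r / (d%:R + 1) by rewrite divr_gt0// ltr_wpDl.
have [j hj] := ratvec_dense (median t) r'0.
exists j.+1 => // m /= jm.
rewrite distrC; have := coord_le_norm (best m t - median t) i.
rewrite !mxE => /le_trans; apply; apply: hr.
apply: (le_trans (best_le t jm)).
apply: (le_trans (mdist_lipschitz (load_continuous^~ t) 0 _ (median t))).
rewrite -/(md t (median t)) medianP lerD2l.
apply: (@le_trans _ _ (\sum_(i0 < d) r / (d%:R + 1))); first by apply: ler_sum => k _; exact: hj.
rewrite sumr_const card_ord -[leLHS]mulr_natr mulrAC ler_pdivrMr ?ltr_wpDl//.
by apply: ler_wpM2l; [exact: ltW|rewrite lerDl].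
Qed.

Lemma measurable_median i : measurable_fun setT (fun t => median t 0 i).
Proof.
apply: (@measurable_fun_cvg _ _ _ _ (fun m t => best m t 0 i)).
  by move=> m; exact: (measurable_best m).2.
by move=> t _; exact: best_cvg.
Qed.

Lemma load_le i t s : 0 <= s <= 1 ->
  `|load i t s| <= \int[mu]_(s in `[0, 1]) `|f i t s|.
Proof.
move=> /andP[s0 s1]; have [fi e] := primitive_AC (lf i t) s0.
rewrite primitive0 subr0 in e; rewrite /load normrN e.
apply: (le_trans (le_normr_Rintegral _ fi)) => //.
have fi1 := lf i t 0 1.
have fn1 : mu.-integrable `[0, 1] (EFin \o (fun s => `|f i t s|)) by exact: integrable_norm fi1.
have fn : mu.-integrable `[0, s] (EFin \o (fun s => `|f i t s|)) by exact: integrable_norm fi.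
rewrite -lee_fin EFin_Rintegral// EFin_Rintegral//.
apply: ge0_subset_integral => //; first exact: measurable_int fn1.
- by move=> z /=; rewrite !in_itv /= => /andP[-> zs]; exact: le_trans zs s1.
Qed.

(** [rho] is the load recentred at its median; [median_direction] then says that it points along
    [xs], with its own length as the tension. *)
Lemma tension_exists : exists rho : 'I_d -> R -> R -> R,
  [/\ forall i, measurable_fun setT (uncurry2 (rho i)),
      forall i t, periodic1 (rho i t),
      forall i t, AC_loc (rho i t) (fun s => - f i t s),
      forall t, {ae mu, forall s, [set` `[0, 1]] s ->
         forall i, rho i t s = vnorm (fun j => rho j t s) * xs i t s} &
      forall i t s, `|rho i t s| <= 3 * \sum_j \int[mu]_(u in `[0, 1]) `|f j t u|].
Proof.
exists (fun i t s => load i t s - median t 0 i); split.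
- move=> i; apply: measurable_funB; first exact: measurable_load.
  exact: (measurableT_comp (measurable_median i) measurable_fst).
- by move=> i t s; rewrite load_periodic.
- by move=> i t a b ab; have [? <-] := load_AC i t ab; split=> //; ring.
- move=> t; exact: (median_direction (load_AC^~ t) (Kx t) (Hx^~ t) (mxs^~ t) (xs1 t) (medianP t)).
move=> i t s; set M := \sum_j _.
have [u u01 ->] : exists2 u, 0 <= u <= 1 & load i t s = load i t u.
  exact: periodic1_unit (load_periodic i t).
have I0 j : 0 <= \int[mu]_(u in `[0, 1]) `|f j t u| by apply: Rintegral_ge0.
have M1 j : \int[mu]_(u in `[0, 1]) `|f j t u| <= M.
  by rewrite /M (bigD1 j)//= lerDl sumr_ge0.
have V1 : \int[mu]_(s in `[0, 1]) vnorm (fun i => load i t s) <= M.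
  rewrite -(Rintegral01_cst M); apply: le_Rintegral => //.
  - apply: continuous_itv_integrable => z; apply: continuous_cvg; first exact: sqrt_continuous.
    by apply: cvg_bigsum => j; apply: cvg_sqr; exact: load_continuous.
  - exact: integrable01_cst.
  move=> z /= z01; apply: (le_trans (vnorm_le_sum _)); apply: ler_sum => j _.
  by apply: load_le; move: z01; rewrite in_itv.
have md0 : md t 0 <= M.
  apply: le_trans V1; rewrite /md /mdist le_eqVlt; apply/orP; left; apply/eqP.
  apply: eq_Rintegral => z _; rewrite rnorm0; congr vnorm; apply/funext => j.
  by rewrite /shifted mxE subr0.
have mdc : md t (median t) <= M.
  apply: le_trans md0; rewrite medianP.
  exact: (tension_mass_le (load_AC^~ t) (Kx t) (Hx^~ t) (mxs^~ t) (xs1 t)).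
(* Coercivity bounds the median by the least mean distance plus the mean of |load|, each at most M;
   with the bound M on the load itself this gives the factor 3. *)
have := mdist_coercive (load_continuous^~ t) 0 (median t).
have := coord_le_norm (median t) i; have := le_trans (load_le i t u01) (M1 i).
have := ler_normB (load i t u) (median t 0 i).
by rewrite /md in mdc; lra.
Qed.

End StaticFamily.

(** * Velocity of the limit path *)

Section SquareIntegrable.
Variable R : realType.
Local Notation mu := (@lebesgue_measure R).
Implicit Types g z phi : R -> R.

Definition sqint g := measurable_fun setT g /\
  mu.-integrable `[0, 1] (EFin \o (fun s => g s ^+ 2)).

Lemma sqint_mul g z : sqint g -> sqint z -> mu.-integrable `[0, 1] (EFin \o (fun s => g s * z s)).
Proof.
move=> [mg ig] [mz iz].
have iD : mu.-integrable `[0, 1] (EFin \o (fun s => g s ^+ 2 + z s ^+ 2)).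
  by apply: eq_integrable (integrableD _ ig iz).
apply: (@le_integrable _ _ _ _ _ _ _ _ _ _ iD) => //.
- by apply/measurable_EFinP; apply: measurable_funTS; exact: measurable_funM.
- move=> s _ /=; rewrite lee_fin [leRHS]ger0_norm ?addr_ge0 ?sqr_ge0//.
  rewrite ler_norml; have := sqr_ge0 (g s - z s); have := sqr_ge0 (g s + z s).
  rewrite sqrrD sqrrB; have := sqr_ge0 (g s); have := sqr_ge0 (z s); lra.
Qed.

Lemma sqintD g z : sqint g -> sqint z -> sqint (fun s => g s + z s).
Proof.
move=> hg hz; have [mg ig] := hg; have [mz iz] := hz; split; first exact: measurable_funD.
have i2 : mu.-integrable `[0, 1] (EFin \o (fun s => 2 * (g s * z s))).
  by apply: eq_integrable (integrableZl _ 2 (sqint_mul hg hz)).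
have i1 : mu.-integrable `[0, 1] (EFin \o (fun s => g s ^+ 2 + 2 * (g s * z s))).
  by apply: eq_integrable (integrableD _ ig i2).
apply: eq_integrable (integrableD _ i1 iz) => // s _ /=.
by rewrite -!EFinD; congr EFin; ring.
Qed.

Lemma sqintZ c g : sqint g -> sqint (fun s => c * g s).
Proof.
move=> [mg ig]; split; first exact: measurable_funM.
apply: eq_integrable (integrableZl _ (c ^+ 2) ig) => // s _ /=.
by rewrite -EFinM exprMn.
Qed.

Lemma sqintB g z : sqint g -> sqint z -> sqint (fun s => g s - z s).
Proof.
move=> hg hz; have h := sqintD hg (sqintZ (-1) hz).
by rewrite (_ : (fun s => _) = (fun s => g s + -1 * z s))//; apply/funext => s; ring.
Qed.

Lemma continuous_sqint g : continuous g -> sqint g.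
Proof.
move=> cg; split; first exact: continuous_measurable_fun.
by apply: continuous_itv_integrable; exact: continuous_sqr.
Qed.

Lemma Rintegral_sqD g z c : sqint g -> sqint z ->
  \int[mu]_(s in `[0, 1]) (g s + c * z s) ^+ 2 =
  \int[mu]_(s in `[0, 1]) g s ^+ 2 + 2 * c * \int[mu]_(s in `[0, 1]) (g s * z s) +
  c ^+ 2 * \int[mu]_(s in `[0, 1]) z s ^+ 2.
Proof.
move=> hg hz; have ig := hg.2; have iz := hz.2; have igz := sqint_mul hg hz.
have i2 : mu.-integrable `[0, 1] (EFin \o (fun s => 2 * c * (g s * z s))).
  by apply: eq_integrable (integrableZl _ (2 * c) igz).
have i3 : mu.-integrable `[0, 1] (EFin \o (fun s => c ^+ 2 * z s ^+ 2)).
  by apply: eq_integrable (integrableZl _ (c ^+ 2) iz).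
have i1 : mu.-integrable `[0, 1] (EFin \o (fun s => g s ^+ 2 + 2 * c * (g s * z s))).
  by apply: eq_integrable (integrableD _ ig i2).
rewrite -(RintegralZl _ _ igz)// -(RintegralZl _ _ iz)//.
rewrite -(RintegralD _ ig i2)// -(RintegralD _ i1 i3)//.
by apply: eq_Rintegral => s _; ring.
Qed.

Lemma Rintegral_young g z (e : R) : sqint g -> sqint z -> 0 < e ->
  `|\int[mu]_(s in `[0, 1]) (g s * z s)| <=
  (e * \int[mu]_(s in `[0, 1]) z s ^+ 2 + e^-1 * \int[mu]_(s in `[0, 1]) g s ^+ 2) / 2.
Proof.
move=> hg hz e0; have e0' : e != 0 by rewrite gt_eqF.
have P c : 0 <= \int[mu]_(s in `[0, 1]) (g s + c * z s) ^+ 2.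
  by apply: Rintegral_ge0 => s _; exact: sqr_ge0.
have := P e; have := P (- e); rewrite !Rintegral_sqD// sqrrN.
set A := \int[mu]_(s in _) (g s ^+ 2); set B := \int[mu]_(s in _) (g s * z s).
set C := \int[mu]_(s in _) (z s ^+ 2) => h1 h2.
have -> : (e * C + e^-1 * A) / 2 = (A + e ^+ 2 * C) / (2 * e) by field.
rewrite ler_norml -mulNr !ler_pdivlMr ?ler_pdivrMr ?mulr_gt0//; apply/andP; split; lra.
Qed.

Lemma sqint_cvg_mul (u : nat -> R -> R) phi z : (forall k, sqint (u k)) -> sqint phi -> sqint z ->
  \int[mu]_(s in `[0, 1]) (u k s - phi s) ^+ 2 @[k --> \oo] --> 0 ->
  \int[mu]_(s in `[0, 1]) (u k s * z s) @[k --> \oo] --> \int[mu]_(s in `[0, 1]) (phi s * z s).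
Proof.
move=> hu hphi hz h0; apply/cvgrPdist_le => e e0.
set Z := \int[mu]_(s in `[0, 1]) z s ^+ 2.
have Z0 : 0 <= Z by apply: Rintegral_ge0 => s _; exact: sqr_ge0.
(* The Young weight: l Z <= e, and the other term is at most e once the squared distance is below e
   l. Half the sum is e. *)
pose l := e / (Z + 1).
have l0 : 0 < l by rewrite divr_gt0// ltr_wpDl.
have el0 : 0 < e * l by exact: mulr_gt0.
have /cvgrPdist_le /(_ _ el0) := h0; apply: filterS => k.
rewrite sub0r normrN ger0_norm; last by apply: Rintegral_ge0 => s _; exact: sqr_ge0.
move=> hk; have hB := sqintB (hu k) hphi.
have -> : \int[mu]_(s in `[0, 1]) (phi s * z s) - \int[mu]_(s in `[0, 1]) (u k s * z s) =
    - \int[mu]_(s in `[0, 1]) ((u k s - phi s) * z s).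
  have i1 := sqint_mul (hu k) hz; have i2 := sqint_mul hphi hz.
  have -> : \int[mu]_(s in `[0, 1]) ((u k s - phi s) * z s) =
      \int[mu]_(s in `[0, 1]) (u k s * z s - phi s * z s).
    by apply: eq_Rintegral => s _; rewrite mulrBl.
  by rewrite (RintegralB _ i1 i2)// opprB.
rewrite normrN; apply: (le_trans (Rintegral_young hB hz l0)).
have h1 : l * Z <= e.
  by rewrite /l mulrAC ler_pdivrMr ?ltr_wpDl// ler_wpM2l ?lerDl// ltW.
have h2 : l^-1 * \int[mu]_(s in `[0, 1]) (u k s - phi s) ^+ 2 <= e.
  by rewrite mulrC ler_pdivrMr.
by rewrite -/Z; lra.
Qed.

Lemma sqint_cvg_sqr (u : nat -> R -> R) phi : (forall k, sqint (u k)) -> sqint phi ->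
  \int[mu]_(s in `[0, 1]) (u k s - phi s) ^+ 2 @[k --> \oo] --> 0 ->
  \int[mu]_(s in `[0, 1]) (u k s ^+ 2) @[k --> \oo] --> \int[mu]_(s in `[0, 1]) (phi s ^+ 2).
Proof.
move=> hu hphi h0; have h1 := sqint_cvg_mul hu hphi hphi h0.
set P := \int[mu]_(s in `[0, 1]) (phi s ^+ 2).
have PE : \int[mu]_(s in `[0, 1]) (phi s * phi s) = P.
  by apply: eq_Rintegral => s _; rewrite expr2.
rewrite PE in h1.
have -> : (fun k => \int[mu]_(s in `[0, 1]) (u k s ^+ 2)) = fun k =>
    \int[mu]_(s in `[0, 1]) (u k s - phi s) ^+ 2 + 2 * \int[mu]_(s in `[0, 1]) (u k s * phi s) - P.
  apply/funext => k; have := Rintegral_sqD (-1) (hu k) hphi.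
  have -> : \int[mu]_(s in `[0, 1]) (u k s + -1 * phi s) ^+ 2 =
      \int[mu]_(s in `[0, 1]) (u k s - phi s) ^+ 2.
    by apply: eq_Rintegral => s _; rewrite mulN1r.
  by rewrite -/P; lra.
rewrite [X in _ --> X](_ : P = 0 + 2 * P - P); last by ring.
by apply: cvgB; [apply: cvgD => //; exact: cvgMr|exact: cvg_cst].
Qed.

Lemma sqint_of_approx g phi (C : R) : sqint g -> measurable_fun setT phi ->
  (\int[mu]_(s in `[0%R, 1%R]) ((g s - phi s) ^+ 2)%:E <= C%:E)%E ->
  sqint phi /\ \int[mu]_(s in `[0, 1]) (g s - phi s) ^+ 2 <= C.
Proof.
move=> hg mphi hC; have mB : measurable_fun setT (fun s => g s - phi s).
  exact: measurable_funB hg.1 mphi.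
have iB : mu.-integrable `[0, 1] (EFin \o (fun s => (g s - phi s) ^+ 2)).
  apply/integrableP; split.
    by apply/measurable_EFinP; apply: measurable_funTS; exact: measurable_funX.
  apply: le_lt_trans (ltry C); apply: le_trans hC.
  by rewrite le_eqVlt; apply/orP; left; apply/eqP; apply: eq_integral => s _ /=;
    rewrite ger0_norm ?sqr_ge0.
split; last by rewrite -lee_fin EFin_Rintegral.
have := sqintB hg (conj mB iB).
by rewrite (_ : (fun s => g s - _) = phi)//; apply/funext => s; ring.
Qed.

End SquareIntegrable.

(** * Regularity of the limit path and its velocity *)

Section CompressingPath.
Variables (R : realType) (d : nat).
Local Notation mu := (@lebesgue_measure R).
Local Notation W := (@window R).
Local Notation nrm := (seminorm (@cdot R d)).
Local Notation h := (@dyadic_step R).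
Variable X : R -> curve R d.
Hypothesis KX : forall t, Lip1 (X t).
Hypothesis X_neg : forall t, t <= 0 -> X t = X 0.
Hypothesis X_evi : forall a b w, 0 <= a <= b -> Lip1 w ->
  nrm (X b - w) <= nrm (expR (b - a) *: X a - w).
Hypothesis X_energy : forall a b, 0 <= a <= b ->
  nrm (X b - X a) ^+ 2 <= (b - a) / 2 * (nrm (X b) ^+ 2 - nrm (X a) ^+ 2).
Hypothesis X_lip : forall a b, 0 <= a <= b ->
  nrm (X b - X a) <= (expR (b - a) - 1) * nrm (X a).

Let ipC := @cdotC R d.
Let ipDl := @cdotDl R d.
Let ipZl := @cdotZl R d.
Let ip0 := @cdot_ge0 R d.
Let nrm0le (x : curve R d) : 0 <= nrm x := nrm_ge0 (@cdot R d) x.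

Lemma path_norm t : 0 <= t -> nrm (X t) <= expR t * nrm (X 0).
Proof.
move=> t0; have h0 : 0 <= (0 : R) <= t by rewrite lexx.
have := X_evi h0 (@Lip1_0 R d); rewrite !subr0 (nrmZ ipC ipZl).
by rewrite ger0_norm ?expR_ge0.
Qed.

(** A Lipschitz constant up to time [T] for increments of length at most 1: the growth bound e^T |X
    0| times the e of e^a - 1 <= a e for a in [0, 1]. *)
Definition path_speed (T : R) := expR 1 * (expR T * nrm (X 0)).

Lemma path_speed_ge0 T : 0 <= path_speed T.
Proof. by rewrite !mulr_ge0 ?expR_ge0. Qed.

Lemma path_modulus (T s t : R) : 0 <= T -> s <= T -> t <= T -> `|s - t| <= 1 ->
  nrm (X s - X t) <= `|s - t| * path_speed T.
Proof.
wlog ts : s t / t <= s.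
  move=> W0 T0 sT tT st1; have [ts|/ltW st] := leP t s; first exact: W0.
  by rewrite (nrm_distC ipC ipZl) distrC; apply: W0 => //; rewrite distrC.
move=> T0 sT tT; rewrite ger0_norm ?subr_ge0// => st1.
have E (a : R) : 0 <= a <= 1 -> expR a - 1 <= a * expR 1.
  move=> /andP[a0 a1]; have h1 := expR_ge1Dx (- a); have h2 := expRxMexpNx_1 a.
  have h3 : expR a <= expR 1 by rewrite ler_expR.
  have := expR_gt0 a; move: (expR a) (expR (- a)) (expR 1) h1 h2 h3 => p q r *; nra.
have [s0|s0] := leP s 0.
  rewrite (X_neg s0) X_neg ?(le_trans ts)// subrr (nrm0 ipC ipZl).
  by rewrite mulr_ge0 ?path_speed_ge0 ?subr_ge0.
pose a := Num.max 0 t.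
have Xt : X t = X a.
  by rewrite /a; case: (leP 0 t) => // t0; rewrite X_neg// ltW.
have a0 : 0 <= a by rewrite le_max lexx.
have as_ : a <= s by rewrite /a ge_max (ltW s0).
have aT : a <= T by rewrite /a ge_max T0.
have sa : s - a <= s - t by rewrite lerD2l lerN2 le_max lexx orbT.
have a01 : 0 <= s - a <= 1 by rewrite subr_ge0 as_ (le_trans sa).
have a0s : 0 <= a <= s by rewrite a0.
rewrite Xt; apply: (le_trans (X_lip a0s)).
apply: (@le_trans _ _ ((s - a) * expR 1 * (expR T * nrm (X 0)))).
  apply: ler_pM; [|exact: nrm0le|exact: E|].
    by rewrite subr_ge0 -expR0 ler_expR; case/andP: a01.
  apply: (le_trans (path_norm a0)); apply: ler_wpM2r => //; by rewrite ler_expR.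
rewrite -mulrA; apply: ler_wpM2r => //; exact: path_speed_ge0.
Qed.

Lemma path_continuous i s : continuous (fun t => cv (X t) i s).
Proof.
move=> t; apply/cvgrPdist_le => e0 e00.
pose e := Num.min e0 1.
have e_gt0 : 0 < e by rewrite lt_min e00 ltr01.
have e1 : e <= 1 by rewrite ge_min lexx orbT.
pose L := path_speed (`|t| + 1).
have L0 : 0 <= L := path_speed_ge0 _.
(* Makes the seminorm smaller than e^2 / 4; its square e^4 / 16 is at most the e^3 / 16 required by
   [Lip1_sup]. *)
pose r := e ^+ 2 / (4 * (L + 1)).
have r0 : 0 < r by rewrite divr_gt0 ?exprn_gt0 ?mulr_gt0// ltr_wpDl.
have r1 : r <= 1.
  rewrite ler_pdivrMr ?mulr_gt0 ?ltr_wpDl// mul1r.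
  by apply: (@le_trans _ _ 1); [rewrite exprn_ile1// ltW|lra].
have : \forall u \near t, `|t - u| < r.
  by apply/nbhs_ballP; exists r => //= u; rewrite /ball /=.
apply: filterS => u tu; apply: (@le_trans _ _ e); last by rewrite ge_min lexx.
apply: (Lip1_sup (KX t) (KX u)); first by rewrite e_gt0.
have tT : t <= `|t| + 1 by have := ler_norm t; lra.
have uT : u <= `|t| + 1.
  by have := ler_norm t; move: tu; rewrite ltr_distlC; lra.
have T0 : 0 <= `|t| + 1 by rewrite addr_ge0.
have M := path_modulus T0 tT uT (le_trans (ltW tu) r1).
have M2 : nrm (X t - X u) < e ^+ 2 / 4.
  apply: (le_lt_trans M); apply: (@le_lt_trans _ _ (r * L)).
    by apply: ler_wpM2r => //; exact: ltW.
  rewrite /r mulrAC ltr_pdivrMr ?mulr_gt0 ?ltr_wpDl//.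
  have -> : e ^+ 2 / 4 * (4 * (L + 1)) = e ^+ 2 * (L + 1) by field.
  by rewrite ltr_pM2l ?exprn_gt0//; lra.
apply: (@lt_le_trans _ _ ((e ^+ 2 / 4) ^+ 2)).
  by rewrite ltr_pXn2r ?nnegrE ?divr_ge0 ?sqr_ge0.
have -> : (e ^+ 2 / 4) ^+ 2 = e ^+ 3 * e / 16 by field.
rewrite ler_pM2r ?invr_gt0// ger_pMr ?exprn_gt0//.
Qed.

Definition pos (i : 'I_d) (t s : R) : R := cv (X t) i s.

Lemma measurable_pos i : measurable_fun setT (uncurry2 (pos i)).
Proof.
apply: measurable_caratheodory => [s|t]; last exact: curve_continuous.
by apply: continuous_measurable_fun; exact: path_continuous.
Qed.

Lemma measurable_pos_swap i : measurable_fun setT (uncurry2 (fun s t => pos i t s)).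
Proof.
apply: measurable_caratheodory => [t|s]; last exact: path_continuous.
by apply: continuous_measurable_fun; exact: curve_continuous.
Qed.

Lemma integral_window_cst N (C : R) : (\int[mu]_(x in W N) cst C%:E x)%E = (C * (2 * N%:R))%:E.
Proof.
rewrite integral_cst; last exact: measurable_window.
by rewrite EFinM; congr (_ * _)%E; exact: mu_window.
Qed.

Lemma integral_window_le N (f : R -> \bar R) (C : R) : measurable_fun setT f ->
  (forall x, 0 <= f x)%E -> (forall x, window N x -> f x <= C%:E)%E ->
  (\int[mu]_(x in W N) f x <= (C * (2 * N%:R))%:E)%E.
Proof.
move=> mf f0 fC; rewrite -integral_window_cst; apply: ge0_le_integral => //.
- exact: measurable_window.
- exact: measurable_funTS.
Qed.

Lemma sum_window_le N (F : 'I_d -> R -> \bar R) (C : R) :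
  (forall i, measurable_fun setT (F i)) ->
  (forall i x, 0 <= F i x)%E -> (forall i x, window N x -> F i x <= C%:E)%E ->
  (\sum_i \int[mu]_(x in W N) F i x <= (d%:R * (C * (2 * N%:R)))%:E)%E.
Proof.
move=> mF F0 FC; apply: (@le_trans _ _ (\sum_(i < d) (C * (2 * N%:R))%:E)%E).
  by apply: lee_sum => i _; apply: integral_window_le => //; exact: FC.
by rewrite sumEFin sumr_const card_ord lee_fin -[leLHS]mulr_natl.
Qed.

Lemma space_dq_energy N : exists C : R, forall n, (dq_energy pos N n <= C%:E)%E.
Proof.
eexists => n; apply: (@sum_window_le _ _ (1 * (2 * N%:R))).
- move=> i; apply: (@measurable_inner_integral _ (fun z : R * R => ((diff_quot (pos i z.1) n z.2) ^+ 2)%:E)).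
  + apply/measurable_EFinP; apply: measurable_funX.
    exact: measurable_diff_quot (measurable_pos i).
  + by move=> z; rewrite lee_fin sqr_ge0.
  + exact: measurable_window.
- by move=> i t; apply: integral_ge0 => s _; rewrite lee_fin sqr_ge0.
- move=> i t _; apply: integral_window_le.
  + apply/measurable_EFinP; apply: measurable_funX; apply: measurable_diff_quot1.
    exact: curve_continuous.
  + by move=> s; rewrite lee_fin sqr_ge0.
  + move=> s _; rewrite lee_fin /diff_quot -real_normK ?num_real// exprn_ile1//.
    rewrite normrM normfV (gtr0_norm (dyadic_step_gt0 R n)).
    rewrite ler_pdivrMr ?dyadic_step_gt0// mul1r.
    have := Lip1_comp i (cell_left n s + h n) (cell_left n s) (KX t).
    by rewrite addrAC subrr add0r (gtr0_norm (dyadic_step_gt0 R n)).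
Qed.

Lemma comp_nrm_le (x : curve R d) i :
  (\int[mu]_(s in `[0%R, 1%R]) ((cv x i s) ^+ 2)%:E <= (nrm x ^+ 2)%:E)%E.
Proof.
rewrite (nrmE ipC ip0) /cdot EFin_Rintegral//; last exact: dotp_integrable.
apply: ge0_le_integral => //.
- by move=> s _; rewrite lee_fin sqr_ge0.
- apply: measurable_funTS; apply/measurable_EFinP; apply: measurable_funX.
  by apply: continuous_measurable_fun; exact: curve_continuous.
- apply: measurable_funTS; apply/measurable_EFinP.
  by apply: continuous_measurable_fun; exact: dotp_continuous.
- by move=> s _; rewrite lee_fin dotpp; exact: (sqnorm_le_comp (fun i => cv x i s)).
Qed.

Lemma dyadic_step_le1 n : h n <= 1.
Proof. by rewrite exprn_ile1//; lra. Qed.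

(** The roles are exchanged: space is the parameter and time the variable. For fixed time the
    quotient is bounded in L^2 over one period by the speed, so Tonelli integrates space first and
    periodicity extends the bound to the window. *)
Lemma time_dq_energy N : exists C : R,
  forall n, (dq_energy (fun i s t => pos i t s) N n <= C%:E)%E.
Proof.
(* The right end of a cell meeting the window may exceed N by a step, which is at most 1. *)
pose L := path_speed (N%:R + 1).
eexists => n; rewrite /dq_energy.
have mdq i : measurable_fun setT (fun z : R * R => ((diff_quot (pos i ^~ z.1) n z.2) ^+ 2)%:E).
  apply/measurable_EFinP; apply: measurable_funX.
  exact: (measurable_diff_quot n (measurable_pos_swap i)).
have msw : measurable_fun setT (fun z : R * R => (z.2, z.1)).
  by apply/measurable_fun_pairP; split => /=; [exact: measurable_snd|exact: measurable_fst].
have mdqs i : measurable_fun setT (fun z : R * R => ((diff_quot (pos i ^~ z.2) n z.1) ^+ 2)%:E).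
  exact: (measurableT_comp (mdq i) msw).
under eq_bigr => i _ do rewrite (integral_swap (mdq i)
  (fun z => lee_tofin (sqr_ge0 _)) (@measurable_window R N) (@measurable_window R N)) /=.
apply: (@sum_window_le _ _ (L ^+ 2 * (2 * N%:R))).
- move=> i; apply: (measurable_inner_integral (mdqs i)); last exact: measurable_window.
  by move=> z; rewrite lee_fin sqr_ge0.
- by move=> i t; apply: integral_ge0 => s _; rewrite lee_fin sqr_ge0.
move=> i t; rewrite /window /= in_itv /= => /andP[_ tN].
apply: (le_trans (ge0_periodic_window N _ _ _)).
- exact: (measurableT_comp (mdqs i) (pair1_measurable t)).
- by move=> s; rewrite lee_fin sqr_ge0.
- by move=> s; rewrite /diff_quot /pos !(KX _).1.
rewrite [leRHS]EFinM; apply: lee_wpmul2r; first by rewrite lee_fin mulr_ge0.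
have hn := dyadic_step_gt0 R n.
pose l := cell_left n t.
pose D := (h n)^-1 *: (X (l + h n) - X l).
have -> : (\int[mu]_(s in `[0%R, 1%R]) ((diff_quot (pos i ^~ s) n t) ^+ 2)%:E =
   \int[mu]_(s in `[0%R, 1%R]) ((cv D i s) ^+ 2)%:E)%E.
  by apply: eq_integral => s _; rewrite /diff_quot /D curveZ curveB mulrC.
apply: (le_trans (comp_nrm_le _ _)); rewrite lee_fin ler_pXn2r ?nnegrE ?path_speed_ge0//.
rewrite /D (nrmZ ipC ipZl) normfV (gtr0_norm hn) ler_pdivrMl//.
have /andP[l1 l2] := cell_left_itv n t; have h1 := dyadic_step_le1 n.
have e : `|l + h n - l| = h n by rewrite addrAC subrr add0r gtr0_norm.
rewrite -[X in X * L]e; apply: path_modulus; rewrite ?e//.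
- by rewrite lerD// (le_trans l1)// ltW.
- by apply: (le_trans l1); rewrite ltW// (lt_trans tN)// ltrDl.
Qed.

Lemma squeeze0 (u b : nat -> R) : (\forall k \near \oo, `|u k| <= b k) ->
  b k @[k --> \oo] --> 0 -> u k @[k --> \oo] --> 0.
Proof.
move=> ub b0; apply: norm_cvg0; apply: (@squeeze_cvgr _ _ _ _ (cst 0) b) => //.
  by apply: filterS ub => k /= ->; rewrite andbT.
exact: cvg_cst.
Qed.

Lemma path_cvg (a : nat -> R) t : a k @[k --> \oo] --> t ->
  nrm (X (a k) - X t) @[k --> \oo] --> 0.
Proof.
move=> at_; pose T := `|t| + 1.
have tT : t <= T by have := ler_norm t; rewrite /T; lra.
have T0 : 0 <= T by rewrite addr_ge0.
apply: (@squeeze0 _ (fun k => `|a k - t| * path_speed T)).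
  have /cvgrPdist_le /(_ 1 ltr01) := at_; apply: filterS => k hk.
  rewrite ger0_norm//; rewrite distrC in hk; apply: path_modulus => //.
  by move: hk; rewrite ler_distl /T; have := ler_norm t; lra.
rewrite -(mul0r (path_speed T)); apply: cvgMl.
by apply/norm_cvg0P; exact/subr_cvg0.
Qed.

Lemma cdot_norm_le (p q : curve R d) : `|cdot p q| <= nrm p * nrm q.
Proof.
rewrite ler_norml (ip_le ipC ipDl ipZl ip0) andbT lerNl -(ipNl ipZl) -(nrmN ipC ipZl p).
exact: (ip_le ipC ipDl ipZl ip0).
Qed.

Lemma cdot_cvg (u v : nat -> curve R d) x y :
  nrm (u k - x) @[k --> \oo] --> 0 -> nrm (v k - y) @[k --> \oo] --> 0 ->
  cdot (u k) (v k) @[k --> \oo] --> cdot x y.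
Proof.
move=> ux vy; apply/subr_cvg0.
apply: (@squeeze0 _ (fun k => nrm (u k - x) * (nrm y + nrm (v k - y)) + nrm x * nrm (v k - y))).
  apply: nearW => k.
  have -> : cdot (u k) (v k) - cdot x y = cdot (u k - x) (v k) + cdot x (v k - y).
    by rewrite !(ipE ipC ipDl ipZl); ring.
  apply: (le_trans (ler_normD _ _)); apply: lerD; last exact: cdot_norm_le.
  apply: (le_trans (cdot_norm_le _ _)); apply: ler_wpM2l => //.
  have := nrmD ipC ipDl ipZl ip0 y (v k - y).
  by rewrite addrC subrK addrC.
rewrite [X in _ --> X](_ : 0 = 0 * (nrm y + 0) + nrm x * 0); last by ring.
apply: cvgD; last exact: cvgMr.
by apply: cvgM => //; apply: cvgD => //; exact: cvg_cst.
Qed.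

Lemma cdot_sum (x y : curve R d) :
  cdot x y = \sum_i \int[mu]_(s in `[0, 1]) (cv x i s * cv y i s).
Proof.
rewrite -Rintegral_bigsum// => i; apply: continuous_itv_integrable => s.
by apply: cvgM; exact: curve_continuous.
Qed.

Lemma cdot_first_order (z y w : curve R d) (e : R) : 0 < e ->
  cdot (y - w) (y - w) <= cdot (e *: z + (y - w)) (e *: z + (y - w)) ->
  2 * cdot z (w - y) <= e * cdot z z.
Proof.
move=> e0 E; rewrite -(ler_pM2l e0); move: E; rewrite !(ipE ipC ipDl ipZl).
by rewrite (ipC y z) (ipC w z) (ipC y w); lra.
Qed.

Section Velocity.
Variables (nk : nat -> nat) (t : R) (phi : 'I_d -> R -> R) (C : R).
Hypothesis nk_ge : forall k, (k <= nk k)%N.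
Hypothesis t0 : 0 < t.
Hypothesis mphi : forall i, measurable_fun setT (phi i).
Hypothesis phi_approx : forall i k,
  (\int[mu]_(s in W 2) ((diff_quot (pos i ^~ s) (nk k) t - phi i s) ^+ 2)%:E <=
   (C * (9 / 16) ^+ k)%:E)%E.

Let hk k : R := h (nk k).
Let a k : R := cell_left (nk k) t.
Let b k : R := a k + hk k.
Let D k : curve R d := (hk k)^-1 *: (X (b k) - X (a k)).
Let hk0 k : 0 < hk k. Proof. exact: dyadic_step_gt0. Qed.

Let nkoo : nk k @[k --> \oo] --> \oo.
Proof. by move=> A [M _ HA]; exists M => // k /= Mk; apply: HA; exact: leq_trans (nk_ge k). Qed.
Let hk_cvg : hk k @[k --> \oo] --> 0.
Proof. exact: cvg_comp nkoo (@cvg_dyadic_step R). Qed.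
Let a_cvg : a k @[k --> \oo] --> t.
Proof. exact: cvg_comp nkoo (@cvg_cell_left R t). Qed.
Let b_cvg : b k @[k --> \oo] --> t.
Proof. exact: cvg_comp nkoo (@cvg_cell_right R t). Qed.
Let a_pos : \forall k \near \oo, 0 <= a k.
Proof.
have H : \forall k \near \oo, 0 < a k by exact: (cvgr_gt t a_cvg).
by apply: filterS H => k /ltW.
Qed.

Let DE i k s : cv (D k) i s = diff_quot (pos i ^~ s) (nk k) t.
Proof. by rewrite /D curveZ curveB mulrC. Qed.

Let D_close i k : sqint (phi i) /\
  \int[mu]_(s in `[0, 1]) (cv (D k) i s - phi i s) ^+ 2 <= C * (9 / 16) ^+ k.
Proof.
apply: sqint_of_approx => //; first exact/continuous_sqint/curve_continuous.
have mD : measurable_fun setT (fun s => ((diff_quot (pos i ^~ s) (nk k) t - phi i s) ^+ 2)%:E).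
  apply/measurable_EFinP; apply: measurable_funX; apply: measurable_funB => //.
  have := continuous_measurable_fun (@curve_continuous R d (D k) i).
  by congr measurable_fun; apply/funext => s; rewrite DE.
apply: le_trans (phi_approx i k); under eq_integral do rewrite DE.
(* The window of index 2 is the smallest containing the closed interval [0, 1]. *)
apply: ge0_subset_integral => //.
- exact: measurable_window.
- exact: measurable_funTS.
- by move=> s _; rewrite lee_fin sqr_ge0.
- by move=> s; rewrite /window /= !in_itv /=; lra.
Qed.

Lemma velocity_sqint i : sqint (phi i).
Proof. exact: (D_close i 0).1. Qed.

Let D_L2 i : \int[mu]_(s in `[0, 1]) (cv (D k) i s - phi i s) ^+ 2 @[k --> \oo] --> 0.
Proof.
apply: (@squeeze0 _ (fun k => C * (9 / 16) ^+ k)).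
  apply: nearW => k; rewrite ger0_norm ?(D_close i k).2//.
  by apply: Rintegral_ge0 => s _; exact: sqr_ge0.
rewrite -(mulr0 C); apply: cvgMr; apply: cvg_expr; rewrite ger0_norm//; lra.
Qed.

Let D_sqint k i : sqint (cv (D k) i).
Proof. exact/continuous_sqint/curve_continuous. Qed.

Let D_cdot (z : curve R d) :
  cdot (D k) z @[k --> \oo] --> \sum_i \int[mu]_(s in `[0, 1]) (phi i s * cv z i s).
Proof.
rewrite (_ : (fun k => _) = fun k => \sum_i \int[mu]_(s in `[0, 1]) (cv (D k) i s * cv z i s)).
  apply: cvg_bigsum => i; apply: (sqint_cvg_mul (D_sqint^~ i)) => //.
  - exact: velocity_sqint.
  - exact/continuous_sqint/curve_continuous.
by apply/funext => k; rewrite cdot_sum.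
Qed.

Let D_nrm : nrm (D k) ^+ 2 @[k --> \oo] --> \sum_i \int[mu]_(s in `[0, 1]) (phi i s ^+ 2).
Proof.
rewrite (_ : (fun k => _) = fun k => \sum_i \int[mu]_(s in `[0, 1]) (cv (D k) i s ^+ 2)).
  apply: cvg_bigsum => i; apply: (sqint_cvg_sqr (D_sqint^~ i)) => //.
  exact: velocity_sqint.
apply/funext => k; rewrite (nrmE ipC ip0) cdot_sum; apply: eq_bigr => i _.
by apply: eq_Rintegral => s _; rewrite expr2.
Qed.

Let D_small (z : nat -> curve R d) : nrm (z k) @[k --> \oo] --> 0 ->
  cdot (D k) (z k) @[k --> \oo] --> 0.
Proof.
move=> z0; apply: (@squeeze0 _ (fun k => (1 + nrm (D k) ^+ 2) * nrm (z k))).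
  apply: nearW => k.
  apply: (le_trans (cdot_norm_le _ _)); apply: ler_wpM2r => //.
  by have := sqr_ge0 (nrm (D k) - 1); rewrite sqrrB; have := sqr_ge0 (nrm (D k)); lra.
rewrite -(mulr0 (1 + \sum_i \int[mu]_(s in `[0, 1]) (phi i s ^+ 2))).
by apply: cvgM => //; apply: cvgD => //; exact: cvg_cst.
Qed.

(** Divided by h^2, the energy inequality on the cell reads |D|^2 <= <D, (X a + X b) / 2>. Both
    sides converge because D tends to the velocity strongly in L^2. *)
Lemma velocity_energy : \sum_i \int[mu]_(s in `[0, 1]) (phi i s ^+ 2) <=
  \sum_i \int[mu]_(s in `[0, 1]) (phi i s * pos i t s).
Proof.
have zc : nrm (2^-1 *: ((X (b k) - X t) + (X (a k) - X t))) @[k --> \oo] --> 0.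
  apply: (@squeeze0 _ (fun k => nrm (X (b k) - X t) + nrm (X (a k) - X t))).
    apply: nearW => k; rewrite (nrmZ ipC ipZl) ger0_norm ?mulr_ge0//.
    apply: le_trans (nrmD ipC ipDl ipZl ip0 (X (b k) - X t) (X (a k) - X t)).
    by rewrite ler_piMl// ger0_norm//; lra.
  by rewrite -(addr0 0); apply: cvgD; exact: path_cvg.
have h2 : cdot (D k) (X t) + cdot (D k) (2^-1 *: ((X (b k) - X t) + (X (a k) - X t)))
    @[k --> \oo] --> \sum_i \int[mu]_(s in `[0, 1]) (phi i s * pos i t s).
  by rewrite -[X in _ --> X]addr0; apply: cvgD; [exact: D_cdot|exact: D_small].
apply: (ler_cvg_to D_nrm h2); apply: filterS a_pos => k ak /=.
have ab : 0 <= a k <= b k by rewrite ak lerDl ltW.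
have := X_energy ab; rewrite addrAC subrr add0r => E.
have hp := hk0 k.
rewrite /D (nrmZ ipC ipZl) normfV (gtr0_norm hp) exprMn !(ipE ipC ipDl ipZl).
rewrite -(ler_pM2l (exprn_gt0 2 hp)) mulrA -exprMn divff ?gt_eqF// expr1n mul1r.
apply: (le_trans E); rewrite !(nrmE ipC ip0).
rewrite le_eqVlt; apply/orP; left; apply/eqP.
rewrite (ipC (X (a k)) (X (b k))); field; by rewrite gt_eqF.
Qed.

(** On the cell, e^h X a - w = h Z + (X b - w) with Z tending to X t minus the velocity. Expanding
    the squares in [X_evi] and dividing by h leaves 2 <Z, w - X b> <= h |Z|^2, whose right side
    vanishes in the limit. *)
Lemma velocity_normal_cone (w : curve R d) : Lip1 w ->
  \sum_i \int[mu]_(s in `[0, 1]) ((pos i t s - phi i s) * (cv w i s - pos i t s)) <= 0.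
Proof.
move=> Kw; pose al k := (expR (hk k) - 1) / hk k.
have al_cvg : al k @[k --> \oo] --> (1 : R).
  apply/subr_cvg0; apply: (@squeeze0 _ (fun k => 2 * hk k)); last first.
    by rewrite -(mulr0 2); exact: cvgMr.
  have half : 0 < (2^-1 : R) by lra.
  have H : \forall k \near \oo, hk k <= 2^-1 by exact: (cvgr_le 0 hk_cvg).
  apply: filterS H => k hk2.
  have hp := hk0 k; have := @expR_sub1_le R (hk k); rewrite (ltW hp) hk2 => /(_ isT) h1.
  have -> : al k - 1 = (expR (hk k) - 1 - hk k) / hk k by rewrite /al; field; rewrite gt_eqF.
  rewrite normrM normfV (gtr0_norm hp) ler_pdivrMr// ler_norml; move: h1.
  rewrite expr2; have := mulr_gt0 hp hp; lra.
pose Z k := al k *: X (a k) - D k.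
have Zn : hk k * nrm (Z k) ^+ 2 @[k --> \oo] --> 0.
  (* The factor multiplying 0 is the limit of |Z|^2, so convergence can be read off factor by
     factor. *)
  rewrite -(mul0r (1 ^+ 2 * cdot (X t) (X t) - 2 * 1 * (\sum_i \int[mu]_(s in `[0, 1]) (phi i s * cv (X t) i s) + 0) + \sum_i \int[mu]_(s in `[0, 1]) (phi i s ^+ 2))).
  rewrite (_ : (fun k => _) = fun k => hk k * (al k ^+ 2 * cdot (X (a k)) (X (a k)) - 2 * al k * (cdot (D k) (X t) + cdot (D k) (X (a k) - X t)) + nrm (D k) ^+ 2)); last first.
    apply/funext => k; congr (_ * _); rewrite !(nrmE ipC ip0) /Z !(ipE ipC ipDl ipZl).
    by rewrite (ipC (X (b k)) (X (a k))); ring.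
  apply: cvgM => //; apply: cvgD => //; apply: cvgB.
    by apply: cvgM; [exact: cvg_sqr|apply: cdot_cvg; exact: path_cvg].
  apply: cvgM; first exact: cvgMr.
  by apply: cvgD; [exact: D_cdot|apply: D_small; exact: path_cvg].
have Zw : 2 * (al k * cdot (X (a k)) (w - X (b k)) -
    (cdot (D k) (w - X t) + cdot (D k) (X t - X (b k)))) @[k --> \oo] -->
    2 * (1 * cdot (X t) (w - X t) -
    (\sum_i \int[mu]_(s in `[0, 1]) (phi i s * cv (w - X t) i s) + 0)).
  apply: cvgMr; apply: cvgB.
    apply: cvgM => //; apply: cdot_cvg; first exact: path_cvg.
    rewrite (_ : (fun k => _) = fun k => nrm (X (b k) - X t)); first exact: path_cvg.
    by apply/funext => k; rewrite opprB addrC subrKA (nrm_distC ipC ipZl).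
  apply: cvgD; first exact: D_cdot.
  apply: D_small; rewrite (_ : (fun k => _) = fun k => nrm (X (b k) - X t)); first exact: path_cvg.
  by apply/funext => k; rewrite (nrm_distC ipC ipZl).
have := ler_cvg_to Zw Zn; rewrite mul1r addr0 => H.
have : 2 * (cdot (X t) (w - X t) -
    \sum_i \int[mu]_(s in `[0, 1]) (phi i s * cv (w - X t) i s)) <= 0.
  apply: H; apply: filterS a_pos => k ak.
  have ab : 0 <= a k <= b k by rewrite ak lerDl ltW.
  have hp := hk0 k.
  have := X_evi ab Kw; rewrite addrAC subrr add0r (le_nrm ipC ip0) (nrmE ipC ip0).
  have -> : expR (hk k) *: X (a k) - w = hk k *: Z k + (X (b k) - w).
    rewrite /Z /D /al scalerBr !scalerA mulrA divff ?gt_eqF// scale1r.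
    by rewrite mulrAC divff ?gt_eqF// mul1r scalerBl scale1r opprB -addrA !subrKA.
  move=> /(cdot_first_order hp).
  have e1 : cdot (Z k) (w - X (b k)) = al k * cdot (X (a k)) (w - X (b k)) -
    (cdot (D k) (w - X t) + cdot (D k) (X t - X (b k))).
    by rewrite /Z !(ipE ipC ipDl ipZl); ring.
  by rewrite e1.
rewrite cdot_sum -sumrB pmulr_rle0//; congr (_ <= _); apply: eq_bigr => i _.
have iX : mu.-integrable `[0, 1] (EFin \o (fun s => cv (X t) i s * cv (w - X t) i s)).
  by apply: continuous_itv_integrable => s; apply: cvgM; exact: curve_continuous.
have iP : mu.-integrable `[0, 1] (EFin \o (fun s => phi i s * cv (w - X t) i s)).
  by apply: sqint_mul; [exact: velocity_sqint|exact/continuous_sqint/curve_continuous].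
rewrite -(RintegralB _ iX iP)//; apply: eq_Rintegral => s _.
by rewrite -mulrBl.
Qed.

End Velocity.

End CompressingPath.

(** * Construction of the solution *)

Section NormOfCurve.
Variables (R : realType) (d : nat).
Local Notation mu := (@lebesgue_measure R).
Local Notation W := (@window R).
Local Notation h := (@dyadic_step R).

Lemma vnormB_le (v w : 'I_d -> R) : `|vnorm v - vnorm w| <= vnorm (fun i => v i - w i).
Proof.
have tri (x y : 'I_d -> R) : vnorm x <= vnorm y + vnorm (fun i => x i - y i).
  have := rnormD 0 y (fun i => x i - y i); rewrite !rnorm0.
  by rewrite (_ : (fun i => y i + _) = x)//; apply/funext => i; ring.
have := tri w v; rewrite -(vnormN (fun i => w i - v i)).
rewrite (_ : (fun i => - _) = fun i => v i - w i); last by apply/funext => i; rewrite opprB.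
by rewrite ler_norml; have := tri v w; lra.
Qed.

Lemma Rintegral_sqr_le (f : R -> R) (l r : R) : l < r -> measurable_fun setT f ->
  mu.-integrable `[l, r] (EFin \o f) ->
  (((\int[mu]_(x in `[l, r]) f x) ^+ 2 / (r - l))%:E <= \int[mu]_(x in `[l, r]) ((f x) ^+ 2)%:E)%E.
Proof.
move=> lr mf fi; have mf2 : measurable_fun setT (fun x => ((f x) ^+ 2)%:E).
  by apply/measurable_EFinP; exact: measurable_funX.
have I0 : (0 <= \int[mu]_(x in `[l, r]) ((f x) ^+ 2)%:E)%E.
  by apply: integral_ge0 => x _; rewrite lee_fin sqr_ge0.
have [fin|] := ltP (\int[mu]_(x in `[l, r]) ((f x) ^+ 2)%:E)%E +oo%E; last first.
  by rewrite leye_eq => /eqP ->; rewrite leey.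
have i2 : mu.-integrable `[l, r] (EFin \o (fun x => f x ^+ 2)).
  apply/integrableP; split; first exact: measurable_funTS.
  apply: le_lt_trans fin; rewrite le_eqVlt; apply/orP; left; apply/eqP.
  by apply: eq_integral => x _ /=; rewrite ger0_norm ?sqr_ge0.
have L0 : 0 < r - l by rewrite subr_gt0.
set I := \int[mu]_(x in `[l, r]) f x; pose m := I / (r - l).
have ic (c : R) : mu.-integrable `[l, r] (EFin \o cst c).
  by apply: continuous_itv_integrable => ?; exact: cvg_cst.
have imf : mu.-integrable `[l, r] (EFin \o (fun x => 2 * m * f x)).
  by apply: eq_integrable (integrableZl _ (2 * m) fi).
have iD : mu.-integrable `[l, r] (EFin \o (fun x => m ^+ 2 + f x ^+ 2)).
  by apply: eq_integrable (integrableD _ (ic (m ^+ 2)) i2).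
have : \int[mu]_(x in `[l, r]) (2 * m * f x) <= \int[mu]_(x in `[l, r]) (m ^+ 2 + f x ^+ 2).
  apply: le_Rintegral => // x _; have := sqr_ge0 (m - f x); rewrite sqrrB; lra.
rewrite RintegralZl// -/I (RintegralD _ (ic (m ^+ 2)) i2)// Rintegral_cst//=.
rewrite lebesgue_measure_itv /= lte_fin lr -EFinB /= => H.
rewrite -EFin_Rintegral// lee_fin.
have -> : I ^+ 2 / (r - l) = m ^+ 2 * (r - l) by rewrite /m; field; rewrite gt_eqF.
have e : 2 * m * I = 2 * (m ^+ 2 * (r - l)) by rewrite /m; field; rewrite gt_eqF.
by rewrite e in H; lra.
Qed.

Variables (rho f : 'I_d -> R -> R).
Hypothesis Hrho : forall i, AC_loc (rho i) (fun s => - f i s).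
Hypothesis mf : forall i, measurable_fun setT (f i).
Hypothesis pf : forall i, periodic1 (f i).

Lemma vnorm_continuous : continuous (fun s => vnorm (rho ^~ s)).
Proof.
move=> s; apply: continuous_cvg; first exact: sqrt_continuous.
by apply: cvg_bigsum => i; apply: cvg_sqr; exact: AC_continuous (Hrho i) s.
Qed.

(** On a cell the increment of |rho| is at most the length of the increment of rho, and
    Cauchy-Schwarz bounds the latter by the local integral of |f|^2. Thus |rho| inherits the H^1
    bound of rho although the norm is not smooth at 0. *)
Lemma vnorm_dq_le n N : (\int[mu]_(s in W N) ((diff_quot (fun s => vnorm (rho ^~ s)) n s) ^+ 2)%:E <=
  \int[mu]_(s in `[0%R, 1%R]) (\sum_i f i s ^+ 2)%:E * (2 * N%:R)%:E)%E.
Proof.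
set w := fun s => vnorm (rho ^~ s); pose G s := \sum_i f i s ^+ 2.
have mG : measurable_fun setT (fun s => (G s)%:E).
  by apply/measurable_EFinP; apply: measurable_sum => i; exact: measurable_funX.
have G0 s : (0 <= (G s)%:E)%E by rewrite lee_fin sumr_ge0// => i _; exact: sqr_ge0.
have pG s : (G (s + 1))%:E = (G s)%:E.
  by congr EFin; apply: eq_bigr => i _; rewrite pf.
apply: le_trans (ge0_periodic_window N mG G0 pG).
have mw : measurable_fun setT (fun s => ((diff_quot w n s) ^+ 2)%:E).
  apply/measurable_EFinP; apply: measurable_funX; apply: measurable_diff_quot1.
  exact: vnorm_continuous.
have [k [j ->]] := @window_cells R n N.
apply: cells_integral_le => // [s|{j}k]; first by rewrite lee_fin sqr_ge0.
set l := k%:~R * h n; have hn := dyadic_step_gt0 R n.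
have lr : l < l + h n by rewrite ltrDl.
pose c := (w (l + h n) - w l) / h n.
have -> : (\int[mu]_(x in cell n k) ((diff_quot w n x) ^+ 2)%:E = (c ^+ 2 * h n)%:E)%E.
  transitivity (\int[mu]_(x in cell n k) (cst (c ^+ 2)%:E x))%E.
    apply: eq_integral => x /set_mem xk; rewrite /diff_quot (cell_leftE xk)//.
  by rewrite integral_cst; [rewrite [X in (_ * X)%E]mu_cell|exact: measurable_cell].
have -> : (\int[mu]_(x in cell n k) (G x)%:E = \int[mu]_(x in `[l, (l + h n)%R]) (G x)%:E)%E.
  by rewrite /cell -/l integral_itv_bndo_bndc//; exact: measurable_funTS.
have f2 i : measurable_fun setT (fun x => ((f i x) ^+ 2)%:E).
  by apply/measurable_EFinP; exact: measurable_funX.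
have -> : (\int[mu]_(x in `[l, (l + h n)%R]) (G x)%:E =
    \sum_i \int[mu]_(x in `[l, (l + h n)%R]) ((f i x) ^+ 2)%:E)%E.
  transitivity (\int[mu]_(x in `[l, (l + h n)%R]) (\sum_i ((f i x) ^+ 2)%:E))%E.
    by apply: eq_integral => x _; rewrite sumEFin.
  rewrite ge0_integral_sum// => [i|i x _]; last by rewrite lee_fin sqr_ge0.
  by apply: measurable_funTS; exact: f2.
have ci : c ^+ 2 * h n <= \sum_i (rho i (l + h n) - rho i l) ^+ 2 / (l + h n - l).
  rewrite -mulr_suml addrAC subrr add0r -[\sum_i _]/(sqnorm (fun i => rho i (l + h n) - rho i l)).
  rewrite /c expr_div_n -mulrA ler_pdivlMr// -mulrA.
  have -> : (h n ^+ 2)^-1 * h n * h n = 1 by field; rewrite gt_eqF.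
  rewrite mulr1 -vnorm_sqr -[leLHS]real_normK ?num_real// ler_sqr ?nnegrE ?vnorm_ge0//.
  exact: vnormB_le.
apply: (@le_trans _ _ (\sum_i ((rho i (l + h n) - rho i l) ^+ 2 / (l + h n - l))%:E)%E).
  by rewrite sumEFin lee_fin.
apply: lee_sum => i _; have [fi ->] := Hrho i (ltW lr).
have mNf : measurable_fun setT (fun s => - f i s) by exact: measurableT_comp.
apply: (le_trans (Rintegral_sqr_le lr mNf fi)).
by rewrite le_eqVlt; apply/orP; left; apply/eqP; apply: eq_integral => x _; rewrite sqrrN.
Qed.

End NormOfCurve.

Section Bounds.
Variables (R : realType) (d : nat).
Local Notation mu := (@lebesgue_measure R).
Local Notation W := (@window R).
Local Notation nrm := (seminorm (@cdot R d)).

Lemma locally_int_sqr (f : R -> R) : measurable_fun setT f ->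
  (forall N, (\int[mu]_(s in W N) ((f s) ^+ 2)%:E < +oo)%E) -> locally_int f.
Proof.
move=> mf fin a b; have [N hN] := itv_window a b.
have mf2 : measurable_fun setT (fun x => ((f x) ^+ 2)%:E).
  by apply/measurable_EFinP; exact: measurable_funX.
have ic : mu.-integrable `[a, b] (EFin \o cst (1 : R)).
  by apply: continuous_itv_integrable => ?; exact: cvg_cst.
have i2 : mu.-integrable `[a, b] (EFin \o (fun x => f x ^+ 2)).
  apply/integrableP; split; first exact: measurable_funTS.
  apply: le_lt_trans (fin N).
  under eq_integral do rewrite /= ger0_norm ?sqr_ge0//.
  apply: ge0_subset_integral => //.
  - exact: measurable_window.
  - exact: measurable_funTS.
  - by move=> x _; rewrite lee_fin sqr_ge0.
have iD : mu.-integrable `[a, b] (EFin \o (fun x => 1 + f x ^+ 2)).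
  by apply: eq_integrable (integrableD _ ic i2).
apply: (@le_integrable _ _ _ _ _ _ _ _ _ _ iD) => //.
- by apply/measurable_EFinP; exact: measurable_funTS.
- move=> s _ /=; rewrite lee_fin [leRHS]ger0_norm ?addr_ge0 ?sqr_ge0//.
  rewrite ler_norml; have := sqr_ge0 (f s - 1); have := sqr_ge0 (f s + 1).
  rewrite sqrrD sqrrB; have := sqr_ge0 (f s); lra.
Qed.

(** Within a period |x(s) - x(u)| <= 1, so x(s)^2 <= 2 x(u)^2 + 2; integrating in u and using |y| <=
    y^2 + 1 gives the constants 2 and 3. *)
Lemma Lip1_bound (x : curve R d) i s : Lip1 x -> 0 <= s <= 1 ->
  `|cv x i s| <= 2 * nrm x ^+ 2 + 3.
Proof.
move=> Kx s01; have cx := @curve_continuous R d x i.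
have i2 : mu.-integrable `[0, 1] (EFin \o (fun u => 2 * cv x i u ^+ 2 + 2)).
  apply: continuous_itv_integrable => u; apply: cvgD; last exact: cvg_cst.
  by apply: cvgMr; apply: cvg_sqr; exact: cx.
have i3 : mu.-integrable `[0, 1] (EFin \o (fun u => 2 * cv x i u ^+ 2)).
  by apply: continuous_itv_integrable => u; apply: cvgMr; apply: cvg_sqr; exact: cx.
have i1 : mu.-integrable `[0, 1] (EFin \o (fun u => cv x i u ^+ 2)).
  by apply: continuous_itv_integrable => u; apply: cvg_sqr; exact: cx.
have : \int[mu]_(u in `[0, 1]) (cv x i s ^+ 2) <= \int[mu]_(u in `[0, 1]) (2 * cv x i u ^+ 2 + 2).
  apply: le_Rintegral => //; first exact: integrable01_cst.
  move=> u; rewrite /= in_itv /= => u01.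
  have su : `|s - u| <= 1 by rewrite ler_distl; lra.
  have := le_trans (Lip1_comp i s u Kx) su.
  rewrite -ler_sqr ?nnegrE// real_normK ?num_real// expr1n => h1.
  by have := sqr_ge0 (cv x i s - 2 * cv x i u); move: h1; rewrite !sqrrB exprMn; lra.
rewrite Rintegral01_cst (RintegralD _ i3 (integrable01_cst 2))// Rintegral01_cst RintegralZl//.
have : \int[mu]_(u in `[0, 1]) (cv x i u ^+ 2) <= nrm x ^+ 2.
  rewrite (nrmE (@cdotC R d) (@cdot_ge0 R d)); apply: le_Rintegral => //; first exact: dotp_integrable.
  by move=> u _; rewrite dotpp; exact: (sqnorm_le_comp (fun i => cv x i u)).
have := sqr_ge0 (cv x i s - 1); have := sqr_ge0 (cv x i s + 1); rewrite sqrrB sqrrD.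
rewrite ler_norml; have := sqr_ge0 (nrm x); lra.
Qed.

Lemma diff_quot_sqnorm (x : curve R d) n s : Lip1 x ->
  sqnorm (fun i => diff_quot (cv x i) n s) <= 1.
Proof.
move=> [_ L]; set l := cell_left n s; have hn := dyadic_step_gt0 R n.
rewrite (_ : sqnorm _ = sqnorm (fun i => cv x i (l + dyadic_step R n) - cv x i l) / dyadic_step R n ^+ 2).
  rewrite ler_pdivrMr ?exprn_gt0// mul1r; apply: (le_trans (L _ _)).
  by rewrite addrAC subrr add0r.
by rewrite /sqnorm mulr_suml; apply: eq_bigr => i _; rewrite /diff_quot expr_div_n.
Qed.

End Bounds.

(** * Tension along the flow and verification of the equations *)

Section Assembly.
Variables (R : realType) (d : nat).
Local Notation mu := (@lebesgue_measure R).
Local Notation mu2 := ((@lebesgue_measure R) \x (@lebesgue_measure R))%E.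
Local Notation W := (@window R).
Local Notation nrm := (seminorm (@cdot R d)).
Variables (X : R -> curve R d) (xis xit : 'I_d -> R -> R -> R) (A : set R).
Hypothesis KX : forall t, Lip1 (X t).
Hypothesis X_norm : forall t, 0 <= t -> nrm (X t) <= expR t * nrm (X 0).
Hypothesis mX : forall i, measurable_fun setT (uncurry2 (pos X i)).
Hypothesis mxis : forall i, measurable_fun setT (uncurry2 (xis i)).
Hypothesis xis1 : forall t s, sqnorm (fun i => xis i t s) <= 1.
Hypothesis mxit : forall i, measurable_fun setT (uncurry2 (xit i)).
Hypothesis pxit : forall i t, periodic1 (xit i t).
Hypothesis xit_L2 : forall i, L2loc (xit i).
Hypothesis xit_AC : {ae mu, forall s, forall i, AC_loc (fun t => pos X i t s) (fun t => xit i t s)}.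
(* [A] is a set of good times; at other times everything is replaced by 0, so that
   the fixed-time results apply at every time. *)
Hypothesis mA : @measurable _ (measurableTypeR R) A.
Hypothesis A_pos : forall t, A t -> 0 < t.
Hypothesis A_ae : {ae mu, forall t, 0 < t -> A t}.
Hypothesis A_xis : forall t, A t -> forall i, AC_loc (pos X i t) (xis i t).
Hypothesis A_loc : forall t, A t -> forall i, locally_int (xit i t).
Hypothesis A_sq : forall t, A t -> forall i, sqint (xit i t).
Hypothesis A_energy : forall t, A t -> \sum_i \int[mu]_(s in `[0, 1]) (xit i t s ^+ 2) <=
  \sum_i \int[mu]_(s in `[0, 1]) (xit i t s * pos X i t s).
Hypothesis A_cone : forall t, A t -> forall w, Lip1 w ->
  \sum_i \int[mu]_(s in `[0, 1]) ((pos X i t s - xit i t s) * (cv w i s - pos X i t s)) <= 0.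

Let one t : R := \1_A t.
Let oneT t : A t -> one t = 1. Proof. by move=> At; rewrite /one indicE mem_set. Qed.
Let oneF t : ~ A t -> one t = 0. Proof. by move=> At; rewrite /one indicE memNset. Qed.
Let m1 : measurable_fun setT (fun z : R * R => one z.1).
Proof.
have h : measurable_fun setT one by exact: measurable_indic.
exact: (measurableT_comp h measurable_fst).
Qed.

Let f i t s := one t * (pos X i t s - xit i t s).
Let x t := if `[< A t >] then X t else 0.
Let xs i t s := one t * xis i t s.

Let fF t : ~ A t -> forall i, f i t = fun=> 0.
Proof. by move=> At i; apply/funext => s; rewrite /f oneF// mul0r. Qed.
Let fT t : A t -> forall i, f i t = fun s => pos X i t s - xit i t s.
Proof. by move=> At i; apply/funext => s; rewrite /f oneT// mul1r. Qed.

Let mf i : measurable_fun setT (uncurry2 (f i)).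
Proof. by apply: (measurable_funM m1); apply: measurable_funB; [exact: mX|exact: mxit]. Qed.

Let cX i t : continuous (pos X i t). Proof. exact: curve_continuous. Qed.

Let lf i t : locally_int (f i t).
Proof.
move=> a b; have [At|nAt] := pselect (A t); last first.
  by rewrite fF//; apply: continuous_itv_integrable => ?; exact: cvg_cst.
rewrite fT//; have i1 : mu.-integrable `[a, b] (EFin \o pos X i t).
  exact: continuous_itv_integrable (@cX i t).
by apply: eq_integrable (integrableB _ i1 (A_loc At i a b)).
Qed.

Let pf i t : periodic1 (f i t).
Proof. by move=> s; rewrite /f /pos (KX t).1 pxit. Qed.

Let Kx t : Lip1 (x t).
Proof. by rewrite /x; case: ifP => _; [exact: KX|exact: Lip1_0]. Qed.

Let Hx i t : AC_loc (cv (x t) i) (xs i t).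
Proof.
rewrite /x; case: asboolP => At.
  rewrite (_ : xs i t = xis i t); first exact: A_xis.
  by apply/funext => s; rewrite /xs oneT// mul1r.
rewrite (_ : xs i t = fun=> 0); last by apply/funext => s; rewrite /xs oneF// mul0r.
move=> a b ab; split.
  by apply: continuous_itv_integrable => ?; exact: cvg_cst.
by rewrite !curve0 subrr Rintegral_cst// mul0r.
Qed.

Let mxs i t : measurable_fun setT (xs i t).
Proof.
apply: measurable_funM => //.
exact: (measurableT_comp (mxis i) (pair1_measurable t)).
Qed.

Let xs1 t s : sqnorm (fun i => xs i t s) <= 1.
Proof.
have [At|nAt] := pselect (A t).
  have -> : (fun i => xs i t s) = fun i => xis i t s; last exact: xis1.
  by apply/funext => i; rewrite /xs oneT// mul1r.
rewrite /sqnorm big1 ?ler01// => i _; by rewrite /xs oneF// mul0r expr0n.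
Qed.

Let cone t w : Lip1 w ->
  \sum_i \int[mu]_(s in `[0, 1]) (f i t s * (cv w i s - cv (x t) i s)) <= 0.
Proof.
move=> Kw; have [At|nAt] := pselect (A t).
  rewrite /x asboolT//; have := A_cone At Kw.
  suff -> : \sum_i \int[mu]_(s in `[0, 1]) (f i t s * (cv w i s - cv (X t) i s)) =
    \sum_i \int[mu]_(s in `[0, 1]) ((pos X i t s - xit i t s) * (cv w i s - pos X i t s)) by [].
  by apply: eq_bigr => i _; rewrite fT.
rewrite big1// => i _; rewrite fF//.
transitivity (\int[mu]_(s in `[0, 1]) (0 : R)); last exact: Rintegral01_cst.
by apply: eq_Rintegral => s _; rewrite mul0r.
Qed.

Let fsq i t : sqint (f i t).
Proof.
have [At|nAt] := pselect (A t).
  by rewrite fT//; apply: sqintB; [exact/continuous_sqint/cX|exact: A_sq].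
by rewrite fF//; apply: continuous_sqint => ?; exact: cvg_cst.
Qed.

Let B T := (expR T * nrm (X 0)) ^+ 2.
Let B0 T : 0 <= B T. Proof. exact: sqr_ge0. Qed.

(** In the expansion of |X - xit|^2 the energy inequality bounds - 2 <xit, X> + |xit|^2 by - |xit|^2
    <= 0. The force is thus no larger than the curve in L^2, uniformly on bounded times, and all
    bounds on the tension follow from this. *)
Let f_total t T : t <= T -> \sum_i \int[mu]_(s in `[0, 1]) f i t s ^+ 2 <= B T.
Proof.
move=> tT; have [At|nAt] := pselect (A t); last first.
  rewrite big1// => i _; rewrite fF//.
  transitivity (\int[mu]_(s in `[0, 1]) (0 : R)); last exact: Rintegral01_cst.
  by apply: eq_Rintegral => s _; rewrite expr0n.
have t0 := A_pos At.
have sqX i : sqint (pos X i t) by exact/continuous_sqint/cX.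
have E i : \int[mu]_(s in `[0, 1]) f i t s ^+ 2 = \int[mu]_(s in `[0, 1]) pos X i t s ^+ 2 -
    2 * \int[mu]_(s in `[0, 1]) (xit i t s * pos X i t s) + \int[mu]_(s in `[0, 1]) xit i t s ^+ 2.
  have := Rintegral_sqD (-1) (sqX i) (A_sq At i).
  have -> : \int[mu]_(s in `[0, 1]) (pos X i t s + -1 * xit i t s) ^+ 2 =
      \int[mu]_(s in `[0, 1]) f i t s ^+ 2.
    by apply: eq_Rintegral => s _; rewrite fT// mulN1r.
  have -> : \int[mu]_(s in `[0, 1]) (pos X i t s * xit i t s) =
      \int[mu]_(s in `[0, 1]) (xit i t s * pos X i t s).
    by apply: eq_Rintegral => s _; rewrite mulrC.
  by move=> ->; ring.
rewrite (eq_bigr _ (fun i _ => E i)) big_split sumrB /= -mulr_sumr.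
have nX : \sum_i \int[mu]_(s in `[0, 1]) pos X i t s ^+ 2 = nrm (X t) ^+ 2.
  rewrite (nrmE (@cdotC R d) (@cdot_ge0 R d)) cdot_sum; apply: eq_bigr => i _.
  by apply: eq_Rintegral => s _; rewrite expr2.
have nB : nrm (X t) ^+ 2 <= B T.
  rewrite /B ler_pXn2r ?nnegrE ?mulr_ge0 ?expR_ge0 ?nrm_ge0//.
  apply: (le_trans (X_norm (ltW t0))); rewrite ler_wpM2r ?nrm_ge0//.
  by rewrite ler_expR.
rewrite nX; have := A_energy At.
have : 0 <= \sum_i \int[mu]_(s in `[0, 1]) xit i t s ^+ 2.
  by apply: sumr_ge0 => i _; apply: Rintegral_ge0 => s _; exact: sqr_ge0.
by move: (\sum_i _) (\sum_i _) => p q; lra.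
Qed.

Let f_sq t T j : t <= T -> \int[mu]_(s in `[0, 1]) f j t s ^+ 2 <= B T.
Proof.
move=> tT; apply: le_trans (f_total tT); rewrite (bigD1 j)//= lerDl.
by apply: sumr_ge0 => i _; apply: Rintegral_ge0 => s _; exact: sqr_ge0.
Qed.

Let f_sqE t T j : t <= T -> (\int[mu]_(s in `[0%R, 1%R]) ((f j t s) ^+ 2)%:E <= (B T)%:E)%E.
Proof.
by move=> tT; rewrite -EFin_Rintegral ?lee_fin ?f_sq//; exact: (fsq j t).2.
Qed.

Let f_abs t T j : t <= T -> \int[mu]_(s in `[0, 1]) `|f j t s| <= 1 + B T.
Proof.
move=> tT; have i2 := (fsq j t).2.
have iD : mu.-integrable `[0, 1] (EFin \o (fun s => 1 + f j t s ^+ 2)).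
  by apply: eq_integrable (integrableD _ (integrable01_cst 1) i2).
have ia : mu.-integrable `[0, 1] (EFin \o (fun s => `|f j t s|)).
  exact: integrable_norm (lf j t 0 1).
apply: (@le_trans _ _ (\int[mu]_(s in `[0, 1]) (1 + f j t s ^+ 2))).
  apply: le_Rintegral => // s _; rewrite -[f j t s ^+ 2]real_normK ?num_real//.
  have := sqr_ge0 (`|f j t s| - 1); rewrite sqrrB expr1n; have := normr_ge0 (f j t s).
  by move: (`|_|) => p; have := sqr_ge0 p; lra.
by rewrite (RintegralD _ (integrable01_cst 1) i2)// Rintegral01_cst lerD2l f_sq.
Qed.

Lemma assembly : exists sigma : R -> R -> R,
  generalized_solution (fun i s => pos X i 0 s) (pos X) sigma /\
  (forall t s, 0 <= sigma t s).
Proof.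
have [rho [mrho prho ACrho dirrho brho]] := tension_exists mf lf pf Kx Hx mxs xs1 cone.
pose sigma t s := vnorm (fun i => rho i t s).
(* The bound of [tension_exists] with |f| <= 1 + f^2 integrated over one period. *)
pose M T := 3 * \sum_(j < d) (1 + B T).
have M0 T : 0 <= M T by rewrite mulr_ge0// sumr_ge0// => j _; rewrite addr_ge0.
have bM t T i s : t <= T -> `|rho i t s| <= M T.
  move=> tT; apply: (le_trans (brho i t s)); rewrite ler_wpM2l//.
  by apply: ler_sum => j _; exact: f_abs.
have sqM t T i s : t <= T -> rho i t s ^+ 2 <= M T ^+ 2.
  by move=> tT; rewrite -real_normK ?num_real// ler_pXn2r ?nnegrE// bM.
have msigma : measurable_fun setT (uncurry2 sigma).
  apply: (measurableT_comp (continuous_measurable_fun (@sqrt_continuous R))).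
  by apply: measurable_sum => i; apply: measurable_funX; exact: mrho.
have L2rho i : L2loc (rho i).
  apply: L2loc_bounded => // T T0; exists (M T ^+ 2) => t /andP[_ tT].
  have mr : measurable_fun setT (fun s => ((rho i t s) ^+ 2)%:E).
    apply/measurable_EFinP; apply: measurable_funX.
    exact: (measurableT_comp (mrho i) (pair1_measurable t)).
  apply: (@le_trans _ _ (\int[mu]_(s in `[0%R, 1%R]) (cst (M T ^+ 2)%:E s))%E).
    apply: ge0_le_integral => //.
    - by move=> s _; rewrite lee_fin sqr_ge0.
    - exact: measurable_funTS.
    - by move=> s _; rewrite lee_fin sqM// ltW.
  by rewrite integral_cst//= lebesgue_measure_itv /= lte_fin ltr01 sube0 mule1.
have L2sigma : L2loc sigma.
  split => // T T0.
  have mr i : measurable_fun setT (fun p => ((uncurry2 (rho i) p) ^+ 2)%:E).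
    by apply/measurable_EFinP; apply: measurable_funX; exact: mrho.
  have mQ : measurable (@QT R T) by apply: measurableX; exact: measurable_itv.
  have -> : (\int[mu2]_(p in QT T) ((uncurry2 sigma p) ^+ 2)%:E =
      \sum_i \int[mu2]_(p in QT T) ((uncurry2 (rho i) p) ^+ 2)%:E)%E.
    transitivity (\int[mu2]_(p in QT T) (\sum_i ((uncurry2 (rho i) p) ^+ 2)%:E))%E.
      by apply: eq_integral => p _; rewrite sumEFin /uncurry2 /sigma vnorm_sqr.
    rewrite ge0_integral_sum// => [i|i p _]; last by rewrite lee_fin sqr_ge0.
    by apply: measurable_funTS; exact: mr.
  by apply: lte_sum_pinfty => i _; exact: (L2rho i).2.
have L2tau i : L2loc (fun t s => - f i t s).
  apply: L2loc_bounded => [|T T0].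
    by apply: (measurableT_comp (@oppr_measurable R setT)); exact: mf.
  exists (B T) => t /andP[_ tT].
  by under eq_integral do rewrite sqrrN; apply: f_sqE; exact: ltW.
have csig t : continuous (sigma t) := vnorm_continuous (ACrho^~ t).
have mft i t : measurable_fun setT (f i t).
  exact: (measurableT_comp (mf i) (pair1_measurable t)).
(* The tension is treated as a family with a single component, so that its space derivative comes
   from [sobolev_partial] as well. *)
have sigma_dq N : exists C : R, forall n, (dq_energy (fun _ : 'I_1 => sigma) N n <= C%:E)%E.
  eexists => n; apply: (@sum_window_le _ _ N _ (B N%:R * (2 * N%:R))).
  - move=> _; apply: (@measurable_inner_integral _ (fun z : R * R => ((diff_quot (sigma z.1) n z.2) ^+ 2)%:E)).
    + apply/measurable_EFinP; apply: measurable_funX; exact: measurable_diff_quot msigma.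
    + by move=> z; rewrite lee_fin sqr_ge0.
    + exact: measurable_window.
  - by move=> _ t; apply: integral_ge0 => s _; rewrite lee_fin sqr_ge0.
  - move=> _ t; rewrite /window /= in_itv /= => /andP[_ tN].
    apply: (le_trans (vnorm_dq_le (ACrho^~ t) (mft^~ t) (pf^~ t) n N)).
    rewrite [leRHS]EFinM; apply: lee_wpmul2r; first by rewrite lee_fin mulr_ge0.
    have fi i := (fsq i t).2.
    rewrite -EFin_Rintegral//; last exact: integrable_bigsum fi.
    by rewrite Rintegral_bigsum// lee_fin; apply: f_total; exact: ltW.
have [g [nk [[mg L2g ACg _] _]]] :=
  sobolev_partial (fun _ : 'I_1 => msigma) (fun _ : 'I_1 => csig) sigma_dq.
exists sigma; split; last by move=> t s; exact: vnorm_ge0.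
have rhoE t : A t -> {ae mu, forall s, [set` `[0, 1]] s ->
    forall i, rho i t s = sigma t s * xis i t s}.
  move=> At; apply: (ae_imp _ (dirrho t)) => s hs s01 i.
  by rewrite [LHS](hs s01 i) /xs oneT// mul1r.
have Qprod : @Qinf R = `]0, +oo[%classic `*` `[0, 1]%classic by [].
exists xis, xit, (g ord0), rho, (fun i t s => - f i t s); split; last split.
- split; first by move=> i t; exact: (KX t).1.
  split.
    move=> i; split.
      split=> [|T T0]; first exact: mX.
      exists (2 * B T + 3); apply: aeW => -[t s] [] /=.
      rewrite !in_itv /= => /andP[t0 tT] s01.
      apply: (le_trans (Lip1_bound i (KX t) s01)); rewrite lerD2r ler_pM2l// /B.
      rewrite ler_pXn2r ?nnegrE ?mulr_ge0 ?expR_ge0 ?nrm_ge0//.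
      apply: (le_trans (X_norm (ltW t0))); rewrite ler_wpM2r ?nrm_ge0//.
      by rewrite ler_expR ltW.
    split=> [|T T0]; first exact: mxis.
    exists 1; apply: aeW => -[t s] _ /=.
    rewrite -ler_sqr ?nnegrE// real_normK ?num_real// expr1n.
    by apply: le_trans (xis1 t s); exact: (sqnorm_le_comp (fun i => xis i t s)).
  split; first by apply: (ae_imp _ A_ae) => t At t0; exact/A_xis/At.
  split; first exact: xit_L2.
  split.
    apply: (ae_imp _ xit_AC) => s hs i b c b0 bc; exact: hs.
  split; first by move=> t s; congr vnorm; apply/funext => i; exact: prho.
  split; first exact: L2sigma.
  split; first by apply: L2loc_window; [exact: mg|exact: L2g].
  split; first by apply: (ae_imp _ ACg) => t ht _; exact: ht.
  move=> i; split => //.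
    rewrite Qprod; apply: (@ae_prod_eq _ _ _ (uncurry2 (rho i))
      (fun p => sigma p.1 p.2 * xis i p.1 p.2)) => //.
    + by apply: measurable_funM; [exact: msigma|exact: mxis].
    + apply: (ae_imp _ A_ae) => t At; rewrite /= in_itv /= andbT => t0.
      by apply: (ae_imp _ (rhoE t (At t0))) => s hs s01; exact: hs.
  by apply: aeW => t _; exact: ACrho.
- split.
  (* A sum of squares gathers all components into one scalar identity on the product space. *)
  + pose F (p : R * R) :=
      \sum_i (xit i p.1 p.2 - (- f i p.1 p.2 + pos X i p.1 p.2)) ^+ 2.
    have : {ae mu2, forall p, Qinf p -> F p = cst 0 p}.
      rewrite Qprod; apply: ae_prod_eq => //.
      * apply: measurable_sum => i; apply: measurable_funX; apply: measurable_funB; first exact: mxit.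
        apply: measurable_funD; last exact: mX.
        by apply: (measurableT_comp (@oppr_measurable R setT)); exact: mf.
      * apply: (ae_imp _ A_ae) => t At; rewrite /= in_itv /= andbT => t0.
        apply: aeW => s _; rewrite /F big1// => i _ /=.
        by rewrite (fT (At t0)); ring.
    move=> [N [mN N0 sN]]; exists N; split => // p /= np; apply: sN => /= hp; apply: np => Qp i.
    have /eqP := hp Qp.
    rewrite /F /= psumr_eq0 => [|j _]; last exact: sqr_ge0.
    by move=> /allP /(_ i (mem_index_enum i)); rewrite sqrf_eq0 subr_eq0 => /eqP.
  + rewrite Qprod; apply: (@ae_prod_eq _ _ _
      (fun p => sigma p.1 p.2 * (sqnorm (fun i => xis i p.1 p.2) - 1)) (cst 0)) => //.
    * apply: measurable_funM; first exact: msigma.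
      apply: measurable_funB => //; apply: measurable_sum => i.
      by apply: measurable_funX; exact: mxis.
    * apply: (ae_imp _ A_ae) => t At; rewrite /= in_itv /= andbT => t0.
      apply: (ae_imp _ (rhoE t (At t0))) => s hs s01.
      (* Taking lengths in rho = sigma xis gives sigma^2 = sigma^2 |xis|^2; one factor sigma is then
         removed by distinguishing sigma = 0. *)
      have e : sigma t s * (sigma t s * (sqnorm (fun i => xis i t s) - 1)) = 0.
        have := vnorm_sqr (fun i => rho i t s); rewrite -/(sigma t s).
        have -> : sqnorm (fun i => rho i t s) = sigma t s ^+ 2 * sqnorm (fun i => xis i t s).
          by rewrite /sqnorm mulr_sumr; apply: eq_bigr => i _; rewrite hs// exprMn.
        by move=> e; rewrite mulrA -expr2 mulrBr mulr1 -e subrr.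
      have /eqP := e; rewrite mulf_eq0 => /orP[/eqP ->|/eqP //]; by rewrite mul0r.
  + by apply: aeW => -[t s] _; exact: xis1.
  + by apply: aeW.
- apply: (ae_imp _ A_ae) => t At t0; have {}At := At t0.
  have i1 i := (A_sq At i).2.
  have sqX i : sqint (pos X i t) by exact/continuous_sqint/cX.
  have i2 i := sqint_mul (sqX i) (A_sq At i).
  rewrite /sqnorm /dotp !Rintegral_bigsum//; apply: (le_trans (A_energy At)).
  rewrite le_eqVlt; apply/orP; left; apply/eqP; apply: eq_bigr => i _.
  by apply: eq_Rintegral => s _; rewrite mulrC.
Qed.

End Assembly.

Lemma compressing_path_exists (R : realType) (d : nat) (x0 : curve R d) : Lip1 x0 ->
  exists X : R -> curve R d,
  [/\ forall t, Lip1 (X t), forall t, t <= 0 -> X t = X 0 & forall i s, cv (X 0) i s = cv x0 i s] /\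
  [/\ forall a b w, 0 <= a <= b -> Lip1 w ->
        seminorm (@cdot R d) (X b - w) <= seminorm (@cdot R d) (expR (b - a) *: X a - w),
      forall a b, 0 <= a <= b -> seminorm (@cdot R d) (X b - X a) ^+ 2 <=
        (b - a) / 2 * (seminorm (@cdot R d) (X b) ^+ 2 - seminorm (@cdot R d) (X a) ^+ 2) &
      forall a b, 0 <= a <= b -> seminorm (@cdot R d) (X b - X a) <=
        (expR (b - a) - 1) * seminorm (@cdot R d) (X a)].
Proof.
move=> Kx0.
pose F := flow (@cdotC R d) (@cdotDl R d) (@cdotZl R d) (@cdot_ge0 R d) (@Lip1_0 R d)
  (@Lip1_conv R d) (@Lip1_complete R d) Kx0.
have KF t : Lip1 (F t) by exact: flowK.
(* Freezing the path before time 0 keeps it locally Lipschitz on the whole line, as the quotients on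
   symmetric windows require. *)
exists (fun t => F (Num.max 0 t)).
have mx (t : R) : 0 <= t -> Num.max 0 t = t by move=> t0; rewrite max_r.
have F0 : seminorm (@cdot R d) (F 0 - x0) = 0 by exact: flow0.
have E (a b : R) : 0 <= a <= b -> Num.max 0 a = a /\ Num.max 0 b = b.
  by move=> /andP[a0 ab]; rewrite !mx// (le_trans a0).
split; split.
- by move=> t.
- by move=> t t0; congr F; rewrite maxxx max_l.
(* The scheme fixes the initial curve only up to seminorm 0; [Lip1_sup] at every positive [e]
   upgrades this to pointwise equality. *)
- move=> i s; rewrite (mx 0 (lexx 0)); apply/eqP; rewrite -subr_eq0 -normr_le0.
  apply/ler_addgt0Pr => e e0; rewrite add0r.
  have e1 : 0 < Num.min e 1 <= 1 by rewrite lt_min e0 ltr01 ge_min lexx orbT.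
  apply: (@le_trans _ _ (Num.min e 1)); last by rewrite ge_min lexx.
  apply: (Lip1_sup (KF 0) Kx0 e1).
  by rewrite F0 expr0n divr_gt0// exprn_gt0//; case/andP: e1.
- by move=> a b w ab Kw; have [-> ->] := E a b ab; exact: flow_evi.
- by move=> a b ab; have [-> ->] := E a b ab; exact: flow_energy.
- by move=> a b ab; have [-> ->] := E a b ab; exact: flow_lipschitz.
Qed.

Lemma solution_from_curve (R : realType) (d : nat) (x0 : curve R d) : Lip1 x0 ->
  exists (xi : 'I_d -> R -> R -> R) (sigma : R -> R -> R),
    generalized_solution (fun i s => cv x0 i s) xi sigma /\ (forall t s, 0 <= sigma t s).
Proof.
move=> /compressing_path_exists[X [[KX X_neg X0] [X_evi X_energy X_lip]]].
have mX := measurable_pos KX X_neg X_evi X_lip.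
have [xis [nk1 [[mxis _ AC_xis _] [_ cases1 _]]]] := sobolev_partial mX
  (fun i t => @curve_continuous R d (X t) i) (space_dq_energy KX X_neg X_evi X_lip).
have mXs := measurable_pos_swap KX X_neg X_evi X_lip.
have [g [nk [[mg L2g AC_g close] [nk_ge _ perg]]]] := sobolev_partial mXs
  (fun i s => @path_continuous R d X KX X_neg X_evi X_lip i s) (time_dq_energy KX X_neg X_evi X_lip).
have msw : measurable_fun setT (fun z : R * R => (z.2, z.1)).
  by apply/measurable_fun_pairP; split => /=; [exact: measurable_snd|exact: measurable_fst].
have mgs i : measurable_fun setT (uncurry2 (fun t s => g i s t)).
  exact: (measurableT_comp (mg i) msw).
have mg2 i : measurable_fun setT (fun z : R * R => ((g i z.2 z.1) ^+ 2)%:E).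
  by apply/measurable_EFinP; apply: measurable_funX; exact: mgs.
have L2gs i N : (\int[@lebesgue_measure R]_(t in window N) \int[@lebesgue_measure R]_(s in window N)
    ((g i s t) ^+ 2)%:E < +oo)%E.
  have mW := @measurable_window R N.
  rewrite (integral_swap (mg2 i) (fun z => lee_tofin (sqr_ge0 _)) mW mW) /=; exact: L2g.
pose P t := (forall i, AC_loc (pos X i t) (xis i t)) /\ (forall N, exists C : R, forall i k,
  (\int[@lebesgue_measure R]_(s in window N)
     ((diff_quot (pos X i ^~ s) (nk k) t - g i s t) ^+ 2)%:E <= (C * (9 / 16) ^+ k)%:E)%E) /\
  forall i, locally_int (fun s => g i s t).
have g_loc i : {ae @lebesgue_measure R, forall t, locally_int (fun s => g i s t)}.
  apply: (ae_imp _ (ae_inner_finite (mg2 i) (fun z => lee_tofin (sqr_ge0 _)) (L2gs i))).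
  move=> t ht; apply: locally_int_sqr => //.
  exact: (measurableT_comp (mgs i) (pair1_measurable t)).
have aeP : {ae @lebesgue_measure R, forall t, P t}.
  apply: (ae_imp2 _ AC_xis) => [t h1 h2|]; first by split; [exact: h1|exact: h2].
  apply: (ae_imp2 _ close) => [t h1 h2|]; first by split; [exact: h1|exact: h2].
  exact: filter_forall.
have [N0 [mN0 N00 sN0]] := aeP.
(* Removing a measurable null set that covers the bad times, rather than the bad times themselves,
   makes [A] measurable. *)
pose A : set R := `]0, +oo[%classic `&` ~` N0.
have AP t : A t -> P t.
  by move=> [_ nN]; apply: contrapT => nP; exact: nN (sN0 t nP).
have A_pos t : A t -> 0 < t by move=> [+ _]; rewrite /= in_itv /= andbT.
have A_ae : {ae @lebesgue_measure R, forall t, 0 < t -> A t}.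
  exists N0; split => // t /= h; apply: contrapT => nN; apply: h => t0.
  by split => //=; rewrite in_itv /= t0.
have mA : @measurable _ (measurableTypeR R) A.
  by apply: measurableI; [exact: measurable_itv|exact: measurableC].
have xis1 t s : sqnorm (fun i => xis i t s) <= 1.
  (* The bound holds at every point: the derivative is either 0 in all components or a limit of
     quotients of a 1-Lipschitz curve. *)
  have [z|c] := cases1 t s.
    by rewrite /sqnorm big1 ?ler01// => i _; rewrite z expr0n.
  have cS : sqnorm (fun i => diff_quot (pos X i t) (nk1 k) s) @[k --> \oo] -->
      sqnorm (fun i => xis i t s).
    by apply: cvg_bigsum => i; apply: cvg_sqr; exact: c.
  apply: (cvgr_to_le cS); apply: nearW => k; exact: diff_quot_sqnorm (KX t).
have vel t : A t -> exists C : R, forall i k,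
    (\int[@lebesgue_measure R]_(s in window 2)
     ((diff_quot (pos X i ^~ s) (nk k) t - g i s t) ^+ 2)%:E <= (C * (9 / 16) ^+ k)%:E)%E.
  by move=> /AP[_ [h _]]; exact: h.
have mg1 t i : measurable_fun setT (fun s => g i s t).
  exact: (measurableT_comp (mgs i) (pair1_measurable t)).
have [sigma [gs sigma0]] := @assembly R d X xis (fun i t s => g i s t) A KX
  (fun t => path_norm X_evi (t := t)) mX mxis xis1 mgs
  (* The histories at [s + 1] and [s] are the same functions of time, so the time derivatives built
     from them coincide everywhere. *)
  (fun i t s => congr1 (@^~ t) (perg (s + 1) s (fun i => funext (fun t => (KX t).1 i s)) i))
  (fun i => L2loc_window (mgs i) (L2gs i)) AC_g mA A_pos A_ae
  (fun t At => (AP t At).1) (fun t At => (AP t At).2.2)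
  (fun t At i => let: ex_intro C hC := vel t At in velocity_sqint (mg1 t) hC i)
  (fun t At => let: ex_intro C hC := vel t At in
     velocity_energy X_neg X_evi X_energy X_lip nk_ge (A_pos t At) (mg1 t) hC)
  (fun t At w => let: ex_intro C hC := vel t At in
     @velocity_normal_cone _ _ _ X_neg X_evi X_lip _ _ _ _ nk_ge (A_pos t At) (mg1 t) hC w).
exists (pos X), sigma; split => //.
have -> : (fun i s => cv x0 i s) = fun i s => pos X i 0 s; last exact: gs.
by apply/funext => i; apply/funext => s; rewrite /pos X0.
Qed.

Theorem theorem3p24 (R : realType) (d : nat) (hd : (2 <= d)%N)
    (xi0 xi0s : 'I_d -> R -> R)
    (hper : forall i, periodic1 (xi0 i))
    (hAC : forall i, AC_loc (xi0 i) (xi0s i))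
    (hmeas : forall i, measurable_fun setT (xi0s i))
    (hlip : {ae (@lebesgue_measure R), forall s, sqnorm (fun i => xi0s i s) <= 1}) :
  exists (xi : 'I_d -> R -> R -> R) (sigma : R -> R -> R),
    generalized_solution xi0 xi sigma /\
    {ae ((@lebesgue_measure R) \x (@lebesgue_measure R))%E,
       forall p, Qinf p -> 0 <= sigma p.1 p.2}.
Proof.
pose x0 := mkcurve (fun i => AC_continuous (hAC i)).
have x0E i s : cv x0 i s = xi0 i s by exact: mkcurveE.
(* The a.e. bound on the derivative becomes a Lipschitz condition on all pairs of points, the form
   in which the constraint enters [K]. *)
have Kx0 : Lip1 x0.
  split=> [i s|s t]; first by rewrite !x0E hper.
  have := AC_vector_lipschitz hAC hlip s t.
  by rewrite /sqnorm; under [X in X <= _ -> _]eq_bigr do rewrite -!x0E.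
have [xi [sigma [gs sigma0]]] := solution_from_curve Kx0.
exists xi, sigma; split; last by apply: aeW => p _; exact: sigma0.
have <- : (fun i s => cv x0 i s) = xi0 by apply/funext => i; apply/funext => s.
exact: gs.
Qed.
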